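(* Let $1\le p<\infty$, $a\in L^1(\Omega)$ and $c_1,c_2\ge 0$. For any sequence $(F_h)_h\subseteq\mathcal{V}_{m,p}(a,c_1,c_2)$ there exist a subsequence $(F_{h_k})_k$ and a functional $F\in\mathcal{V}_{m,p}(a,c_1,c_2)$ such that $$F(\cdot,A)=\Gamma(W_X^{1,p})\text{-}\lim_{k\to+\infty}F_{h_k}(\cdot,A)\qquad\text{for any }A\in\mathcal{A}.$$
   Context: Setting. $m,n\in\mathbb{N}\setminus\{0\}$ with $m\le n$; $\Omega\subseteq\mathbb{R}^n$ is open and bounded; $\mathcal{A}$ is the family of all open subsets of $\Omega$. $X=(X_1,\dots,X_m)$ is a family of vector fields $X_j=\sum_{i=1}^n c_{j,i}(x)\partial_i$ with each $c_{j,i}$ Lipschitz on $\Omega$, and $C(x)=[c_{j,i}(x)]$ is the corresponding $m\times n$ matrix. $X$ satisfies the linear independence condition (LIC): the set of $x\in\Omega$ such that $X_1(x),\dots,X_m(x)$ (seen as vectors of $\mathbb{R}^n$) are linearly dependent has Lebesgue measure zero. $X$-gradient and $X$-Sobolev space. For $u\in L^1_{loc}(\Omega)$ the distributional $X$-gradient $Xu$ is defined by $\langle Xu,\varphi\rangle=-\int_\Omega u\,\mathrm{div}(\varphi(x)\cdot C(x))\,dx$ for all $\varphi\in C_c^\infty(\Omega,\mathbb{R}^m)$ ($\varphi$ a row vector). $W_X^{1,p}(\Omega)=\{u\in L^p(\Omega): Xu\in L^p(\Omega,\mathbb{R}^m)\}$ with norm $\|u\|_{W_X^{1,p}(\Omega)}=\|u\|_{L^p(\Omega)}+\|Xu\|_{L^p(\Omega,\mathbb{R}^m)}$.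 Classes of functionals. $F:W_X^{1,p}(\Omega)\times\mathcal{A}\to[0,\infty]$ belongs to $\mathcal{U}_{m,p}(a,c_1,c_2)$ if there exists a Carathéodory function $f:\Omega\times\mathbb{R}\times\mathbb{R}^m\to[0,\infty]$ (measurable in $x$, continuous in $(u,\eta)$ for a.e. $x$) such that $f(x,u,\eta)\le a(x)+c_1|\eta|^p+c_2|u|^p$ for any $(u,\eta)\in\mathbb{R}\times\mathbb{R}^m$ and for a.e. $x\in\Omega$, and $F(u,A)=\int_A f(x,u(x),Xu(x))\,dx$ for any $A\in\mathcal{A}$ and $u\in W_X^{1,p}(\Omega)$. $F$ belongs to $\mathcal{V}_{m,p}(a,c_1,c_2)$ if in addition $f$ can be taken so that $f(x,\cdot,\cdot)$ is convex for a.e. $x\in\Omega$. $\Gamma$-convergence. For functionals $G_h$ on $W_X^{1,p}(\Omega)$, $\Gamma(W_X^{1,p})\text{-}\liminf_h G_h(u)=\inf\{\liminf_h G_h(u_h): u_h\to u \text{ strongly in } W_X^{1,p}(\Omega)\}$ and $\Gamma(W_X^{1,p})\text{-}\limsup_h G_h(u)=\inf\{\limsup_h G_h(u_h): u_h\to u\text{ strongly in }W_X^{1,p}(\Omega)\}$; $G=\Gamma(W_X^{1,p})\text{-}\lim_h G_h$ means both coincide with $G(u)$ for every $u\in W_X^{1,p}(\Omega)$. *)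

(* Defs.v *)
From HB Require Import structures.
From mathcomp Require Import all_boot all_order all_algebra.
From mathcomp Require Import all_classical all_reals all_analysis measurable_realfun.

Set Implicit Arguments.
Unset Strict Implicit.
Unset Printing Implicit Defensive.
Import Order.TTheory GRing.Theory Num.Theory.
Import numFieldNormedType.Exports.

Local Open Scope classical_set_scope.
Local Open Scope ring_scope.

(** ** Lebesgue measure on R^n

    MathComp-Analysis has Lebesgue measure on R only. We take the textbook
    construction on R^n: the outer measure obtained from countable covers by
    half-open boxes, restricted to its Caratheodory-measurable sets.
    Consequently "measurable" below means Lebesgue measurable, and the measure
    is complete. *)

Section cover_outer_measure.
Local Open Scope ereal_scope.
Context {R : realType} {T I : Type} (e : I -> set T) (w : I -> \bar R).

Definition cover_outer (A : set T) : \bar R :=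
  ereal_inf [set \sum_(k <oo) w (s k) |
             s in [set s : nat -> I | A `<=` \bigcup_k e (s k)]].

Hypothesis w_ge0 : forall i, 0 <= w i.
Variable i0 : I.
Hypothesis w_i0 : w i0 = 0.

Lemma le_cover_outer : {homo cover_outer : A B / A `<=` B >-> A <= B}.
Proof.
move=> A B AB; apply/ereal_inf_le_tmp => x [s Bs <-{x}].
by exists s => //; exact: subset_trans AB Bs.
Qed.

Lemma cover_outer_ge0 A : 0 <= cover_outer A.
Proof.
by apply: le_ereal_inf_tmp => x [s As <-{x}]; exact: nneseries_ge0.
Qed.

Lemma cover_outer0 : cover_outer set0 = 0.
Proof.
apply/eqP; rewrite eq_le cover_outer_ge0 andbT.
apply: ereal_inf_lbound; exists (fun=> i0); first by [].
by rewrite eseries0.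
Qed.

Lemma cover_outer_sigma_subadditive : sigma_subadditive cover_outer.
Proof.
move=> A; have [[i ioo]|] := pselect (exists i, cover_outer (A i) = +oo).
  rewrite (eseries_pinfty _ _ ioo) ?leey// => n _.
  by rewrite -ltNye (lt_le_trans _ (cover_outer_ge0 _)).
rewrite -forallNE => Aoo.
suff add2e (eps : {posnum R}) : cover_outer (\bigcup_n A n) <=
    \sum_(i <oo) cover_outer (A i) + eps%:num%:E.
  by apply/lee_addgt0Pr => _/posnumP[].
rewrite (le_trans _ (epsilon_trick _ _ _))//; last first.
  by move=> n; exact: cover_outer_ge0.
pose P n (s : nat -> I) := A n `<=` \bigcup_k e (s k) /\
  \sum_(k <oo) w (s k) <= cover_outer (A n) + (eps%:num / (2 ^ n.+1)%:R)%:E.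
have [G PG] : {G : nat -> nat -> I & forall n, P n (G n)}.
  apply: (@choice _ _ P) => n; rewrite /P /cover_outer.
  set S := (X in ereal_inf X); move infS : (ereal_inf S) => iS.
  case: iS infS => [r Sr|Soo|Soo].
  - have en1 : (0 < eps%:num / (2 ^ n.+1)%:R)%R by [].
    have /(lb_ereal_inf_adherent en1) : ereal_inf S \is a fin_num by rewrite Sr.
    move=> [x [s Ans xS] muBx].
    by exists s; split => //; rewrite xS -Sr; exact/ltW.
  - by have := Aoo n; rewrite /cover_outer Soo.
  - suff : lbound S 0 by move/le_ereal_inf_tmp; rewrite Soo.
    by move=> /= _ [s Ans <-]; exact: nneseries_ge0.
have wG_ge0 x : 0 <= (w \o uncurry G) x by exact: w_ge0.
apply: (@le_trans _ _ (\esum_(i in setT) (w \o uncurry G) i)).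
  apply: ereal_inf_lbound => /=.
  have /card_esym/ppcard_eqP[f] := card_nat2.
  exists (uncurry G \o f).
    move=> t [i _ Ait]; have [j _ Gijt] := (PG i).1 _ Ait.
    by exists (f^-1%FUN (i, j)) => //=; rewrite invK ?inE.
  rewrite -(esum_pred_image (w \o uncurry G) _ xpredT) ?[fun=> _]set_true//.
  by rewrite image_eq.
rewrite (_ : esum _ _ = \sum_(i <oo) \sum_(j <oo ) w (G i j)); last first.
  pose J : nat -> set (nat * nat) := fun i => [set (i, j) | j in setT].
  rewrite (_ : setT = \bigcup_k J k); last first.
    by rewrite predeqE => -[a b]; split => // _; exists a => //; exists b.
  rewrite esum_bigcupT /=; last 2 first.
    - apply/trivIsetP => i j _ _ ij.
      rewrite predeqE => -[n m] /=; split => //= -[] [_] _ [<-{n} _].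
      by move=> [m' _] [] /esym/eqP; rewrite (negbTE ij).
    - by move=> /= [n m]; exact: w_ge0.
  rewrite -(image_id [set: nat]) -fun_true esum_pred_image//; last first.
    by move=> n _; exact: esum_ge0.
  apply: eq_eseriesr => /= j _.
  rewrite -(esum_pred_image (w \o uncurry G) (pair j) predT)//=; last first.
    by move=> ? ? _ _; exact: (@can_inj _ _ _ snd).
  by congr esum; rewrite predeqE => -[a b]; split; move=> [i _ <-]; exists i.
apply: lee_lim.
- apply: is_cvg_nneseries => n *.
  by apply: nneseries_ge0 => m *; exact: (wG_ge0 (n, m)).
- by apply: is_cvg_nneseries => n *; apply: adde_ge0 => //; exact: cover_outer_ge0.
- by near=> n; apply: lee_sum => i _; exact: (PG i).2.
Unshelve. all: by end_near. Qed.

End cover_outer_measure.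

Section lebesgue_measure_rV.
Context (R : realType) (n : nat).

(** [None] stands for the empty set, so that finite covers are allowed. *)
Definition box (ab : option ('rV[R]_n * 'rV[R]_n)) : set 'rV[R]_n :=
  if ab is Some (a, b) then
    [set x | forall i, a ord0 i < x ord0 i <= b ord0 i]
  else set0.

Definition box_volume (ab : option ('rV[R]_n * 'rV[R]_n)) : \bar R :=
  if ab is Some (a, b) then
    (\prod_(i < n) Num.max 0 (b ord0 i - a ord0 i))%:E
  else 0%E.

Lemma box_volume_ge0 ab : (0 <= box_volume ab)%E.
Proof.
case: ab => [[a b]|//]; rewrite lee_fin.
by apply: prodr_ge0 => i _; rewrite le_max lexx.
Qed.

Definition lebesgue_outer : set 'rV[R]_n -> \bar R :=
  cover_outer box box_volume.

HB.instance Definition _ := isOuterMeasure.Build R 'rV[R]_n lebesgue_outer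
  (@cover_outer0 _ _ _ box box_volume box_volume_ge0 None erefl)
  (@cover_outer_ge0 _ _ _ box box_volume box_volume_ge0)
  (@le_cover_outer _ _ _ box box_volume)
  (@cover_outer_sigma_subadditive _ _ _ box box_volume box_volume_ge0).

Let outer : {outer_measure set 'rV[R]_n -> \bar R} := lebesgue_outer.

(** 'rV[R]_n equipped with its Lebesgue sigma-algebra *)
Definition rVleb := caratheodory_type outer.
HB.instance Definition _ := Measurable.on rVleb.

Definition leb : {measure set rVleb -> \bar R} :=
  [the {measure set (caratheodory_type outer) -> \bar R} of
    (outer : set (caratheodory_type outer) -> \bar R)].

End lebesgue_measure_rV.
Arguments rVleb : clear implicits.
Arguments leb : clear implicits.

(** ** Vectors, Lebesgue spaces, test functions *)

(** Euclidean norm; the norm of the library on 'rV[R]_m is the sup norm. *)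
Definition enorm (R : realType) (m : nat) (v : 'rV[R]_m) : R :=
  Num.sqrt (\sum_(j < m) v ord0 j ^+ 2).

Section function_spaces.
Context (R : realType) (n : nat) (Omega : set 'rV[R]_n).

(** Functions on Omega are modelled by total functions on R^n whose values
    outside Omega are irrelevant. *)

Definition Lp_norm (p : R) (w : 'rV[R]_n -> R) : \bar R :=
  ('N[leb R n]_(p%:E) [EFin \o (w \_ Omega)])%E.

Definition in_Lp (p : R) (w : 'rV[R]_n -> R) : Prop :=
  measurable_fun (Omega : set (rVleb R n)) w /\ (Lp_norm p w < +oo)%E.

Definition in_Lp_vec (m : nat) (p : R) (g : 'rV[R]_n -> 'rV[R]_m) : Prop :=
  (forall j, measurable_fun (Omega : set (rVleb R n)) (fun x => g x ord0 j)) /\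
  (Lp_norm p (@enorm R m \o g) < +oo)%E.

Definition in_L1loc (w : 'rV[R]_n -> R) : Prop :=
  measurable_fun (Omega : set (rVleb R n)) w /\
  forall K, compact K -> K `<=` Omega ->
    (leb R n).-integrable K (EFin \o w : rVleb R n -> \bar R).

Definition partial (W : normedModType R) (i : 'I_n) (f : 'rV[R]_n -> W) :
    'rV[R]_n -> W :=
  fun x => 'D_(delta_mx ord0 i) f x.

(** [foldr (@partial _) f s] is the iterated partial derivative along the
    multi-index listed by s. *)
Definition smooth (W : normedModType R) (f : 'rV[R]_n -> W) : Prop :=
  forall s : seq 'I_n,
    continuous (foldr (@partial W) f s) /\
    forall i x, derivable (foldr (@partial W) f s) x (delta_mx ord0 i).

Definition test_fun (m : nat) (phi : 'rV[R]_n -> 'rV[R]_m) : Prop :=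
  [/\ smooth phi,
      compact (closure [set x | phi x != 0]) &
      closure [set x | phi x != 0] `<=` Omega].

(** 'D_v is total, with a default value where the limit does not exist. The
    fields phi *m C below are Lipschitz, so this only concerns a null set. *)
Definition divergence (V : 'rV[R]_n -> 'rV[R]_n) (x : 'rV[R]_n) : R :=
  \sum_(i < n) partial i (fun y => V y ord0 i) x.

End function_spaces.

(** ** The X-gradient and the X-Sobolev space

    The family X = (X_1, ..., X_m) is given by its coefficient matrix C:
    the vector X_j(x) is the j-th row of C x. *)

Section sobolev.
Context (R : realType) (m n : nat).
Variables (Omega : set 'rV[R]_n) (C : 'rV[R]_n -> 'M[R]_(m, n)).

Definition LIC : Prop :=
  (leb R n).-negligible ([set x | Omega x /\ ~~ row_free (C x)]).

(** The distribution Xu is represented by the locally integrable function g. *)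
Definition is_Xgrad (u : 'rV[R]_n -> R) (g : 'rV[R]_n -> 'rV[R]_m) : Prop :=
  [/\ in_L1loc Omega u,
      forall j, in_L1loc Omega (fun x => g x ord0 j) &
      forall phi : 'rV[R]_n -> 'rV[R]_m, test_fun Omega phi ->
        (\int[leb R n]_(x in Omega)
            (\sum_(j < m) g x ord0 j * phi x ord0 j)%:E =
         - \int[leb R n]_(x in Omega)
            (u x * divergence (fun y => phi y *m C y) x)%:E)%E].

(** Representatives g of Xu are unique up to a null set, and the set of them
    depends on u only through its class modulo a.e. equality; [Xgrad u] picks
    one of them. *)
Definition Xgrad (u : 'rV[R]_n -> R) : 'rV[R]_n -> 'rV[R]_m :=
  xget (fun=> 0) [set g | is_Xgrad u g].

Definition W1p (p : R) : set ('rV[R]_n -> R) :=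
  [set u | in_Lp Omega p u /\
           exists g, is_Xgrad u g /\ in_Lp_vec Omega p g].

Definition W1p_norm (p : R) (u : 'rV[R]_n -> R) : \bar R :=
  (Lp_norm Omega p u + Lp_norm Omega p (@enorm R m \o Xgrad u))%E.

Definition W1p_cvg (p : R) (us : nat -> 'rV[R]_n -> R) (u : 'rV[R]_n -> R) :
    Prop :=
  (fun h => W1p_norm p (us h \- u)) @ \oo --> 0%E.

(** ** Integrands and the class V_{m,p}(a, c1, c2) *)

Definition caratheodory_fun (f : 'rV[R]_n -> R -> 'rV[R]_m -> \bar R) : Prop :=
  (forall u eta,
     measurable_fun (Omega : set (rVleb R n)) (fun x => f x u eta)) /\
  {ae leb R n, forall x, Omega x ->
     continuous (fun z : R * 'rV[R]_m => f x z.1 z.2)}.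

Definition growth (p : R) (a : 'rV[R]_n -> R) (c1 c2 : R)
    (f : 'rV[R]_n -> R -> 'rV[R]_m -> \bar R) : Prop :=
  forall u eta, {ae leb R n, forall x, Omega x ->
    (f x u eta <= (a x + c1 * enorm eta `^ p + c2 * `|u| `^ p)%:E)%E}.

Definition convex_integrand (f : 'rV[R]_n -> R -> 'rV[R]_m -> \bar R) : Prop :=
  {ae leb R n, forall x, Omega x ->
    forall (t : R) (u v : R) (xi eta : 'rV[R]_m), 0 <= t <= 1 ->
      (f x (t * u + (1 - t) * v)%R (t *: xi + (1 - t) *: eta)%R <=
       t%:E * f x u xi + (1 - t)%:E * f x v eta)%E}.

(** A functional on W1p x (open subsets of Omega) is a total function, only
    its values on these arguments being relevant. *)
Definition functional := ('rV[R]_n -> R) -> set 'rV[R]_n -> \bar R.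

Definition class_V (p : R) (a : 'rV[R]_n -> R) (c1 c2 : R) : set functional :=
  [set F | exists f : 'rV[R]_n -> R -> 'rV[R]_m -> \bar R,
    [/\ forall x u eta, Omega x -> (0 <= f x u eta)%E,
        caratheodory_fun f,
        growth p a c1 c2 f,
        convex_integrand f &
        forall u A, W1p p u -> open A -> A `<=` Omega ->
          F u A = (\int[leb R n]_(x in A) f x (u x) (Xgrad u x))%E]].

(** ** Gamma-convergence in the strong topology of W1p *)

Definition approx (p : R) (u : 'rV[R]_n -> R) :
    set (nat -> 'rV[R]_n -> R) :=
  [set us | (forall h, W1p p (us h)) /\ W1p_cvg p us u].

Definition Gamma_liminf (p : R) (G : nat -> ('rV[R]_n -> R) -> \bar R)
    (u : 'rV[R]_n -> R) : \bar R :=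
  ereal_inf [set limn_einf (fun h => G h (us h)) | us in approx p u].

Definition Gamma_limsup (p : R) (G : nat -> ('rV[R]_n -> R) -> \bar R)
    (u : 'rV[R]_n -> R) : \bar R :=
  ereal_inf [set limn_esup (fun h => G h (us h)) | us in approx p u].

Definition Gamma_lim (p : R) (G : nat -> ('rV[R]_n -> R) -> \bar R)
    (Ginf : ('rV[R]_n -> R) -> \bar R) : Prop :=
  forall u, W1p p u ->
    Gamma_liminf p G u = Ginf u /\ Gamma_limsup p G u = Ginf u.

End sobolev.

(* Main.v *)
From HB Require Import structures.
Require Import Defs.
From mathcomp Require Import all_boot all_order all_algebra.
From mathcomp Require Import all_classical all_reals all_analysis measurable_realfun.
From mathcomp Require Import ring lra.

Set Implicit Arguments.
Unset Strict Implicit.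
Unset Printing Implicit Defensive.
Import Order.TTheory GRing.Theory Num.Theory.
Import numFieldNormedType.Exports.

Local Open Scope classical_set_scope.
Local Open Scope ring_scope.

(** Gamma-convergence is nothing but pointwise convergence here. A functional
    of the class sees u only through the pair w = (u, Xu), an L^p map into
    R x R^m, and its integrand f x is convex with 0 <= f x z <= a x + K |z|^p.
    A convex function with such a growth has a modulus of continuity that
    depends on the growth alone ([convex_modulus]), so the functionals
    w |-> \int_A f x (w x) are equicontinuous on L^p, uniformly in f and A
    ([equicontinuous_admissible]). As convergence in W_X^{1,p} is L^p
    convergence of the pairs, F_h(u_h, A) and F_h(u, A) have the same limit for
    every sequence u_h --> u ([cvg_integral_approx]), and both Gamma-limits
    reduce to the limit of F_h(u, A) ([Gamma_lim_of_cvg]).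

    What remains is to extract a subsequence along which the integrals converge
    at every w to those of an integrand of the same kind
    ([admissible_compactness]). For a constant w = z the functions f_h(., z) are
    dominated by one integrable function. A diagonal extraction makes their
    integrals converge over a countable family of sets, dense for the measure of
    the symmetric difference; by domination they then converge over all
    measurable sets, and the limit has a density g_z ([weak_L1_limit]). This is
    done for all z in a countable dense sequence at once. An inequality between
    integrals over all measurable sets is an inequality between densities almost
    everywhere, so the functions z |-> g_z x inherit the growth bound and a
    convexity inequality, with an error term because convex combinations of
    points of the sequence leave the sequence. Such a function extends to a
    convex function on the whole space ([dense_ext_cvx]), which is the limit
    integrand. Convergence passes from constants to maps with finitely many
    values by splitting the domain, and from these to L^p maps by
    equicontinuity ([cvg_integral_admissible]).

    Comparing the pairs of u_h and u in L^p requires the X-gradient, defined as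
    a chosen representative, to be linear almost everywhere ([ae_XgradB]). This
    follows from the uniqueness of the representative, a form of the lemma of
    du Bois-Reymond ([ae_eq0_of_bump]) proved with explicit smooth bumps that
    converge to indicators of half-open boxes, and from the integrability of
    u div(phi C), which holds because the difference quotients of the Lipschitz
    field phi C are bounded ([divergence_bound]). *)

(** * Weak compactness of dominated sequences in L^1 *)

(** By Tychonoff's theorem the points (u i n)_i of a product of compact segments
    have a cluster point c as n grows. A neighbourhood of c constrains finitely
    many coordinates, so the indices k j can be chosen to bring the first j
    coordinates within 1 / (j + 1) of c. *)
Lemma diagonal_subsequence (R : realType) (u : nat -> nat -> R) (M : nat -> R) :
  (forall i n, `|u i n| <= M i) ->
  exists k : nat -> nat, {homo k : i j / (i < j)%N} /\
    forall i, cvgn (fun n => u i (k n)).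
Proof.
move=> uM.
pose x n : prod_topology (fun _ : nat => R) := fun i => u i n.
have cK : compact [set f : prod_topology (fun _ : nat => R) |
    forall i, `[- M i, M i]%classic (f i)].
  apply: (@tychonoff nat (fun _ => R) (fun i => `[- M i, M i]%classic)) => i.
  exact: segment_compact.
have [|c [_ clc]] := cK (x @ \oo) _.
  by exists 0%N => // n _ i /=; rewrite in_itv/= -ler_norml uM.
have near_c N m : exists n, (N <= n)%N /\
    forall i, (i < m)%N -> `|u i n - c i| < m.+1%:R^-1.
  have Uc (e : R) : 0 < e ->
      nbhs c [set y : prod_topology (fun _ : nat => R) |
        forall i, (i < m)%N -> `|y i - c i| < e].
    move=> e0; elim: m => [|m IH]; first by apply: filterS filterT.
    have : nbhs c [set y : prod_topology (fun _ : nat => R) | `|y m - c m| < e].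
      have /= := @proj_continuous nat (fun _ => R) m c (ball (c m) e)
        (nbhsx_ballx (c m) e e0).
      move=> H; apply: (@filterS _ (nbhs c) _ _ _ _ H) => y /=.
      by rewrite /ball/= /ball_/= distrC.
    apply: filterS2 IH => y IH ym i; rewrite ltnS leq_eqVlt => /predU1P[->//|].
    exact: IH.
  have m0 : 0 < m.+1%:R^-1 :> R by rewrite invr_gt0.
  have [|y [[n Nn <-] yc]] := clc (x @` [set n | (N <= n)%N]) _ _ (Uc _ m0).
    by exists N => // n /= Nn; exists n.
  by exists n.
have [g gP] := @choice (nat * nat) nat (fun p n => (p.1 <= n)%N /\
    forall i, (i < p.2)%N -> `|u i n - c i| < p.2.+1%:R^-1)
  (fun p => near_c p.1 p.2).
pose k := fix k j := if j is j'.+1 then g ((k j').+1, j) else g (0%N, 0%N).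
have kP j i : (i < j)%N -> `|u i (k j) - c i| < j.+1%:R^-1.
  by case: j => // j; have [_] := gP ((k j).+1, j.+1); exact.
exists k; split.
  apply: homo_ltn; first exact: ltn_trans.
  by move=> j; have [] := gP ((k j).+1, j.+1).
move=> i; apply: (cvgP (c i)); apply/cvgrPdist_lt => e e0.
have : \forall j \near \oo, j.+1%:R^-1 < e by exact: (near_infty_natSinv_lt (PosNum e0)).
move=> ej; near=> j; rewrite distrC; apply: lt_trans (kP j i _) _.
  by near: j; exists i.+1.
by near: j.
Unshelve. all: by end_near. Qed.

Section weak_compactness.
Context d (T : measurableType d) (R : realType).
Variable mu : {measure set T -> \bar R}.
Variables (D : set T) (mD : measurable D).

Lemma le_integrable_fin (f g : T -> R) :
  measurable_fun D f -> (forall x, D x -> `|f x| <= g x) ->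
  mu.-integrable D (EFin \o g) -> mu.-integrable D (EFin \o f).
Proof.
move=> mf fg; apply: le_integrable => //; first exact/measurable_EFinP.
move=> x Dx /=; rewrite lee_fin (le_trans (fg x Dx))//; exact: ler_norm.
Qed.

Lemma integrable_abs_continuous (b : T -> R) :
  mu.-integrable D (EFin \o b) -> forall e : R, 0 < e ->
  exists2 r : R, 0 < r & forall A, measurable A -> A `<=` D ->
    (mu A < r%:E)%E -> \int[mu]_(x in A) `|b x| < e.
Proof.
move=> ib e e0.
have ib' : mu.-integrable setT (EFin \o (b \_ D)).
  by rewrite -restrict_EFin; exact: (integrable_mkcond _ mD).1.
have [r [r0 rP]] := integral_normr_continuous ib' e0.
exists r => // A mA AD Ar.
rewrite (_ : Rintegral _ _ _ = \int[mu]_(x in A) `|(b \_ D) x|) ?rP//.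
apply: eq_Rintegral => x /set_mem xA.
by rewrite patchE mem_set//; exact: AD.
Qed.

(** On the set where g < f the integrals over subsets are also ordered the other
    way, so that f and g agree almost everywhere there. *)
Lemma ae_le_of_le_Rintegral (f g : T -> R) :
  mu.-integrable D (EFin \o f) -> mu.-integrable D (EFin \o g) ->
  (forall E, measurable E -> E `<=` D ->
     \int[mu]_(x in E) f x <= \int[mu]_(x in E) g x) ->
  {ae mu, forall x, D x -> f x <= g x}.
Proof.
move=> fi gi fg.
have mf : measurable_fun D f by apply/measurable_EFinP; exact: measurable_int fi.
have mg : measurable_fun D g by apply/measurable_EFinP; exact: measurable_int gi.
pose E := D `&` [set x | g x < f x].
have mE : measurable E.
  rewrite (_ : E = D `&` (fun x => g x < f x) @^-1` [set true]); last first.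
    by apply/seteqP; split.
  exact: measurable_fun_ltr.
have ED : E `<=` D by move=> x [].
have : ae_eq mu E (EFin \o f) (EFin \o g).
  apply: integral_ae_eq => //.
  - exact: integrableS fi.
  - by apply/measurable_EFinP; apply: measurable_funS mg.
  move=> A AE mA; have AD : A `<=` D by exact: subset_trans ED.
  have fiA : mu.-integrable A (EFin \o f) by exact: integrableS fi.
  have giA : mu.-integrable A (EFin \o g) by exact: integrableS gi.
  rewrite -[LHS]fineK ?integrable_fin_num// -[RHS]fineK ?integrable_fin_num//.
  congr EFin; apply/eqP; rewrite eq_le [X in X && _]fg//=.
  by apply: le_Rintegral => // x /AE[_ /ltW].
apply: filterS => x /= h Dx; rewrite leNgt; apply/negP => gf.
by have [] := h (conj Dx gf) => fgx; move: gf; rewrite fgx ltxx.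
Qed.

Lemma Rintegral_setD (f : T -> R) (A B : set T) : measurable A -> measurable B ->
  mu.-integrable A (EFin \o f) ->
  \int[mu]_(x in A) f x =
  \int[mu]_(x in A `&` B) f x + \int[mu]_(x in A `\` B) f x.
Proof.
move=> mA mB fi; rewrite -Rintegral_setU//.
- by rewrite setDE -setIUr setUv setIT.
- exact: measurableI.
- exact: measurableD.
- by rewrite setDE -setIUr setUv setIT.
- apply/disj_setPS => x [[_ ?] [_ ?]] //.
Qed.

Lemma dist_Rintegral_le (f : T -> R) (E F : set T) :
  mu.-integrable D (EFin \o f) -> measurable E -> E `<=` D -> measurable F ->
  `|\int[mu]_(x in E) f x - \int[mu]_(x in D `&` F) f x| <=
  \int[mu]_(x in D `&` ((E `\` F) `|` (F `\` E))) `|f x|.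
Proof.
move=> fi mE ED mF.
have fiA A : measurable A -> A `<=` D -> mu.-integrable A (EFin \o f).
  by move=> mA AD; exact: integrableS fi.
have mDF : measurable (D `&` F) by exact: measurableI.
have DFD : D `&` F `<=` D by move=> x [].
have mEF : measurable (E `\` F) by exact: measurableD.
have mFE : measurable ((D `&` F) `\` E) by exact: measurableD.
have EFD : E `\` F `<=` D by move=> x [] /ED.
have FED : (D `&` F) `\` E `<=` D by move=> x [] [].
rewrite (Rintegral_setD mE mF)//; last exact: fiA.
rewrite (Rintegral_setD mDF mE)//; last exact: fiA.
have -> : D `&` F `&` E = E `&` F.
  by apply/seteqP; split => x [] => [[? ?] ?|/[dup] /ED].
rewrite opprD addrACA subrr add0r.
have -> : D `&` ((E `\` F) `|` (F `\` E)) =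
    (E `\` F) `|` ((D `&` F) `\` E).
  apply/seteqP; split => x /=; first by case=> Dx [] []; [left|right].
  by case=> [[Ex Fx]|[[Dx Fx] Ex]]; (split; [exact: ED|]) || split => //;
    [left|right].
rewrite Rintegral_setU//; last 2 first.
- apply: (integrable_norm (f := f)); apply: fiA; first exact: measurableU.
  by rewrite subUset.
- by apply/disj_setPS => x [[? ?] [[? ?] ?]].
rewrite (le_trans (ler_normB _ _))// lerD//;
  by apply: le_normr_Rintegral => //; exact: fiA.
Qed.

End weak_compactness.

Lemma cvgn_of_approx (R : realType) (u : nat -> R) :
  (forall e : R, 0 < e -> exists x, \forall n \near \oo, `|x - u n| < e) ->
  cvgn u.
Proof.
move=> h; apply/cauchy_cvgP/cauchy_exP => e e0; have [x xu] := h _ e0.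
by exists x.
Qed.

Section weak_limit.
Context d (T : measurableType d) (R : realType).
Variable mu : {sigma_finite_measure set T -> \bar R}.
Variables (D : set T) (mD : measurable D).
Variables (v : nat -> T -> R) (b : T -> R).
Hypothesis mv : forall h, measurable_fun D (v h).
Hypothesis v0 : forall h x, D x -> 0 <= v h x.
Hypothesis vb : forall h x, D x -> v h x <= b x.
Hypothesis ib : mu.-integrable D (EFin \o b).
Variable S : nat -> set T.
Hypothesis mS : forall k, measurable (S k).
Hypothesis S_dense : forall E, measurable E -> E `<=` D ->
  forall e : R, 0 < e ->
  exists k, (mu (D `&` ((E `\` S k) `|` (S k `\` E))) < e%:E)%E.
Hypothesis cvgS : forall k, cvgn (fun h => \int[mu]_(x in D `&` S k) v h x).

Let iv h : mu.-integrable D (EFin \o v h).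
Proof.
apply: le_integrable_fin ib => // x Dx.
by rewrite ger0_norm ?v0// vb.
Qed.

Let b0 x : D x -> 0 <= b x.
Proof. by move=> Dx; apply: le_trans (v0 0 Dx) (vb 0 Dx). Qed.

Let ib' : mu.-integrable setT ((EFin \o b) \_ D).
Proof. exact: (integrable_mkcond _ mD).1. Qed.

Let ivE h E : measurable E -> E `<=` D -> mu.-integrable E (EFin \o v h).
Proof. by move=> mE ED; exact: integrableS (iv h). Qed.

Let ibE E : measurable E -> E `<=` D -> mu.-integrable E (EFin \o b).
Proof. by move=> mE ED; exact: integrableS ib. Qed.

(** Replacing E by a set S k close to it changes all the integrals of the
    functions v h by at most the integral of b over the symmetric difference,
    which is small uniformly in h: the sequence is Cauchy. *)
Lemma cvg_Rintegral_all E : measurable E -> E `<=` D ->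
  cvgn (fun h => \int[mu]_(x in E) v h x).
Proof.
move=> mE ED; apply: cvgn_of_approx => e e0.
have e20 : 0 < e / 2 by rewrite divr_gt0.
have [r r0 rP] := integrable_abs_continuous mD ib e20.
have [k kr] := S_dense mE ED r0.
have mX : measurable (D `&` ((E `\` S k) `|` (S k `\` E))).
  by apply: measurableI => //; apply: measurableU; exact: measurableD.
have {}rP := rP _ mX (@subIsetl _ _ _) kr.
exists (limn (fun h => \int[mu]_(x in D `&` S k) v h x)).
have := @cvgS k => /cvgrPdist_lt/(_ _ e20); apply: filterS => h hl.
rewrite [e]splitr (le_lt_trans (ler_distD (\int[mu]_(x in D `&` S k) v h x) _ _))//.
rewrite ltrD// distrC;
apply: le_lt_trans rP; apply: le_trans (dist_Rintegral_le mD (iv h) mE ED (mS k)) _.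
apply: le_Rintegral => //.
- exact: (integrable_norm (f := v h) (ivE h mX (@subIsetl _ _ _))).
- exact: (integrable_norm (f := b) (ibE mX (@subIsetl _ _ _))).
- by move=> x [Dx _]; rewrite !ger0_norm ?v0 ?vb ?b0.
Qed.

Let nu (E : set T) : \bar R := (limn (fun h => \int[mu]_(x in D `&` E) v h x))%:E.

Let cvg_nu E : measurable E ->
  (fun h => \int[mu]_(x in D `&` E) v h x) @ \oo -->
  limn (fun h => \int[mu]_(x in D `&` E) v h x).
Proof.
by move=> mE; apply: cvg_Rintegral_all; [exact: measurableI|exact: subIsetl].
Qed.

Let nu0 : nu set0 = 0%E.
Proof.
rewrite /nu setI0; congr EFin; apply/cvg_lim => //.
under eq_fun do rewrite Rintegral_set0; exact: cvg_cst.
Qed.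

Let nu_fin E : measurable E -> nu E \is a fin_num. Proof. by []. Qed.

Let nuU A B : measurable A -> measurable B -> A `&` B = set0 ->
  nu (A `|` B) = (nu A + nu B)%E.
Proof.
move=> mA mB AB; rewrite /nu -EFinD; congr EFin; apply/cvg_lim => //.
rewrite (_ : (fun h => _) = (fun h => \int[mu]_(x in D `&` A) v h x +
   \int[mu]_(x in D `&` B) v h x)); first by apply: cvgD; exact: cvg_nu.
apply/funext => h; rewrite setIUr Rintegral_setU//.
- exact: measurableI.
- exact: measurableI.
- apply: ivE; last by move=> x [] [].
  by apply: measurableU; exact: measurableI.
- by apply/disj_setPS => x [[_ Ax] [_ Bx]]; rewrite -AB.
Qed.

Let nu_ge0 E : measurable E -> (0 <= nu E)%E.
Proof.
move=> mE; rewrite lee_fin; apply: limr_ge; first exact: cvg_nu.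
by apply: nearW => h; apply: Rintegral_ge0 => x [Dx _]; exact: v0.
Qed.

Let nu_le E : measurable E -> (nu E <= \int[mu]_(x in D `&` E) (b x)%:E)%E.
Proof.
move=> mE; have DE : D `&` E `<=` D by exact: subIsetl.
have mDE : measurable (D `&` E) by exact: measurableI.
rewrite -[leRHS]fineK ?(integrable_fin_num _ (ibE mDE DE))// lee_fin.
apply: limr_le; first exact: cvg_nu.
apply: nearW => h; apply: le_Rintegral => //; first exact: ivE.
  exact: ibE.
by move=> x [Dx _]; exact: vb.
Qed.

(** The part of nu carried by the tail of a disjoint union is at most the
    integral of b over that tail, which tends to 0. *)
Let nu_sadd : semi_sigma_additive nu.
Proof.
move=> F mF tF mUF.
pose B E := (\int[mu]_(x in D `&` E) (b x)%:E)%E.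
pose G n := \big[setU/set0]_(i < n) F i.
have mG n : measurable (G n) by exact: bigsetU_measurable.
have GFn n : G n `&` F n = set0.
  apply/seteqP; split=> // x []; rewrite /G -bigcup_mkord => -[i /= im Fix] Fnx.
  by have := tF i n I I (ex_intro _ x (conj Fix Fnx)) => ein; rewrite ein ltnn in im.
have nuG n : (\sum_(0 <= i < n) nu (F i) = nu (G n))%E.
  rewrite /G; elim: n => [|n IH]; first by rewrite big_geq// big_ord0 nu0.
  rewrite big_nat_recr//= IH big_ord_recr/= nuU//; first exact: mG.
  exact: GFn.
have GF n : G n `<=` \bigcup_i F i by exact: bigsetU_bigcup.
pose H n := (\bigcup_i F i) `\` G n.
have mH n : measurable (H n) by exact: measurableD.
have FGH n : nu (\bigcup_i F i) = (nu (G n) + nu (H n))%E.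
  rewrite -nuU// /H ?setDIK//.
  by congr nu; rewrite setDUK.
have B0 : (fun n => B (H n)) @ \oo --> 0%E.
  rewrite /B; under eq_fun do rewrite integral_mkcondl.
  pose c := induced_charge ib'.
  have cUU X Y : measurable X -> measurable Y -> X `&` Y = set0 ->
    c (X `|` Y) = (c X + c Y)%E by move=> mX mY XY; exact: chargeU.
  have cU n : c (\bigcup_i F i) = (c (G n) + c (H n))%E.
    rewrite -cUU//; last by rewrite /H setDIK.
    by rewrite setDUK.
  have cG n : (\sum_(0 <= i < n) c (F i) = c (G n))%E.
    rewrite /G; elim: n => [|n IH]; first by rewrite big_geq// big_ord0 /c /induced_charge integral_set0.
    rewrite big_nat_recr//= IH big_ord_recr/= cUU//; [exact: mG|exact: GFn].
  have cfin E : measurable E -> c E \is a fin_num by exact: fin_num_measure.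
  have -> : (fun n => c (H n)) = (fun n => c (\bigcup_i F i) - c (G n))%E.
    by apply/funext => n; rewrite (cU n) addeAC subee ?add0e// cfin.
  rewrite -(subee (cfin _ mUF)); apply: cvgeB => //.
    by rewrite fin_num_adde_defr// cfin.
    exact: cvg_cst.
  under eq_fun do rewrite -cG.
  exact: charge_semi_sigma_additive.
under eq_fun do rewrite nuG.
have -> : (fun n => nu (G n)) = (fun n => nu (\bigcup_i F i) - nu (H n))%E.
  by apply/funext => n; rewrite (FGH n) -addeA subee ?adde0// nu_fin.
suff : ((fun n => nu (\bigcup_i F i) - nu (H n)) @ \oo -->
    nu (\bigcup_i F i) - 0)%E by rewrite sube0.
apply: cvgeB => //.
  exact: cvg_cst.
apply: (@squeeze_cvge _ _ _ _ (cst 0%E) _ (fun n => B (H n))) => //.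
  by apply: nearW => n; rewrite nu_ge0//= nu_le.
exact: cvg_cst.
Qed.

HB.instance Definition _ := isCharge.Build _ _ _ nu nu0 nu_fin nu_sadd.

(** The limits of the integrals form a finite measure nu dominated by the
    integral of b, hence absolutely continuous with respect to mu; the weak limit
    is its Radon-Nikodym density. *)
Lemma weak_L1_limit : exists2 g : T -> R, mu.-integrable setT (EFin \o g) &
  forall E, measurable E -> E `<=` D ->
    (fun h => \int[mu]_(x in E) v h x) @ \oo --> \int[mu]_(x in E) g x.
Proof.
have nu_mu : nu `<< mu.
  apply/null_content_dominatesP => E mE muE0; apply/eqP.
  rewrite eq_le nu_ge0// andbT (le_trans (nu_le mE))//.
  rewrite null_set_integral//; first exact: measurableI.
    by apply: (measurable_int mu); apply: ibE => //; exact: measurableI.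
  by apply: subset_measure0 muE0 => //; exact: measurableI.
have gfin := Radon_Nikodym_fin_num _ nu_mu.
exists (fine \o Radon_Nikodym nu mu).
  rewrite (_ : _ \o _ = (Radon_Nikodym nu mu)).
    exact: Radon_Nikodym_integrable.
  by apply/funext => x /=; rewrite fineK.
move=> E mE ED.
suff <- : limn (fun h => \int[mu]_(x in D `&` E) v h x) =
    \int[mu]_(x in E) (fine \o Radon_Nikodym nu mu) x.
  by rewrite setIidr//; have := cvg_nu mE; rewrite setIidr.
have := Radon_Nikodym_integral nu_mu mE; rewrite /Rintegral.
move=> /(congr1 fine) /= ->; congr fine.
by apply: eq_integral => x _ /=; rewrite fineK.
Qed.

End weak_limit.

(** * Convex functions of p-growth *)

Lemma le_powR (R : realType) (p x y : R) : 0 <= p -> 0 <= x -> x <= y ->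
  x `^ p <= y `^ p.
Proof. by move=> p0 x0 xy; rewrite ge0_ler_powR// nnegrE (le_trans x0). Qed.

Lemma powRD_le (R : realType) (p x y : R) : 0 <= p -> 0 <= x -> 0 <= y ->
  (x + y) `^ p <= 2 `^ p * (x `^ p + y `^ p).
Proof.
move=> p0; wlog : x y / x <= y => [hw x0 y0|xy x0 y0].
  by case/orP: (le_total x y) => xy; [|rewrite addrC [_ + y `^ p]addrC]; exact: hw.
apply: (@le_trans _ _ ((2 * y) `^ p)).
  by rewrite ge0_ler_powR// ?nnegrE ?addr_ge0 ?mulr_ge0// mulr_natl mulr2n lerD2r.
by rewrite powRM// ler_wpM2l ?powR_ge0// lerDr powR_ge0.
Qed.

Section convex_growth.
Context (R : realType) (Z : normedModType R).
Variables (p K : R) (G : Z -> R).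
Hypothesis p0 : 0 <= p.
Hypothesis K0 : 0 <= K.
Hypothesis G_le : forall z, G z <= K * `|z| `^ p.

Definition cvx (f : Z -> R) := forall (t : R) (y z : Z), 0 <= t <= 1 ->
  f (t *: y + (1 - t) *: z) <= t * f y + (1 - t) * f z.

Definition modulus_cst := K * 2 `^ p * (2 `^ p + 1).
Let K1 := modulus_cst.

(** The free parameter t is to be small, and then r small with respect to t. *)
Definition modulus (a y r t : R) := t * (a + K1 * (y `^ p + (r / t) `^ p)).

Lemma modulus_cst_ge0 : 0 <= K1.
Proof. by rewrite !mulr_ge0 ?addr_ge0 ?powR_ge0. Qed.

Lemma le_modulus a y y' r r' t : 0 <= t -> 0 <= y <= y' -> 0 <= r <= r' ->
  modulus a y r t <= modulus a y' r' t.
Proof.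
move=> t0 /andP[y0 yy'] /andP[r0 rr']; rewrite ler_wpM2l// lerD2l.
rewrite ler_wpM2l ?modulus_cst_ge0// lerD// ge0_ler_powR// ?nnegrE.
- exact: le_trans yy'.
- by rewrite divr_ge0.
- by rewrite divr_ge0// (le_trans r0).
- by rewrite ler_wpM2r ?invr_ge0.
Qed.

(** The point z is the convex combination of y and y + (z - y) / t with weights
    1 - t and t, so f z - f y is at most t times the growth bound at that far
    point. The other inequality is the same with y and z exchanged; the larger
    constant K1 absorbs the estimate of |z| by |y| + |z - y|. *)
Lemma convex_modulus (a : R) (f : Z -> R) : 0 <= a -> cvx f ->
  (forall z, 0 <= f z <= a + G z) ->
  forall (y z : Z) (t : R), 0 < t <= 1 ->
  `|f z - f y| <= modulus a `|y| `|z - y| t.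
Proof.
move=> a0 fc fG.
have aux (y z : Z) (t : R) : 0 < t <= 1 -> f z <= f y +
    t * (a + K * 2 `^ p * (`|y| `^ p + (`|z - y| / t) `^ p)).
  move=> /andP[t0 t1]; have t1' : 0 <= t <= 1 by rewrite ltW.
  have zE : t *: (y + t^-1 *: (z - y)) + (1 - t) *: y = z.
    rewrite scalerDr scalerA mulfV ?gt_eqF// scale1r scalerBl scale1r.
    by rewrite (addrC (t *: y)) addrACA subrK subrr addr0.
  rewrite -{1}zE (le_trans (fc _ _ _ t1'))// addrC lerD//.
    by rewrite ler_piMl// ?gerBl ?(ltW t0)//; have /andP[] := fG y.
  rewrite ler_wpM2l ?(ltW t0)//; have /andP[_ /le_trans] := fG (y + t^-1 *: (z - y)).
  apply; rewrite lerD2l (le_trans (G_le _))// -mulrA ler_wpM2l//.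
  apply: (le_trans _ (powRD_le _ _ _)) => //; last by rewrite divr_ge0// ltW.
  rewrite ge0_ler_powR// ?nnegrE ?addr_ge0// ?divr_ge0 ?(ltW t0)//.
  rewrite (le_trans (ler_normD _ _))// normrZ lerD2l ger0_norm ?invr_ge0 ?(ltW t0)//.
  by rewrite mulrC.
move=> y z t t01; have /andP[t0 t1] := t01; rewrite ler_norml; apply/andP; split.
- rewrite lerBrDl lerBlDr (le_trans (aux z y t t01))// lerD2l ler_wpM2l ?(ltW t0)//.
  rewrite lerD2l distrC /K1 /modulus_cst -[leRHS]mulrA ler_wpM2l ?mulr_ge0 ?powR_ge0//.
  set r := `|z - y|; have r0 : 0 <= r := normr_ge0 _.
  have zr : `|z| <= `|y| + r.
    by rewrite addrC -[z in `|z|](subrK y) ler_normD.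
  have : `|z| `^ p <= 2 `^ p * (`|y| `^ p + (r / t) `^ p).
    apply: (@le_trans _ _ ((`|y| + r) `^ p)).
      exact: le_powR.
    rewrite (le_trans (powRD_le _ _ _))// ler_wpM2l ?powR_ge0// lerD2l.
    by rewrite le_powR// ler_pdivlMr// ler_piMr.
  move=> /le_trans h; rewrite mulrDl mul1r lerD ?h// lerDr powR_ge0//.
- rewrite lerBlDl (le_trans (aux y z t t01))// lerD2l ler_wpM2l ?(ltW t0)//.
  rewrite lerD2l /K1 /modulus_cst ler_wpM2r ?addr_ge0 ?powR_ge0//.
  by rewrite ler_peMr ?mulr_ge0 ?powR_ge0// lerDr powR_ge0.
Qed.

Lemma modulus_small a Y e : 0 <= a -> 0 <= Y -> 0 < e ->
  exists2 t0, 0 < t0 <= 1 & forall t y r, 0 < t <= t0 ->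
    0 <= y <= Y -> 0 <= r <= t -> modulus a y r t <= e.
Proof.
move=> a0 Y0 e0; pose A := a + K1 * (Y `^ p + 1).
have A0 : 0 <= A.
  by rewrite addr_ge0// mulr_ge0 ?modulus_cst_ge0// addr_ge0 ?powR_ge0.
exists (Num.min 1 (e / (A + 1))).
  by rewrite lt_min ltr01/= divr_gt0 ?ltr_wpDl// ge_min lexx.
move=> t y r /andP[t0 tt] yY /andP[r0 rt].
apply: (@le_trans _ _ (modulus a Y t t)).
  by apply: le_modulus; rewrite ?(ltW t0)// r0.
rewrite /modulus divff ?gt_eqF// powR1 -/A.
apply: (@le_trans _ _ (e / (A + 1) * A)).
  by rewrite ler_wpM2r// (le_trans tt)// ge_min lexx orbT.
rewrite mulrAC ler_pdivrMr ?ltr_wpDl// ler_wpM2l ?(ltW e0)//.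
by rewrite lerDl.
Qed.

End convex_growth.

Lemma convex_continuous (R : realType) (Z : normedModType R) (p K : R)
  (G f : Z -> R) (b : R) : 0 <= p -> 0 <= K -> (forall z, G z <= K * `|z| `^ p) ->
  0 <= b -> cvx f -> (forall z, 0 <= f z <= b + G z) -> continuous f.
Proof.
move=> p0 K0 G_le b0 fc fb z.
apply/(@cvgrPdist_le _ _ _ (nbhs z) (nbhs_filter z)) => e e0.
have [t t01 tP] := modulus_small p0 K0 b0 (normr_ge0 z) e0.
have t0 : 0 < t by have /andP[] := t01.
have zt : \forall y \near z, `|z - y| < t.
  by have /cvgrPdist_lt/(_ _ t0) := @cvg_id _ (nbhs z).
apply: (@filterS _ (nbhs z) (nbhs_filter z) _ _ _ zt) => y zy.
rewrite distrC (le_trans (convex_modulus p0 K0 G_le b0 fc fb z y t01))//.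
by apply: tP; rewrite ?t0 ?normr_ge0/= ?lexx// distrC ltW.
Qed.

(** * Approximation by the nearest points of a sequence *)

Section nearest.
Context (R : realType) (Z : normedModType R) (q : nat -> Z).

(** As x varies, [nearest (w x) M] takes the values q 0, ..., q M on sets cut out
    by comparing distances: it approximates w by maps with finitely many values
    as soon as the functions |w x - q k| are measurable. *)
Fixpoint nearest (z : Z) (M : nat) : Z :=
  if M is M'.+1 then
    if `|z - q M| < `|z - nearest z M'| then q M else nearest z M'
  else q 0.

Lemma nearest_le z M k : (k <= M)%N -> `|z - nearest z M| <= `|z - q k|.
Proof.
elim: M => [|M IH]; first by rewrite leqn0 => /eqP ->.
rewrite leq_eqVlt => /predU1P[->|kM] /=.
  by case: ltP => // h; rewrite lexx.
case: ltP => h; last exact: IH.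
by rewrite (le_trans (ltW h))// IH.
Qed.

Lemma nearest_cvg z : (forall e : R, 0 < e -> exists k, `|z - q k| < e) ->
  (fun M => nearest z M) @ \oo --> z.
Proof.
move=> qd; apply/cvgrPdist_lt => e e0; have [k ke] := qd _ e0.
by exists k => // M /= kM; exact: le_lt_trans (nearest_le _ kM) ke.
Qed.

Context d (T : measurableType d) (D : set T) (mD : measurable D).
Variable w : T -> Z.
Hypothesis mw : forall k, measurable_fun D (fun x => `|w x - q k|).

Lemma measurable_dist_nearest M : measurable_fun D (fun x => `|w x - nearest (w x) M|).
Proof.
elim: M => [|M IH] /=; first exact: mw.
rewrite (_ : (fun x => _) = (fun x =>
  if `|w x - q M.+1| < `|w x - nearest (w x) M| then `|w x - q M.+1|
  else `|w x - nearest (w x) M|)); last by apply/funext => x; case: ifP.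
apply: measurable_fun_if => //; first exact: measurable_fun_ltr.
- by apply: measurable_funS (mw _).
- by apply: measurable_funS IH.
Qed.

Lemma measurable_nearest_lt M :
  measurable (D `&` [set x | `|w x - q M.+1| < `|w x - nearest (w x) M|]).
Proof.
rewrite (_ : [set x | _] = (fun x => `|w x - q M.+1| < `|w x - nearest (w x) M|)
   @^-1` [set true]); last by apply/seteqP; split.
apply: measurable_fun_ltr => //; exact: measurable_dist_nearest.
Qed.

Lemma measurable_comp_nearest (f : T -> Z -> R) M :
  (forall k, measurable_fun D (f^~ (q k))) ->
  measurable_fun D (fun x => f x (nearest (w x) M)).
Proof.
move=> mf; elim: M => [|M IH] /=; first exact: mf.
rewrite (_ : (fun x => _) = (fun x =>
  if `|w x - q M.+1| < `|w x - nearest (w x) M| then f x (q M.+1)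
  else f x (nearest (w x) M))); last by apply/funext => x; case: ifP.
apply: measurable_fun_if => //.
- by apply: measurable_fun_ltr; [exact: mw|exact: measurable_dist_nearest].
- by apply: measurable_funS (mf _).
- by apply: measurable_funS IH.
Qed.

End nearest.

(** * Convex integrands on L^p *)

Section integrable_real.
Context d (T : measurableType d) (R : realType) (mu : {measure set T -> \bar R}).
Variables (D : set T) (mD : measurable D).
Implicit Types f g : T -> R.

Lemma integrable_finD f g : mu.-integrable D (EFin \o f) ->
  mu.-integrable D (EFin \o g) -> mu.-integrable D (EFin \o (fun x => f x + g x)).
Proof. by move=> fi gi; exact: (integrableD mD fi gi). Qed.

Lemma integrable_finB f g : mu.-integrable D (EFin \o f) ->
  mu.-integrable D (EFin \o g) -> mu.-integrable D (EFin \o (fun x => f x - g x)).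
Proof. by move=> fi gi; exact: (integrableB mD fi gi). Qed.

Lemma integrable_finZ (k : R) f : mu.-integrable D (EFin \o f) ->
  mu.-integrable D (EFin \o (fun x => k * f x)).
Proof. by move=> fi; exact: (integrableZl mD k fi). Qed.

Lemma integrable_fin_cst (k : R) : (mu D < +oo)%E ->
  mu.-integrable D (EFin \o (fun=> k)).
Proof.
move=> muD; apply/integrableP; split; first exact/measurable_EFinP.
rewrite (eq_integral (cst `|k|%:E))// integral_cst// lte_mul_pinfty//.
Qed.

Lemma le_Rintegral_subset f (E : set T) : measurable E -> E `<=` D ->
  mu.-integrable D (EFin \o f) -> (forall x, D x -> 0 <= f x) ->
  \int[mu]_(x in E) f x <= \int[mu]_(x in D) f x.
Proof.
move=> mE ED fi f0; rewrite fine_le//.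
- by apply: integrable_fin_num => //; exact: integrableS fi.
- exact: integrable_fin_num.
- by apply: ge0_subset_integral => //; exact: measurable_int fi.
Qed.

End integrable_real.

Section convex_integrands.
Context d (T : measurableType d) (R : realType) (mu : {measure set T -> \bar R}).
Variables (D : set T) (mD : measurable D).
Variables (Z : normedModType R) (q : nat -> Z).
Hypothesis q0 : q 0 = 0.
Hypothesis q_dense : forall z (e : R), 0 < e -> exists k, `|z - q k| < e.
Variables (p K : R) (G : Z -> R) (a : T -> R).
Hypothesis p0' : 0 < p.
Let p0 : 0 <= p := ltW p0'.
Hypothesis K0 : 0 <= K.
Hypothesis G_le : forall z, G z <= K * `|z| `^ p.
Hypothesis a0 : forall x, D x -> 0 <= a x.
Hypothesis ia : mu.-integrable D (EFin \o a).

Definition admissible (f : T -> Z -> R) :=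
  (forall z, measurable_fun D (f ^~ z)) /\
  forall x, D x -> cvx (f x) /\ forall z, 0 <= f x z <= a x + G z.

(** Measurability is asked of the distances to the points q k, so that no
    sigma-algebra on Z is involved. *)
Definition Lpmap (w : T -> Z) :=
  (forall k, measurable_fun D (fun x => `|w x - q k|)) /\
  mu.-integrable D (EFin \o (fun x => `|w x| `^ p)).

Let nearest_w (z : Z) : (fun M => nearest q z M) @ \oo --> z.
Proof. by apply: nearest_cvg => e; exact: q_dense. Qed.

Lemma convex_cvg (f : Z -> R) (b : R) (u : nat -> Z) (z : Z) : 0 <= b -> cvx f ->
  (forall z, 0 <= f z <= b + G z) -> u @ \oo --> z -> (f \o u) @ \oo --> f z.
Proof.
move=> b0 fc fb uz.
have cf : continuous f := convex_continuous p0 K0 G_le b0 fc fb.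
exact: (continuous_cvg _ (cf z) uz).
Qed.

(** By convexity f x is continuous, so x |-> f x (w x) is the limit of the maps
    obtained by replacing w with its finitely valued approximations. *)
Lemma measurable_comp_admissible f w : admissible f ->
  (forall k, measurable_fun D (fun x => `|w x - q k|)) ->
  measurable_fun D (fun x => f x (w x)).
Proof.
move=> [mf fP] mw.
apply: (measurable_fun_cvg (h := fun M x => f x (nearest q (w x) M))).
  by move=> M; apply: measurable_comp_nearest.
move=> x Dx; have [fc fb] := fP _ Dx.
exact: (convex_cvg (a0 Dx) fc fb (@nearest_w (w x))).
Qed.

Lemma integrable_comp_admissible f w E : admissible f -> Lpmap w ->
  measurable E -> E `<=` D -> mu.-integrable E (EFin \o (fun x => f x (w x))).
Proof.
move=> fa [mw iw] mE ED; apply: (integrableS mD) => //.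
apply: (@le_integrable_fin _ _ _ _ _ _ _ (fun x => a x + K * `|w x| `^ p)) => //.
- exact: measurable_comp_admissible.
- move=> x Dx; have [_ /(_ (w x))/andP[f0 fG]] := fa.2 _ Dx.
  by rewrite ger0_norm// (le_trans fG)// lerD2l.
- by apply: integrable_finD => //; exact: integrable_finZ.
Qed.

Lemma Lpmap_nearest w M : Lpmap w -> Lpmap (fun x => nearest q (w x) M).
Proof.
move=> [mw iw]; split=> [k|].
  by apply: (measurable_comp_nearest mD mw (f := fun _ z => `|z - q k|)).
have m1 : measurable_fun D (fun x => `|nearest q (w x) M| `^ p).
  by apply: (measurable_comp_nearest mD mw (f := fun _ z => `|z| `^ p)).
apply: (@le_integrable_fin _ _ _ _ _ _ _ (fun x => 2 `^ p * `|w x| `^ p)) => //.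
  move=> x Dx; rewrite ger0_norm ?powR_ge0// -powRM// le_powR//.
  rewrite -[X in `|X| <= _](subKr (w x)) (le_trans (ler_normB _ _))//.
  rewrite mulr_natl mulr2n lerD2l (le_trans (nearest_le _ _ (leq0n _)))//.
  by rewrite q0 subr0.
exact: integrable_finZ.
Qed.

Lemma integrable_Lpmap_dist w v : Lpmap w -> Lpmap v ->
  measurable_fun D (fun x => `|v x - w x|) ->
  mu.-integrable D (EFin \o (fun x => `|v x - w x| `^ p)).
Proof.
move=> [mw iw] [mv iv] mvw.
apply: (@le_integrable_fin _ _ _ _ _ _ _
    (fun x => 2 `^ p * (`|v x| `^ p + `|w x| `^ p))) => //.
- by apply: (measurableT_comp (measurable_powR p)).
- move=> x Dx; rewrite ger0_norm ?powR_ge0//.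
  by apply: le_trans (powRD_le _ _ _) => //; rewrite le_powR// ler_normB.
- by apply: integrable_finZ => //; exact: integrable_finD.
Qed.

(** Integrating [convex_modulus] bounds the difference by
    t (\int a + K1 (\int |w|^p + t^-p \int |v - w|^p)). Once t is chosen, in terms
    of w and e only, r = t^p makes the last summand at most 1. *)
Lemma equicontinuous_admissible w (e : R) : Lpmap w -> 0 < e ->
  exists2 r, 0 < r & forall f v E, admissible f -> Lpmap v ->
    measurable_fun D (fun x => `|v x - w x|) ->
    \int[mu]_(x in D) (`|v x - w x| `^ p) <= r ->
    measurable E -> E `<=` D ->
    `|\int[mu]_(x in E) f x (v x) - \int[mu]_(x in E) f x (w x)| <= e.
Proof.
move=> Lw e0; have [mw iw] := Lw.
pose K1 := modulus_cst p K; have K10 : 0 <= K1 := modulus_cst_ge0 p K0.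
pose B := \int[mu]_(x in D) a x + K1 * (\int[mu]_(x in D) (`|w x| `^ p) + 1).
have B0 : 0 <= B.
  by apply: addr_ge0; rewrite ?mulr_ge0 ?addr_ge0// Rintegral_ge0// => x _; exact: powR_ge0.
(* makes t * B at most e, where B bounds the factor of t when r = t ^ p *)
pose t := Num.min 1 (e / (B + 1)).
have t0 : 0 < t by rewrite lt_min ltr01/= divr_gt0// ltr_wpDl.
have t01 : 0 < t <= 1 by rewrite t0 ge_min lexx.
exists (t `^ p); first exact: powR_gt0.
move=> f v E fa Lv mvw vw mE ED.
have ivw := integrable_Lpmap_dist Lw Lv mvw.
pose g x := t * (a x + K1 * (`|w x| `^ p + t^-1 `^ p * `|v x - w x| `^ p)).
have ig : mu.-integrable D (EFin \o g).
  do 2! (apply: integrable_finZ => //; apply: integrable_finD => //).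
  exact: integrable_finZ.
have fvi := integrable_comp_admissible fa Lv mE ED.
have fwi := integrable_comp_admissible fa Lw mE ED.
rewrite -RintegralB//; apply: le_trans (le_normr_Rintegral _ _) _ => //.
  exact: integrable_finB.
apply: (@le_trans _ _ (\int[mu]_(x in E) g x)).
  apply: le_Rintegral => //.
  - by apply: (integrable_norm (f := fun x => f x (v x) - f x (w x))); exact: integrable_finB.
  - exact: integrableS ig.
  - move=> x /ED Dx; have [fc fb] := fa.2 _ Dx.
    apply: le_trans (convex_modulus p0 K0 G_le (a0 Dx) fc fb (w x) (v x) t01) _.
    by rewrite /g /modulus [_ / t]mulrC powRM ?invr_ge0 ?(ltW t0).
apply: (@le_trans _ _ (\int[mu]_(x in D) g x)).
  apply: le_Rintegral_subset => // x Dx.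
  rewrite mulr_ge0 ?(ltW t0)// addr_ge0 ?a0// mulr_ge0// addr_ge0 ?powR_ge0//.
  by rewrite mulr_ge0 ?powR_ge0.
rewrite /g RintegralZl//; last first.
  apply: integrable_finD => //; apply: integrable_finZ => //.
  by apply: integrable_finD => //; exact: integrable_finZ.
rewrite RintegralD//; last first.
  by apply: integrable_finZ => //; apply: integrable_finD => //; exact: integrable_finZ.
rewrite RintegralZl//; last by apply: integrable_finD => //; exact: integrable_finZ.
rewrite RintegralD//; last exact: integrable_finZ.
rewrite RintegralZl//.
apply: (@le_trans _ _ (t * B)).
  rewrite ler_wpM2l ?(ltW t0)// lerD2l ler_wpM2l// lerD2l.
  apply: (@le_trans _ _ (t^-1 `^ p * t `^ p)).
    by rewrite ler_wpM2l ?powR_ge0.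
  by rewrite -powRM ?invr_ge0 ?(ltW t0)// mulVf ?gt_eqF// powR1.
apply: (@le_trans _ _ (e / (B + 1) * B)).
  by rewrite ler_wpM2r// ge_min lexx orbT.
by rewrite mulrAC ler_pdivrMr ?ltr_wpDl// ler_wpM2l ?(ltW e0)// lerDl.
Qed.

(** Dominated convergence: since q 0 = 0 is among the candidates, the distance
    from w x to its approximations is at most |w x|. *)
Lemma nearest_Lp_cvg w : Lpmap w ->
  (fun M => \int[mu]_(x in D) (`|nearest q (w x) M - w x| `^ p)) @ \oo --> 0.
Proof.
move=> Lw; have [mw iw] := Lw.
have pn0 : p != 0 by rewrite gt_eqF.
have mM M : measurable_fun D (fun x => `|nearest q (w x) M - w x|).
  under eq_fun do rewrite distrC.
  exact: measurable_dist_nearest.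
suff : (fun M => \int[mu]_(x in D) (`|nearest q (w x) M - w x| `^ p)%:E)%E @ \oo
    --> (\int[mu]_(x in D) (cst 0 x))%E.
  by rewrite integral0 => /fine_cvg.
apply: (@dominated_cvg _ _ _ _ _ mD _ _ (EFin \o (fun x => `|w x| `^ p))) => //.
- move=> M; apply/measurable_EFinP.
  by apply: (measurableT_comp (measurable_powR p)).
- move=> x Dx; apply: cvg_EFin; first exact: nearW.
  apply/cvgrPdist_lt => e e0.
  have e1 : 0 < e `^ p^-1 by rewrite powR_gt0.
  have /cvgrPdist_lt/(_ _ e1) := @nearest_w (w x).
  apply: filterS => M wM /=; rewrite sub0r normrN ger0_norm ?powR_ge0//.
  rewrite -[ltRHS](powRr1 (ltW e0)) -(mulVf pn0) powRrM.
  by apply: gt0_ltr_powR => //; rewrite ?nnegrE ?powR_ge0// distrC.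
- move=> M x Dx; rewrite lee_fin ger0_norm ?powR_ge0// le_powR ?(ltW p0')// distrC.
  by rewrite (le_trans (nearest_le _ _ (leq0n _)))// q0 subr0.
Qed.

(** A map with finitely many values splits E into sets on which it is constant,
    where the hypothesis applies. Such maps approximate w in L^p, and
    equicontinuity makes the error uniform in h. *)
Lemma cvg_integral_admissible (f : nat -> T -> Z -> R) (f' : T -> Z -> R) :
  (forall h, admissible (f h)) -> admissible f' ->
  (forall i E, measurable E -> E `<=` D ->
    (fun h => \int[mu]_(x in E) f h x (q i)) @ \oo --> \int[mu]_(x in E) f' x (q i)) ->
  forall w E, Lpmap w -> measurable E -> E `<=` D ->
    (fun h => \int[mu]_(x in E) f h x (w x)) @ \oo --> \int[mu]_(x in E) f' x (w x).
Proof.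
move=> fa f'a cvgq w E Lw mE ED.
have step M : forall E, measurable E -> E `<=` D ->
    (fun h => \int[mu]_(x in E) f h x (nearest q (w x) M)) @ \oo -->
    \int[mu]_(x in E) f' x (nearest q (w x) M).
  elim: M => [|M IH] {mE ED}E mE ED; first exact: cvgq.
  pose S := D `&` [set x | `|w x - q M.+1| < `|w x - nearest q (w x) M|].
  have mS : measurable S := measurable_nearest_lt mD Lw.1 M.
  have split g : admissible g ->
      \int[mu]_(x in E) g x (nearest q (w x) M.+1) =
      \int[mu]_(x in E `&` S) g x (q M.+1) +
      \int[mu]_(x in E `\` S) g x (nearest q (w x) M).
    move=> ga; rewrite (Rintegral_setD (B := S))//; last first.
      by apply: (integrable_comp_admissible ga (Lpmap_nearest M.+1 Lw)).
    congr (_ + _); apply: eq_Rintegral => x /set_mem/= [Ex].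
      by move=> [_ ->].
    by move=> /not_andP[/(_ (ED _ Ex))//|/negP/negbTE ->].
  rewrite split//; under eq_fun do rewrite split//.
  apply: cvgD; first by apply: cvgq; [exact: measurableI|move=> x [] /ED].
  by apply: IH; [exact: measurableD|move=> x [] /ED].
apply/cvgrPdist_le => e e0; have e30 : 0 < e / 3 by rewrite divr_gt0.
have [r r0 rP] := equicontinuous_admissible Lw e30.
have [M Mr] : exists M, \int[mu]_(x in D) (`|nearest q (w x) M - w x| `^ p) <= r.
  have /cvgrPdist_le/(_ _ r0)[M _ /(_ M (leqnn _))/=] := nearest_Lp_cvg Lw.
  by rewrite sub0r normrN => h; exists M; rewrite (le_trans (ler_norm _)).
have LM := Lpmap_nearest M Lw.
have mM : measurable_fun D (fun x => `|nearest q (w x) M - w x|).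
  under eq_fun do rewrite distrC.
  exact: measurable_dist_nearest Lw.1 _.
have close g : admissible g -> `|\int[mu]_(x in E) g x (nearest q (w x) M) -
    \int[mu]_(x in E) g x (w x)| <= e / 3.
  by move=> ga; exact: rP.
have /cvgrPdist_le/(_ _ e30) := step M E mE ED.
apply: filterS => h hM.
have -> : e = e / 3 + e / 3 + e / 3.
  by rewrite -!mulrDl -mulr2n -mulrSr -[e *+ 3]mulr_natr mulfK// pnatr_eq0.
rewrite (le_trans (ler_distD (\int[mu]_(x in E) f h x (nearest q (w x) M)) _ _))//.
rewrite lerD ?close//.
rewrite (le_trans (ler_distD (\int[mu]_(x in E) f' x (nearest q (w x) M)) _ _))//.
by rewrite lerD// distrC close.
Qed.

End convex_integrands.

(** * Extension of almost convex functions from a dense sequence *)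

Lemma cvg_truncn_ratio (R : realType) (t : R) : 0 <= t ->
  (fun n => (Num.truncn (t * n.+1%:R))%:R / n.+1%:R : R) @ \oo --> t.
Proof.
move=> t0; apply/cvgrPdist_lt => e e0.
have : \forall n \near \oo, n.+1%:R^-1 < e by exact: (near_infty_natSinv_lt (PosNum e0)).
apply: filterS => n ne.
have n0 : 0 < n.+1%:R :> R by [].
have /truncn_itv/andP[h1 h2] : 0 <= t * n.+1%:R by rewrite mulr_ge0.
rewrite ger0_norm; last by rewrite subr_ge0 ler_pdivrMr.
rewrite (le_lt_trans _ ne)// lerBlDr -[X in _ <= X + _]div1r -mulrDl ler_pdivlMr//.
by rewrite (le_trans (ltW h2))// -[in leLHS]addn1 natrD addrC.
Qed.

Section convex_extension.
Context (R : realType) (Z : normedModType R) (q : nat -> Z).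
Hypothesis q_dense : forall z (e : R), 0 < e -> exists k, `|z - q k| < e.
Variables (p K : R) (G : Z -> R).
Hypothesis p0 : 0 <= p.
Hypothesis K0 : 0 <= K.
Hypothesis G_cont : continuous G.

Let idx_ex (zn : Z * nat) : exists k, `|zn.1 - q k| < zn.2.+1%:R^-1.
Proof. by apply: q_dense; rewrite invr_gt0. Qed.

Definition approx_idx (z : Z) (n : nat) : nat := sval (cid (idx_ex (z, n))).

Lemma approx_idx_cvg z : (q \o approx_idx z) @ \oo --> z.
Proof.
apply/cvgrPdist_lt => e e0.
have : \forall n \near \oo, n.+1%:R^-1 < e by exact: (near_infty_natSinv_lt (PosNum e0)).
apply: filterS => n; apply: lt_trans; rewrite /approx_idx /=.
by case: cid.
Qed.

Definition dense_ext (F : nat -> R) (z : Z) : R := limn (F \o approx_idx z).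

(** Convexity as seen by the points q alone. The combination y of two of them is
    in general not one of them, and the last term pays for the passage from y to
    a third point q i3. Rational weights and parameters keep the number of
    conditions countable, so that they can hold simultaneously almost
    everywhere. *)
Definition almost_convex (b : R) (F : nat -> R) := forall i1 i2 i3 j k n,
  (j <= k.+1)%N ->
  let t := j%:R / k.+1%:R in
  let y := t *: q i1 + (1 - t) *: q i2 in
  F i3 <= t * F i1 + (1 - t) * F i2 + modulus p K b `|y| `|q i3 - y| n.+1%:R^-1.

Variables (b : R) (F : nat -> R).
Hypothesis b0 : 0 <= b.
Hypothesis F_bound : forall i, 0 <= F i <= b + G (q i).
Hypothesis F_cvx : almost_convex b F.

(** With weight t = 1 the point y is q i1, and what is left of the inequality is
    a modulus of continuity. *)
Lemma almost_convex_modulus z (e : R) : 0 < e -> exists2 r : R, 0 < r &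
  forall i j, `|q i - z| < r -> `|q j - z| < r -> `|F i - F j| <= e.
Proof.
move=> e0; suff [r r0 rP] : exists2 r : R, 0 < r &
    forall i j, `|q i - z| < r -> `|q j - z| < r -> F i <= F j + e.
  by exists r => // i j iz jz; rewrite ler_distl lerBlDr !rP.
have Y0 : 0 <= `|z| + 1 by rewrite addr_ge0.
have [t /andP[t0 t1] tP] := modulus_small p0 K0 b0 Y0 e0.
have [n _ /(_ n (leqnn n))/= nt] := near_infty_natSinv_lt (PosNum t0).
have n0 : 0 < n.+1%:R^-1 :> R by rewrite invr_gt0.
exists (n.+1%:R^-1 / 2); first by rewrite divr_gt0.
move=> i j iz jz.
have := @F_cvx j j i 1 0 n isT => /=.
rewrite divr1 subrr scale1r scale0r addr0 mul1r mul0r addr0 => /le_trans; apply.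
rewrite lerD2l; apply: tP; rewrite ?n0 ?(ltW nt) ?normr_ge0//=.
- rewrite -[q j](subrK z) addrC (le_trans (ler_normD _ _))// lerD2l.
  rewrite (le_trans (ltW jz))// (le_trans (ler_piMr (ltW n0) _))//.
    by rewrite invf_le1// ler1n.
  by rewrite invf_le1// ler1n.
- rewrite (le_trans (ler_distD z _ _))// [leRHS]splitr lerD// ltW//.
  by rewrite distrC.
Qed.

Lemma dense_ext_cvg (u : nat -> nat) z : (q \o u) @ \oo --> z ->
  (F \o u) @ \oo --> dense_ext F z.
Proof.
move=> uz.
have cF : cvgn (F \o approx_idx z).
  apply: cvgn_of_approx => e e0; have e20 : 0 < e / 2 by rewrite divr_gt0.
  have [r r0 rP] := almost_convex_modulus z e20.
  have /cvgrPdist_lt/(_ _ r0)[N _ NP] := @approx_idx_cvg z.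
  exists (F (approx_idx z N)); exists N => // n Nn /=.
  have h1 := NP _ Nn; have h2 := NP _ (leqnn N).
  rewrite /= distrC in h1; rewrite /= distrC in h2.
  rewrite (@le_lt_trans _ _ (e / 2))// ?gtr_pMr ?invf_lt1 ?ltr1n//.
  exact: rP.
apply/cvgrPdist_le => e e0; have e20 : 0 < e / 2 by rewrite divr_gt0.
have [r r0 rP] := almost_convex_modulus z e20.
have /cvgrPdist_lt/(_ _ r0) h1 := uz.
have /cvgrPdist_lt/(_ _ r0) h2 := @approx_idx_cvg z.
have /cvgrPdist_lt/(_ _ e20) h3 := cF.
near=> n.
rewrite [e]splitr (le_trans (ler_distD (F (approx_idx z n)) _ _))// lerD//.
  by apply: ltW; near: n; exact: h3.
have g1 : `|q (u n) - z| < r by rewrite distrC; near: n.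
have g2 : `|q (approx_idx z n) - z| < r by rewrite distrC; near: n.
exact: rP.
Unshelve. all: by end_near. Qed.

Lemma dense_extE i : dense_ext F (q i) = F i.
Proof.
have h : (F \o (fun=> i : nat)) @ \oo --> dense_ext F (q i).
  by apply: dense_ext_cvg; exact: cvg_cst.
by move/cvg_lim : h => <-//; apply: cvg_lim => //; exact: cvg_cst.
Qed.

Lemma dense_ext_bound z : 0 <= dense_ext F z <= b + G z.
Proof.
have h := dense_ext_cvg (@approx_idx_cvg z).
apply/andP; split.
  apply: (limr_ge (cvgP _ h)); apply: nearW => n /=.
  by have /andP[] := F_bound (approx_idx z n).
have Gz : (fun n => b + G (q (approx_idx z n))) @ \oo --> b + G z.
  apply: cvgD; first exact: cvg_cst.
  exact: (continuous_cvg _ (@G_cont z) (@approx_idx_cvg z)).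
apply: (ler_cvg_to h Gz); apply: nearW => n /=.
by have /andP[] := F_bound (approx_idx z n).
Qed.

(** Take the inequality at points q approximating y, z and their combination m,
    with rational weights tau n tending to t. The points whose distance enters
    the error term both tend to m, so this term ends below any e > 0. *)
Lemma dense_ext_cvx : cvx (dense_ext F).
Proof.
move=> t y z /andP[t0 t1]; set m := _ *: y + _.
apply/ler_addgt0Pr => e e0.
pose tau n : R := (Num.truncn (t * n.+1%:R))%:R / n.+1%:R.
have tau_t : tau @ \oo --> t by exact: cvg_truncn_ratio.
pose v n := tau n *: q (approx_idx y n) + (1 - tau n) *: q (approx_idx z n).
have v_m : v @ \oo --> m.
  apply: cvgD; apply: cvgZ => //; try exact: approx_idx_cvg.
  by apply: cvgB => //; exact: cvg_cst.
have Y0 : 0 <= `|m| + 1 by rewrite addr_ge0.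
have [s /andP[s0 s1] sP] := modulus_small p0 K0 b0 Y0 e0.
have [N _ /(_ N (leqnn N))/= Ns] := near_infty_natSinv_lt (PosNum s0).
have N0 : 0 < N.+1%:R^-1 :> R by rewrite invr_gt0.
have h1 := dense_ext_cvg (@approx_idx_cvg m).
have h2 : (fun n => tau n * F (approx_idx y n) + (1 - tau n) * F (approx_idx z n) + e)
    @ \oo --> t * dense_ext F y + (1 - t) * dense_ext F z + e.
  apply: cvgD; last exact: cvg_cst.
  apply: cvgD; apply: cvgM => //; try exact: (dense_ext_cvg (@approx_idx_cvg _)).
  by apply: cvgB => //; exact: cvg_cst.
apply: (ler_cvg_to h1 h2).
have N20 : 0 < N.+1%:R^-1 / 2 :> R by rewrite divr_gt0.
have /cvgrPdist_lt/(_ _ N20) g1 := v_m.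
have /cvgrPdist_lt/(_ _ N20) g2 := @approx_idx_cvg m.
near=> n => /=.
have jn : (Num.truncn (t * n.+1%:R) <= n.+1)%N.
  rewrite -(ler_nat R); have /truncn_itv/andP[/le_trans h _] : 0 <= t * n.+1%:R by rewrite mulr_ge0.
  by apply: h; rewrite ler_piMl.
apply: le_trans (F_cvx (approx_idx y n) (approx_idx z n) _ N jn) _.
rewrite -/(tau n) lerD2l; apply: sP; rewrite ?N0 ?(ltW Ns) ?normr_ge0//=.
- have : `|m - v n| < N.+1%:R^-1 / 2 by near: n.
  rewrite distrC => mv.
  rewrite -/(v n) -[v n](subrK m) addrC (le_trans (ler_normD _ _))// lerD2l.
  rewrite (le_trans (ltW mv))// (le_trans (ler_piMr (ltW N0) _))//.
    by rewrite invf_le1// ler1n.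
  by rewrite invf_le1// ler1n.
- rewrite (le_trans (ler_distD m _ _))// [leRHS]splitr lerD// ltW//.
    by rewrite distrC; near: n; exact: g2.
  by near: n; exact: g1.
Unshelve. all: by end_near. Qed.

End convex_extension.

(** * Compactness of convex integrands *)

Section compactness.
Context d (T : measurableType d) (R : realType).
Variable mu : {sigma_finite_measure set T -> \bar R}.
Variables (D : set T) (mD : measurable D).
Hypothesis muD : (mu D < +oo)%E.
Variable S : nat -> set T.
Hypothesis mS : forall k, measurable (S k).
Hypothesis S_dense : forall E, measurable E -> E `<=` D ->
  forall e : R, 0 < e ->
  exists k, (mu (D `&` ((E `\` S k) `|` (S k `\` E))) < e%:E)%E.
Variables (Z : normedModType R) (q : nat -> Z).
Hypothesis q0 : q 0 = 0.
Hypothesis q_dense : forall z (e : R), 0 < e -> exists k, `|z - q k| < e.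
Variables (p K : R) (G : Z -> R) (a : T -> R).
Hypothesis p0 : 0 < p.
Hypothesis K0 : 0 <= K.
Hypothesis G_ge0 : forall z, 0 <= G z.
Hypothesis G_le : forall z, G z <= K * `|z| `^ p.
Hypothesis G_cont : continuous G.
Hypothesis a0 : forall x, D x -> 0 <= a x.
Hypothesis ia : mu.-integrable D (EFin \o a).
Local Notation admissible := (admissible D G a).
Local Notation Lpmap := (Lpmap mu D q p).

Variable f : nat -> T -> Z -> R.
Hypothesis fa : forall h, admissible (f h).

Let b i x := a x + G (q i).

Let ib i : mu.-integrable D (EFin \o b i).
Proof. by apply: integrable_finD => //; exact: integrable_fin_cst. Qed.

Let f_ge0 h x z : D x -> 0 <= f h x z.
Proof. by move=> Dx; have [_ /(_ z)/andP[]] := (fa h).2 _ Dx. Qed.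

Let f_le h x z : D x -> f h x z <= a x + G z.
Proof. by move=> Dx; have [_ /(_ z)/andP[]] := (fa h).2 _ Dx. Qed.

Let ifz h z E : measurable E -> E `<=` D -> mu.-integrable E (EFin \o (f h ^~ z)).
Proof.
move=> mE ED; apply: (integrableS mD) => //.
apply: (@le_integrable_fin _ _ _ _ _ _ _ (fun x => a x + G z)) => //.
- exact: (fa h).1.
- by move=> x Dx; rewrite ger0_norm ?f_ge0 ?f_le.
- by apply: integrable_finD => //; exact: integrable_fin_cst.
Qed.

Lemma subsequence_cvg_cst : exists2 k : nat -> nat, {homo k : i j / (i < j)%N} &
  forall i j, cvgn (fun h => \int[mu]_(x in D `&` S j) f (k h) x (q i)).
Proof.
pose M n := if (unpickle n : option (nat * nat)) is Some (i, j) then \int[mu]_(x in D) b i x else 0.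
pose u n h := if (unpickle n : option (nat * nat)) is Some (i, j) then
  \int[mu]_(x in D `&` S j) f h x (q i) else 0.
have mDS j : measurable (D `&` S j) by exact: measurableI.
have DSD j : D `&` S j `<=` D by exact: subIsetl.
have [n h|k [kh kc]] := @diagonal_subsequence R u M.
  rewrite /u /M; case: unpickle => [[i j]|]; last by rewrite normr0.
  rewrite ger0_norm ?Rintegral_ge0//; last by move=> x /DSD Dx; exact: f_ge0.
  apply: (@le_trans _ _ (\int[mu]_(x in D `&` S j) b i x)).
    apply: le_Rintegral => //; first exact: ifz.
      exact: integrableS (ib i).
    by move=> x /DSD Dx; exact: f_le.
  apply: le_Rintegral_subset => // x Dx; exact: le_trans (f_ge0 0 (q i) Dx) (f_le _ _ Dx).
exists k => // i j; have := kc (pickle (i, j)).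
by rewrite /u; under eq_fun do rewrite pickleK.
Qed.

(** The weak limits g i of the functions f (k h) _ (q i) inherit almost everywhere
    each inequality satisfied by the f h, because it can be integrated over any
    measurable set and passed to the limit. Countably many inequalities are
    needed, so they hold together off one null set N; there the limit integrand
    extends i |-> g i x by density, and it is set to 0 on N. *)
Theorem admissible_compactness :
  exists2 k : nat -> nat, {homo k : i j / (i < j)%N} &
  exists2 f' : T -> Z -> R, admissible f' &
  forall w E, Lpmap w -> measurable E -> E `<=` D ->
    (fun h => \int[mu]_(x in E) f (k h) x (w x)) @ \oo -->
    \int[mu]_(x in E) f' x (w x).
Proof.
have [k kh kc] := subsequence_cvg_cst.
have /choice[g gP] : forall i, exists g : T -> R,
    mu.-integrable D (EFin \o g) /\
    forall E, measurable E -> E `<=` D ->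
      (fun h => \int[mu]_(x in E) f (k h) x (q i)) @ \oo --> \int[mu]_(x in E) g x.
  move=> i; have [g ig gP] := weak_L1_limit mD (fun h => (fa (k h)).1 (q i))
    (fun h x Dx => @f_ge0 (k h) x (q i) Dx) (fun h x Dx => @f_le (k h) x (q i) Dx)
    (@ib i) mS S_dense (@kc i).
  by exists g; split => //; exact: integrableS ig.
have igE i E : measurable E -> E `<=` D -> mu.-integrable E (EFin \o g i).
  by move=> mE ED; exact: integrableS (gP i).1.
have g_ge0 i : {ae mu, forall x, D x -> 0 <= g i x}.
  apply: ae_le_of_le_Rintegral => //; first exact: integrable_fin_cst.
    exact: (gP i).1.
  move=> E mE ED; rewrite Rintegral_cst// mul0r.
  have h := (gP i).2 E mE ED; apply: (ler_cvg_to (cvg_cst 0) h).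
  by apply: nearW => n; apply: Rintegral_ge0 => x /ED Dx; exact: f_ge0.
have g_le i : {ae mu, forall x, D x -> g i x <= b i x}.
  apply: ae_le_of_le_Rintegral => //; first exact: (gP i).1.
  move=> E mE ED.
  have h := (gP i).2 E mE ED; apply: (ler_cvg_to h (cvg_cst _)).
  apply: nearW => n /=; apply: le_Rintegral => //; first exact: ifz.
    exact: integrableS (ib i).
  by move=> x /ED Dx; exact: f_le.
pose ac i1 i2 i3 j l n x := let t := j%:R / l.+1%:R in
  let y := t *: q i1 + (1 - t) *: q i2 in
  g i3 x <= t * g i1 x + (1 - t) * g i2 x +
            modulus p K (a x) `|y| `|q i3 - y| n.+1%:R^-1.
have g_ac i1 i2 i3 j l n : (j <= l.+1)%N -> {ae mu, forall x, D x -> ac i1 i2 i3 j l n x}.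
  move=> jl; set t : R := j%:R / l.+1%:R.
  have t0 : 0 <= t by rewrite divr_ge0.
  have t1 : t <= 1 by rewrite ler_pdivrMr// mul1r ler_nat.
  set y := t *: q i1 + (1 - t) *: q i2.
  pose m x := modulus p K (a x) `|y| `|q i3 - y| n.+1%:R^-1.
  have im : mu.-integrable D (EFin \o m).
    apply: integrable_finZ => //; apply: integrable_finD => //.
    exact: integrable_fin_cst.
  apply: (@ae_le_of_le_Rintegral _ _ _ mu _ mD (g i3)
    (fun x => t * g i1 x + (1 - t) * g i2 x + m x)) => //; first exact: (gP i3).1.
    by apply: integrable_finD => //; apply: integrable_finD => //;
      apply: integrable_finZ => //; exact: (gP _).1.
  move=> E mE ED.
  have imE : mu.-integrable E (EFin \o m) by exact: integrableS im.
  have h3 := (gP i3).2 E mE ED.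
  have h1 := (gP i1).2 E mE ED.
  have h2 := (gP i2).2 E mE ED.
  rewrite RintegralD//; last by apply: integrable_finD => //; apply: integrable_finZ => //; exact: igE.
  rewrite RintegralD//; [|by apply: integrable_finZ => //; exact: igE..].
  rewrite RintegralZl//; last exact: igE.
  rewrite RintegralZl//; last exact: igE.
  have h12 : (fun h => t * \int[mu]_(x in E) f (k h) x (q i1) +
      (1 - t) * \int[mu]_(x in E) f (k h) x (q i2) + \int[mu]_(x in E) m x) @ \oo -->
      t * \int[mu]_(x in E) g i1 x + (1 - t) * \int[mu]_(x in E) g i2 x +
      \int[mu]_(x in E) m x.
    apply: cvgD; last exact: cvg_cst.
    by apply: cvgD; apply: cvgM => //; exact: cvg_cst.
  apply: (ler_cvg_to h3 h12).
  apply: nearW => h /=.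
  rewrite -RintegralZl//; last exact: ifz.
  rewrite -RintegralZl//; last exact: ifz.
  rewrite -RintegralD//; [|by apply: integrable_finZ => //; exact: ifz..].
  rewrite -RintegralD//; last by apply: integrable_finD => //; apply: integrable_finZ => //; exact: ifz.
  apply: le_Rintegral => //; first exact: ifz.
    by apply: integrable_finD => //; apply: integrable_finD => //;
      apply: integrable_finZ => //; exact: ifz.
  move=> x /ED Dx; have [fc fb] := (fa (k h)).2 _ Dx.
  have n01 : 0 < (n.+1%:R^-1 : R) <= 1 by rewrite invr_gt0 ltr0n invf_le1// ler1n.
  have := convex_modulus (ltW p0) K0 G_le (a0 Dx) fc fb y (q i3) n01.
  rewrite ler_norml => /andP[_]; rewrite lerBlDl => /le_trans; apply.
  by rewrite lerD2r; apply: fc; rewrite t0.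
have [N [mN N0 NP]] : {ae mu, forall x, D x ->
    [/\ forall i, 0 <= g i x <= b i x &
     almost_convex q p K (a x) (fun i => g i x)]}.
  have A1 : {ae mu, forall x, forall i, D x -> 0 <= g i x <= b i x}.
    apply: ae_foralln => i; move: (g_ge0 i) (g_le i); apply: filterS2 => x h1 h2 Dx.
    by rewrite h1// h2.
  have A2 : {ae mu, forall x, forall i1 i2 i3 j l n, (j <= l.+1)%N -> D x ->
     ac i1 i2 i3 j l n x}.
    apply: ae_foralln => i1; apply: ae_foralln => i2; apply: ae_foralln => i3.
    apply: ae_foralln => j; apply: ae_foralln => l; apply: ae_foralln => n.
    have [jl|jl] := leqP j l.+1; last by apply: aeW => x.
    by have := g_ac i1 i2 i3 _ _ n jl; apply: filterS => x h _.
  move: A1 A2; apply: filterS2 => x h1 h2 Dx; split => [i|]; first exact: h1.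
  by move=> i1 i2 i3 j l n jl; exact: h2.
pose f' x z := if x \in N then 0 else dense_ext q_dense (fun i => g i x) z.
have good x : D x -> x \notin N -> [/\ forall i, 0 <= g i x <= b i x &
     almost_convex q p K (a x) (fun i => g i x)].
  move=> Dx; rewrite notin_setE => xN.
  by apply: contrapT => h; apply: xN; apply: NP => /(_ Dx).
have f'a : admissible f'.
  split => [z|x Dx].
    apply: (@measurable_fun_cvg _ _ _ _ (fun n x => if x \in N then 0
       else g (approx_idx q_dense z n) x)).
      move=> n; apply: measurable_fun_if => //.
      - apply: (measurable_fun_bool true).
        rewrite (_ : _ @^-1` _ = N); first exact: measurableI.
        by apply/seteqP; split => y /=; [move/set_mem|move=> /mem_set].
      - apply: measurable_funS (_ : measurable_fun D _) => //.
        by apply/measurable_EFinP; exact: measurable_int (gP _).1.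
    move=> x Dx; rewrite /f'; case: ifPn => xN; first exact: cvg_cst.
    have [h1 h2] := good _ Dx xN.
    exact: (dense_ext_cvg (ltW p0) K0 (a0 Dx) h2 (@approx_idx_cvg _ _ _ q_dense z)).
  have [xN|xN] := boolP (x \in N).
    have -> : f' x = fun=> 0 by apply/funext => z; rewrite /f' xN.
    split => [t y z _|z]; first by rewrite !mulr0 addr0.
    by rewrite lexx addr_ge0// a0.
  have -> : f' x = dense_ext q_dense (fun i => g i x).
    by apply/funext => z; rewrite /f' (negbTE xN).
  have [h1 h2] := good _ Dx xN; split.
    exact: (dense_ext_cvx q_dense (ltW p0) K0 (a0 Dx) h2).
  move=> z; exact: (dense_ext_bound q_dense (ltW p0) K0 G_cont (a0 Dx) h1 h2).
exists k => //; exists f' => // w E Lw mE ED.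
apply: (cvg_integral_admissible mD q0 q_dense p0 K0 G_le a0 ia (fun h => fa (k h)) f'a) => //.
move=> i {mE ED}E mE ED.
rewrite (_ : \int[mu]_(x in E) f' x (q i) = \int[mu]_(x in E) g i x); first exact: (gP i).2.
congr fine; apply: ae_eq_integral => //.
- by apply/measurable_EFinP; apply: measurable_funS (f'a.1 (q i)).
- by apply: measurable_int (igE i E mE ED).
exists N; split => // x /= /not_implyP[Ex]; apply: contra_notP => xN; congr EFin.
rewrite /f' ifN; last by rewrite notin_setE.
have [h1 h2] := good _ (ED _ Ex) (negbT (memNset xN)).
exact: (dense_extE q_dense (ltW p0) K0 (a0 (ED _ Ex)) h2).
Qed.

End compactness.

(** * Boxes and Lebesgue measure on R^n *)

Lemma max_subr_split (R : realDomainType) (u v c : R) :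
  Num.max 0 (v - Num.max c u) + Num.max 0 (Num.min c v - u) = Num.max 0 (v - u).
Proof.
by rewrite /Num.max /Num.min; case: (ltP c u) => ?; case: (ltP c v) => ?;
  repeat (case: ltP => ?); lra. Qed.

Section box_measure.
Context (R : realType) (n : nat).
Implicit Types (a b x : 'rV[R]_n) (i : 'I_n) (c : R).
Local Notation mu := (leb R n).
Local Notation vol := (@box_volume R n).

Definition halfspace i c : set 'rV[R]_n := [set x | c < x ord0 i].

Definition box_above i c (o : option ('rV[R]_n * 'rV[R]_n)) :=
  if o is Some (a, b) then
    Some (\row_j (if j == i then Num.max c (a ord0 j) else a ord0 j), b)
  else None.

Definition box_below i c (o : option ('rV[R]_n * 'rV[R]_n)) :=
  if o is Some (a, b) then
    Some (a, \row_j (if j == i then Num.min c (b ord0 j) else b ord0 j))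
  else None.

Lemma box_aboveE i c o : box (box_above i c o) = box o `&` halfspace i c.
Proof.
case: o => [[a b]|]/=; last by rewrite set0I.
apply/seteqP; split => [x h|x [h cx] j].
- split => [j|]; last by have := h i; rewrite mxE eqxx gt_max => /andP[/andP[]].
  by have := h j; rewrite mxE; case: ifP => // _; rewrite gt_max => /andP[/andP[_ ->]].
- by have /andP[h1 h2] := h j; rewrite mxE h2; case: eqP => [->|_]; rewrite ?gt_max ?h1// andbT; have /andP[-> _] := h i; rewrite andbT.
Qed.

Lemma box_belowE i c o : box (box_below i c o) = box o `&` ~` halfspace i c.
Proof.
case: o => [[a b]|]/=; last by rewrite set0I.
apply/seteqP; split => [x h|x [h cx] j].
- split => [j|]; last first.
    by have := h i; rewrite mxE eqxx le_min => /andP[_ /andP[xc _]] /=; apply/negP; rewrite -leNgt.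
  by have := h j; rewrite mxE; case: ifP => // _; rewrite le_min => /andP[-> /andP[_ ->]].
- have /andP[h1 h2] := h j; rewrite mxE h1; case: eqP => [->|_]; rewrite ?le_min ?h2//.
  by have /andP[_ ->] := h i; rewrite andbT/= leNgt; apply/negP.
Qed.

Lemma box_volume_split i c o : (vol (box_above i c o) + vol (box_below i c o) = vol o)%E.
Proof.
case: o => [[a b]|]/=; last by rewrite adde0.
rewrite -EFinD; congr EFin.
rewrite (bigD1 i)//= [X in _ + X](bigD1 i)//= [RHS](bigD1 i)//= !mxE eqxx.
rewrite (eq_bigr (fun j => Num.max 0 (b ord0 j - a ord0 j))); last first.
  by move=> j ji; rewrite mxE (negbTE ji).
rewrite [X in _ + _ * X](eq_bigr (fun j => Num.max 0 (b ord0 j - a ord0 j))); last first.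
  by move=> j ji; rewrite mxE (negbTE ji).
rewrite -mulrDl; congr (_ * _).
exact: max_subr_split.
Qed.

(** A hyperplane cuts every box of a cover into two boxes whose volumes add up
    to the original one, so the outer measure is additive across it. *)
Lemma halfspace_measurable i c : measurable (halfspace i c : set (rVleb R n)).
Proof.
apply: le_caratheodory_measurable => X.
apply: le_ereal_inf_tmp => _ [s Xs <-].
have -> : (\sum_(k <oo) vol (s k) = \sum_(k <oo) vol (box_above i c (s k)) +
    \sum_(k <oo) vol (box_below i c (s k)))%E.
  rewrite -nneseriesD; try by move=> *; exact: box_volume_ge0.
  by apply: eq_eseriesr => k _; rewrite box_volume_split.
apply: leeD; apply: ereal_inf_lbound.
- exists (fun k => box_above i c (s k)) => // x [/Xs [k _ skx] xH].
  by exists k => //; rewrite box_aboveE.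
- exists (fun k => box_below i c (s k)) => // x [/Xs [k _ skx] xH].
  by exists k => //; rewrite box_belowE.
Qed.

Lemma box_measurable o : measurable (box o : set (rVleb R n)).
Proof.
case: o => [[a b]|]; last exact: measurable0.
rewrite (_ : box _ = \bigcap_(i in [set: 'I_n])
  (halfspace i (a ord0 i) `&` ~` halfspace i (b ord0 i))).
  apply: fin_bigcap_measurable => // i _; apply: measurableI.
    exact: halfspace_measurable.
  by apply: measurableC; exact: halfspace_measurable.
apply/seteqP; split => x h i; first by move=> _; have /andP[h1 h2] := h i;
  split => //; rewrite /halfspace/=; apply/negP; rewrite -leNgt.
have [h1 h2] := h i I; rewrite h1/= leNgt; exact/negP.
Qed.

Lemma leb_cover_le (s : nat -> option ('rV[R]_n * 'rV[R]_n)) :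
  (mu (\bigcup_k box (s k)) <= \sum_(k <oo) vol (s k))%E.
Proof. by apply: ereal_inf_lbound; exists s. Qed.

Lemma leb_box_le o : (mu (box o) <= vol o)%E.
Proof.
pose s (k : nat) := if k == 0 then o else None.
have -> : box o = \bigcup_k box (s k).
  by apply/seteqP; split => [x ox|x [k _]]; [exists 0%N|rewrite /s; case: eqP].
apply: (le_trans (leb_cover_le s)).
rewrite (nneseries_split 0 1); last by move=> *; exact: box_volume_ge0.
rewrite add0n big_nat1 eseries0 ?adde0//.
by move=> [|k].
Qed.

Lemma bounded_leb_lty (A : set 'rV[R]_n) : measurable (A : set (rVleb R n)) ->
  bounded_set A -> (mu A < +oo)%E.
Proof.
move=> mA [M [_ /(_ (`|M| + 1))]].
rewrite (le_lt_trans (ler_norm _)) ?ltrDl// => /(_ isT) AM.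
pose o := Some (const_mx (- (`|M| + 2)) : 'rV[R]_n, const_mx (`|M| + 2) : 'rV[R]_n).
apply: (@le_lt_trans _ _ (mu (box o))).
  apply: le_measure; rewrite ?inE//; first exact: box_measurable.
  move=> x /AM /= xM i; rewrite !mxE.
  have : `|x ord0 i| <= `|M| + 1.
    by apply: le_trans xM; rewrite [leRHS]mx_normrE;
      exact: (le_bigmax _ (fun ij => `|x ij.1 ij.2|) (ord0, i)).
  rewrite ler_norml => /andP[h1 h2]; apply/andP; split; lra.
by apply: (le_lt_trans (leb_box_le o)); rewrite ltry.
Qed.

Definition rat_box (o : option ('rV[rat]_n * 'rV[rat]_n)) :
    option ('rV[R]_n * 'rV[R]_n) :=
  omap (fun ab => (map_mx ratr ab.1, map_mx ratr ab.2)) o.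

Lemma rat_row_between a b : (forall i, a ord0 i < b ord0 i) ->
  exists q : 'rV[rat]_n, forall i, a ord0 i < ratr (q ord0 i) < b ord0 i.
Proof.
move=> ab.
have /choice[q qP] : forall i, exists r : rat, a ord0 i < ratr r < b ord0 i.
  by move=> i; have [r] := rat_in_itvoo (ab i); rewrite in_itv/=; exists r.
by exists (\row_i q i) => i; rewrite mxE.
Qed.

Lemma rat_box_in_ball x (e : R) : 0 < e ->
  exists o, box (rat_box o) x /\ box (rat_box o) `<=` ball x e.
Proof.
move=> e0.
have [|a aP] := @rat_row_between (x - const_mx e) x.
  by move=> i; rewrite !mxE ltrBlDr ltrDl.
have [|b bP] := @rat_row_between x (x + const_mx e).
  by move=> i; rewrite !mxE ltrDl.
exists (Some (a, b)); split => [i|y h]; last split => // i j.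
- by rewrite !mxE; have /andP[_ ->] := aP i; have /andP[/ltW -> _] := bP i.
- rewrite ord1; have := aP j; have := bP j; have := h j; rewrite !mxE /ball/=.
rewrite ltr_norml => /andP[h1 h2] /andP[h3 h4] /andP[h5 h6].
apply/andP; split; lra.
Qed.

Lemma open_bigcup_rat_box (A : set 'rV[R]_n) : open A ->
  A = \bigcup_(o in [set o | box (rat_box o) `<=` A]) box (rat_box o).
Proof.
move=> oA; apply/seteqP; split => [x Ax|x [ab abA]]; last exact: abA.
have /nbhs_ballP[e /= e0 eA] := open_nbhs_nbhs (conj oA Ax).
have [ab [abx abe]] := rat_box_in_ball x e0.
by exists ab => //= y /abe; exact: eA.
Qed.

Lemma open_measurable_leb (A : set 'rV[R]_n) : open A ->
  measurable (A : set (rVleb R n)).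
Proof.
move=> /open_bigcup_rat_box ->; rewrite bigcup_mkcond.
apply: countable_bigcupT_measurable; first exact: countableP.
by move=> o; case: ifP => _; [exact: box_measurable|exact: measurable0].
Qed.

Lemma box_volume_rat_enlarge a b (e : R) : 0 < e -> exists o,
  box (Some (a, b)) `<=` box (rat_box o) /\ (vol (rat_box o) <= vol (Some (a, b)) + e%:E)%E.
Proof.
move=> e0.
pose V (r : R) := \prod_(i < n) Num.max 0 (b ord0 i - a ord0 i + r).
have V0 : V r @[r --> (0:R)] --> V 0.
  rewrite /V; elim: (index_enum _) => [|i s IH].
    under eq_fun do rewrite big_nil; rewrite big_nil; exact: cvg_cst.
  under eq_fun do rewrite big_cons; rewrite big_cons; apply: cvgM => //.
  apply: (@continuous_max _ _ (cst 0) (fun r => b ord0 i - a ord0 i + r) 0).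
    exact: cvg_cst.
  by apply: cvgD; [exact: cvg_cst|exact: cvg_id].
have /cvgrPdist_lt/(_ _ e0) := V0; rewrite -[nbhs 0]/(nbhs (0 : R)).
move=> /nbhs_ballP[d /= d0 dV].
pose r := d / 2; have r0 : 0 < r by rewrite divr_gt0.
have Vr : V r <= V 0 + e.
  have /= := dV r; rewrite /ball/= sub0r normrN gtr0_norm// => /(_ _)/ltW.
  have rd : r < d by rewrite /r ltr_pdivrMr// mulr_natr mulr2n ltrDl.
  by move=> /(_ rd); rewrite ler_distlC => /andP[].
have [|a' aP] := @rat_row_between (a - const_mx (r / 2)) a.
  by move=> i; rewrite !mxE ltrBlDr ltrDl divr_gt0.
have [|b' bP] := @rat_row_between b (b + const_mx (r / 2)).
  by move=> i; rewrite !mxE ltrDl divr_gt0.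
exists (Some (a', b')); split.
  move=> x h i; have /andP[h1 h2] := h i; rewrite !mxE.
  have /andP[_ h3] := aP i; have /andP[h4 _] := bP i.
  by rewrite (lt_trans h3 h1) (le_trans h2 (ltW h4)).
rewrite -EFinD lee_fin.
have -> : \prod_(i < n) Num.max 0 (b ord0 i - a ord0 i) = V 0.
  by apply: eq_bigr => i _; rewrite addr0.
apply: le_trans Vr; apply: ler_prod => i _; rewrite le_max lexx/= !mxE.
have := aP i; have := bP i; rewrite !mxE => /andP[h1 h2] /andP[h3 h4].
by rewrite ge_max le_max lexx/= le_max; apply/orP; right; lra.
Qed.

Definition rat_boxes (k : nat) : set 'rV[R]_n :=
  if (unpickle k : option (seq (option ('rV[rat]_n * 'rV[rat]_n)))) is Some s then
    \big[setU/set0]_(o <- s) box (rat_box o) else set0.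

Lemma rat_boxes_measurable k : measurable (rat_boxes k : set (rVleb R n)).
Proof.
rewrite /rat_boxes; case: unpickle => [s|]; last exact: measurable0.
by apply: bigsetU_measurable => o _; exact: box_measurable.
Qed.

(** Take a cover of E by boxes with rational corners, of total volume close to the
    measure of E: its union U exceeds E by little, and continuity from above makes
    the part of U missed by the first N boxes small. *)
Lemma rat_boxes_dense (E : set 'rV[R]_n) (e : R) :
  measurable (E : set (rVleb R n)) -> (mu E < +oo)%E -> 0 < e ->
  exists k, (mu ((E `\` rat_boxes k) `|` (rat_boxes k `\` E)) < e%:E)%E.
Proof.
move=> mE Eoo e0; have e40 : 0 < e / 4 by rewrite divr_gt0.
have Efin : mu E \is a fin_num by rewrite ge0_fin_numE.
have [_ [s Es <-] sE] := lb_ereal_inf_adherent e40 Efin.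
have /choice[t tP] : forall k, exists ab, box (s k) `<=` box (rat_box ab) /\
    (vol (rat_box ab) <= vol (s k) + ((e / 4) / (2 ^ k.+1)%:R)%:E)%E.
  move=> k; have ek0 : 0 < (e / 4) / (2 ^ k.+1)%:R by rewrite divr_gt0 ?ltr0n ?expn_gt0.
  case: (s k) => [[a b]|]; first exact: box_volume_rat_enlarge.
  by exists None; split => //=; rewrite add0e lee_fin ltW.
pose U := \bigcup_k box (rat_box (t k)).
pose UN N := \big[setU/set0]_(k < N) box (rat_box (t k)).
have UNE N : UN N = \bigcup_(k in `I_N) box (rat_box (t k)) by rewrite bigcup_mkord.
have mU : measurable (U : set (rVleb R n)).
  by apply: bigcupT_measurable => k; exact: box_measurable.
have mUN N : measurable (UN N : set (rVleb R n)).
  by apply: bigsetU_measurable => k _; exact: box_measurable.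
have EU : E `<=` U by move=> x /Es[k _ /(tP k).1 xk]; exists k.
have UE : (mu U < mu E + (e / 2)%:E)%E.
  apply: (le_lt_trans (leb_cover_le (fun k => rat_box (t k)))).
  apply: (@le_lt_trans _ _ (\sum_(k <oo) vol (s k) + (e / 4)%:E)%E).
    apply: le_trans (epsilon_trick _ _ _); last 2 first.
    - by move=> k; exact: box_volume_ge0.
    - exact: ltW.
    by apply: lee_nneseries => k *; [exact: box_volume_ge0|exact: (tP k).2].
  have -> : (e / 2)%:E = ((e / 4)%:E + (e / 4)%:E)%E by rewrite -EFinD; congr EFin; lra.
  by rewrite addeA lte_leD.
have Ufin : mu U \is a fin_num.
  by rewrite ge0_fin_numE// (lt_trans UE)// -(fineK Efin) -EFinD ltry.
have UmE : (mu (U `\` E) < (e / 2)%:E)%E.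
  rewrite measureD//; last by rewrite -ge0_fin_numE.
  by rewrite setIidr// lteBlDl.
have cvgU : (mu (U `\` UN N) @[N --> \oo] --> 0)%E.
  have := @nonincreasing_cvg_mu _ _ _ mu (fun N => U `\` UN N).
  have -> : \bigcap_N (U `\` UN N) = set0.
    rewrite -subset0 => x h; have [[k _ xk] _] := h 0%N I.
    have [_ nUN] := h k.+1 I; case: nUN; rewrite UNE; exists k => //=.
  rewrite measure0; apply => //.
  - apply: le_lt_trans (_ : mu U < +oo)%E; last by rewrite -ge0_fin_numE.
    by apply: le_measure; rewrite ?inE//; exact: measurableD.
  - by move=> N; exact: measurableD.
  - move=> N M NM; apply/subsetPset => x [Ux h]; split => //; apply: contra_not h.
    rewrite !UNE => -[k /= kN xk]; exists k => //=.
    exact: leq_trans NM.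
have [N NP] : exists N, (mu (U `\` UN N) < (e / 2)%:E)%E.
  have e20 : 0 < e / 2 by rewrite divr_gt0.
  have /fine_cvgP[fN /cvgrPdist_lt/(_ _ e20) cN] := cvgU.
  have [N _ NP] := filterI fN cN; exists N.
  have [/= h1 h2] := NP N (leqnn N).
  rewrite -(fineK h1) lte_fin; apply: le_lt_trans h2.
  by rewrite sub0r normrN ler_norm.
exists (pickle [seq t k | k <- index_iota 0 N]).
have -> : rat_boxes (pickle [seq t k | k <- index_iota 0 N]) = UN N.
  by rewrite /rat_boxes pickleK big_map /UN big_mkord.
apply: (@le_lt_trans _ _ (mu (U `\` UN N) + mu (U `\` E))%E).
  apply: le_trans (measureU2 _ _ _); [|exact: measurableD..].
  apply: le_measure; rewrite ?inE; [by apply: measurableU; exact: measurableD..|].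
  move=> x [[Ex nx]|[Ux nx]]; [left; split => //; exact: EU|right; split => //].
  by move: Ux; rewrite UNE => -[k _ xk]; exists k.
have -> : e%:E = ((e / 2)%:E + (e / 2)%:E)%E by rewrite -EFinD -splitr.
by apply: lteD.
Qed.

Lemma leb_sigma_finite : sigma_finite setT mu.
Proof.
pose o (k : nat) := Some (const_mx (- k%:R) : 'rV[R]_n, const_mx k%:R : 'rV[R]_n).
exists (fun k => box (o k)); last first.
  move=> k; split; first exact: box_measurable.
  by apply: (le_lt_trans (leb_box_le _)); rewrite ltry.
apply/esym/seteqP; split => // x' _; set x : 'rV[R]_n := x'.
pose M := (Num.truncn `|x|).+1; exists M => //= i; rewrite !mxE.
have : `|x ord0 i| < M%:R.
  apply: (@le_lt_trans _ _ `|x|).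
    by rewrite [leRHS]mx_normrE; exact: (le_bigmax _ (fun ij => `|x ij.1 ij.2|) (ord0, i)).
  by have /truncn_itv/andP[_] := normr_ge0 x.
by rewrite ltr_norml => /andP[-> /ltW].
Qed.

(** A name of its own, to which the sigma-finite structure can be attached. *)
Definition leb_sf : set (rVleb R n) -> \bar R := leb R n.

HB.instance Definition _ := Measure.copy leb_sf (leb R n).
HB.instance Definition _ := Measure_isSigmaFinite.Build _ _ _ leb_sf leb_sigma_finite.

End box_measure.

(** * Bump functions adapted to boxes *)

Section flat_function.
Variable R : realType.
Implicit Types (s t x : R) (k : nat).

(** [flat 0] is Cauchy's smooth function that vanishes to infinite order at 0; the
    powers of 1 / s appear in its derivatives. *)
Definition flat k s : R := if 0 < s then s^-1 ^+ k * expR (- s^-1) else 0.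

Lemma flat_ge0 k s : 0 <= flat k s.
Proof.
by rewrite /flat; case: ifP => // s0; rewrite mulr_ge0 ?expR_ge0// exprn_ge0// invr_ge0 ltW.
Qed.

Lemma flatS k s : s * flat k.+1 s = flat k s.
Proof.
rewrite /flat; case: ifP => [s0|_]; last by rewrite mulr0.
by rewrite exprS !mulrA mulfV ?gt_eqF// mul1r.
Qed.

(** One term of the exponential series: (1 / s)^(k+1) / (k+1)! <= exp (1 / s). *)
Lemma flat_le k s : flat k s <= k.+1`!%:R * `|s|.
Proof.
rewrite /flat; case: ifP => [s0|_]; last by rewrite mulr_ge0.
rewrite gtr0_norm// expRN ler_pdivrMr ?expR_gt0//.
have si0 : 0 <= s^-1 by rewrite invr_ge0 ltW.
have h := expR_ge1Dxn k si0.
apply: (@le_trans _ _ (k.+1`!%:R * s * (s^-1 ^+ k.+1 / k.+1`!%:R))).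
  rewrite exprS (_ : _ * s * _ = s^-1 ^+ k * (k.+1`!%:R / k.+1`!%:R) * (s * s^-1)); last by ring.
  by rewrite !divff ?gt_eqF// ?mulr1// ltr0n fact_gt0.
rewrite ler_wpM2l ?mulr_ge0 ?(ltW s0)//; apply: le_trans h.
by rewrite lerDr.
Qed.

Lemma is_derive_of_cvg (V W : normedModType R) (f : V -> W) (x v : V) (l : W) :
  h^-1 *: (f (h *: v + x) - f x) @[h --> 0^'] --> l -> is_derive x v f l.
Proof. by move=> h; apply: DeriveDef; [exact: cvgP h|exact: cvg_lim]. Qed.

(** The critical point is 0, where the difference quotient of [flat k] at h is
    [flat k.+1 h], which tends to 0 by [flat_le]. *)
Lemma is_derive_flat k s : is_derive s 1 (flat k) (flat k.+2 s - k%:R * flat k.+1 s).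
Proof.
have [s0|s0|->] := ltgtP s 0.
- have -> : flat k.+2 s - k%:R * flat k.+1 s = 0.
    by rewrite /flat lt_gtF// mulr0 subrr.
  have h : is_derive s 1 (cst (0 : R)) 0 by exact: is_derive_cst.
  apply: near_eq_is_derive h.
  near=> y; rewrite /flat lt_gtF//; near: y; exact: lt_nbhsl.
- have dV : is_derive s 1 (fun y : R => y^-1) (- s ^- 2 *: 1).
    by apply: (@is_deriveV _ id); rewrite ?gt_eqF//.
  have dE : is_derive s 1 (fun y : R => expR (- y^-1)) (expR (- s^-1) * (- (- s ^- 2 *: 1))).
    by apply: (@is_derive1_comp _ expR (fun y => - y^-1)).
  have dM := is_deriveM (is_deriveX k dV) dE.
  have := @near_eq_is_derive _ _ _ _ (flat k) _ _ _ _ dM.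
  have -> : flat k.+2 s - k%:R * flat k.+1 s = ((fun y : R => y^-1) ^+ k) s *: (expR (- s^-1) * - (- s ^- 2 *: 1)) +
     expR (- s^-1) *: ((k%:R * s^-1 ^+ k.-1) *: (- s ^- 2 *: 1)).
    rewrite /flat s0 fctE /GRing.scale/= -exprVn.
    by case: k {dM} => [|k]; rewrite ?mul0r ?mulr0 ?expr0 ?subr0/= ?exprS; ring.
  apply; near=> y; rewrite /flat ifT; last by near: y; exact: lt_nbhsr.
  by rewrite !fctE.
- have -> : flat k.+2 0 - k%:R * flat k.+1 0 = 0.
    by rewrite /flat ltxx mulr0 subrr.
  apply: is_derive_of_cvg; apply/cvgrPdist_lt => e e0.
  have f0 : flat k 0 = 0 by rewrite /flat ltxx.
  pose c : R := k.+2`!%:R.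
  have c0 : 0 < c by rewrite ltr0n fact_gt0.
  have ec : 0 < e / c by rewrite divr_gt0.
  near=> h; rewrite sub0r normrN addr0 f0 subr0 /GRing.scale/= mulr1 -flatS mulKf//; last first.
    by near: h; exact: nbhs_dnbhs_neq.
  rewrite ger0_norm ?flat_ge0// (le_lt_trans (flat_le _ _))// -/c mulrC -ltr_pdivlMr//.
  by near: h; apply: dnbhs0_lt.
Unshelve. all: by end_near. Qed.
End flat_function.

Lemma continuous_prod_coord (R : realType) n (g : 'I_n -> R -> R) (s : seq 'I_n)
    (x : 'rV[R]_n) :
  (forall i, {for x ord0 i, continuous (g i)}) ->
  {for x, continuous (fun x : 'rV[R]_n => \prod_(i <- s) g i (x ord0 i))}.
Proof.
move=> gc; elim: s => [|i s IH].
  rewrite (_ : (fun _ => _) = cst 1); first exact: cst_continuous.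
  by apply/funext => y; rewrite big_nil.
rewrite (_ : (fun _ => _) = (fun y : 'rV[R]_n => g i (y ord0 i)) \*
  (fun y : 'rV[R]_n => \prod_(i <- s) g i (y ord0 i))); last first.
  by apply/funext => y; rewrite big_cons.
apply: continuousM => //.
apply: (@continuous_comp _ _ _ (fun y : 'rV[R]_n => y ord0 i) (g i)).
  exact: coord_continuous.
exact: gc.
Qed.

Section bump_functions.
Variable R : realType.
Implicit Types (q : {poly R}) (t : R).

(** Polynomial factors of the derivatives of t |-> flat 0 q.[t]: the k-th one is
    [bump_coef q k] times [flat k.*2] at q.[t]. Each differentiation raises the
    exponent by 2, and [flatS] reduces its three terms to that exponent. *)
Fixpoint bump_coef q (k : nat) : {poly R} :=
  if k is k'.+1 then
    let P := bump_coef q k' in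
    P^`() * q ^+ 2 + P * q^`() - (k'.*2)%:R *: (P * q^`() * q)
  else 1.

Definition bump_derivn q k t := (bump_coef q k).[t] * flat k.*2 q.[t].

Lemma is_derive_bump q k t :
  is_derive t 1 (bump_derivn q k) (bump_derivn q k.+1 t).
Proof.
apply: (is_derive_eq (is_deriveM (is_derive_poly (bump_coef q k) t)
  (is_derive1_comp (is_derive_flat k.*2 q.[t]) (is_derive_poly q t)))).
rewrite /bump_derivn /= !hornerE /GRing.scale/= doubleS.
by rewrite -(flatS k.*2) -(flatS k.*2.+1); ring.
Qed.

Context (n : nat) (W : normedModType R).
Variable f : 'I_n -> nat -> R -> R.
Hypothesis df : forall i k t, is_derive t 1 (f i k) (f i k.+1 t).
Variable e : W.

(** The hypothesis on f makes [f i k] the k-th derivative of [f i 0], so that a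
    partial derivative only increments one entry of the multi-index c. *)
Definition tensor (c : 'I_n -> nat) (x : 'rV[R]_n) : W :=
  (\prod_(i < n) f i (c i) (x ord0 i)) *: e.

Lemma is_derive_tensor c j x : is_derive x (delta_mx ord0 j) (tensor c)
  (tensor (fun i => (c i + (i == j))%N) x).
Proof.
apply: is_derive_of_cvg.
rewrite [X in _ --> X]/tensor.
pose P := \prod_(i < n | i != j) f i (c i) (x ord0 i).
have -> : \prod_(i < n) f i (c i + (i == j))%N (x ord0 i) = f j (c j).+1 (x ord0 j) * P.
  rewrite (bigD1 j)//= eqxx addn1; congr (_ * _).
  by apply: eq_bigr => i /negbTE ->; rewrite addn0.
have E h : h^-1 *: (tensor c (h *: delta_mx ord0 j + x) - tensor c x) =
  (h^-1 * (f j (c j) (h * 1 + x ord0 j) - f j (c j) (x ord0 j)) * P) *: e.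
  rewrite /tensor -scalerBl scalerA -mulrA; congr (_ * _ *: _).
  rewrite (bigD1 j)//= [X in _ - X](bigD1 j)//= !mxE !eqxx mulrBl; congr (_ * _ - _).
  apply: eq_bigr => i ij; rewrite !mxE (negbTE ij) andbF mulr0 add0r//.
under eq_fun do rewrite E.
have dv := @derive_val _ _ _ _ _ _ _ (df j (c j) (x ord0 j)).
apply: cvgZr_tmp; apply: cvgM; last exact: cvg_cst.
rewrite -dv.
exact: (@ex_derive _ _ _ _ _ _ _ (df j (c j) (x ord0 j))).
Qed.

Lemma continuous_tensor c : continuous (tensor c).
Proof.
have g_cont (s : seq 'I_n) :
    continuous (fun x : 'rV[R]_n => \prod_(i <- s) f i (c i) (x ord0 i)).
  move=> x; apply: (@continuous_prod_coord _ _ (fun i => f i (c i))) => i.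
  apply: differentiable_continuous; apply/derivable1_diffP.
  exact: (@ex_derive _ _ _ _ _ _ _ (df i (c i) (x ord0 i))).
move=> x; exact: (cvgZr_tmp (@g_cont _ x)).
Qed.

Lemma foldr_partial_tensor c (s : seq 'I_n) :
  foldr (@partial R n W) (tensor c) s = tensor (fun i => (c i + count_mem i s)%N).
Proof.
elim: s => [|j s IH] /=.
  by congr tensor; apply/funext => i; rewrite addn0.
rewrite IH; apply/funext => x; rewrite /partial.
rewrite (@derive_val _ _ _ _ _ _ _ (is_derive_tensor _ j x)).
congr (tensor _ x); apply/funext => i; rewrite -addnA; congr addn.
by rewrite addnC eq_sym.
Qed.

Lemma smooth_tensor c : smooth (tensor c).
Proof.
move=> s; rewrite foldr_partial_tensor; split; first exact: continuous_tensor.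
by move=> i x; exact: (@ex_derive _ _ _ _ _ _ _ (is_derive_tensor _ i x)).
Qed.

End bump_functions.

Section box_bump.
Context (R : realType) (n m : nat).
Implicit Types (a b x : 'rV[R]_n) (r : R) (e : 'rV[R]_m).

(** The parabola under [flat 0] is positive exactly between a i and b i, and r is
    its steepness. *)
Definition bump_fun a b r x : R :=
  \prod_(i < n) flat 0 (r * (x ord0 i - a ord0 i) * (b ord0 i - x ord0 i)).

Lemma flat_le1 t : flat 0 t <= 1 :> R.
Proof.
rewrite /flat; case: ifP => // t0; rewrite expr0 mul1r -expR0 ler_expR.
by rewrite oppr_le0 invr_ge0 ltW.
Qed.

Lemma bump_fun_ge0 a b r x : 0 <= bump_fun a b r x.
Proof. by apply: prodr_ge0 => i _; exact: flat_ge0. Qed.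

Lemma bump_fun_le1 a b r x : bump_fun a b r x <= 1.
Proof. by apply: prodr_ile1 => i _; rewrite flat_ge0 flat_le1. Qed.

Lemma bump_fun_neq0 a b r x : (forall i, a ord0 i <= b ord0 i) -> 0 < r ->
  bump_fun a b r x != 0 -> forall i, a ord0 i <= x ord0 i <= b ord0 i.
Proof.
move=> ab r0 /prodf_neq0 h i; have := h i isT; rewrite /flat.
case: ifP => [p0 _|_ /eqP//].
have := ab i; move: p0; rewrite -mulrA pmulr_rgt0//.
set u := a _ _; set v := b _ _; set t := x _ _; move=> p0 uv.
apply/andP; split; rewrite leNgt; apply/negP => h'; move: p0; apply/negP; rewrite -leNgt; nra.
Qed.

Lemma continuous_flat k : continuous (flat k : R -> R).
Proof.
move=> t; apply: differentiable_continuous; apply/derivable1_diffP.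
exact: (@ex_derive _ _ _ _ _ _ _ (is_derive_flat k t)).
Qed.

Lemma continuous_bump_fun a b r : continuous (bump_fun a b r).
Proof.
move=> x; apply: (@continuous_prod_coord _ _
  (fun i t => flat 0 (r * (t - a ord0 i) * (b ord0 i - t)))) => i.
apply: (@continuous_comp _ _ _ _ (flat 0)); last exact: continuous_flat.
apply: cvgM; first apply: cvgM; first exact: cvg_cst.
  by apply: cvgB; [exact: cvg_id|exact: cvg_cst].
by apply: cvgB; [exact: cvg_cst|exact: cvg_id].
Qed.

Lemma test_fun_bump (Omega : set 'rV[R]_n) a b r e :
  (forall i, a ord0 i <= b ord0 i) -> 0 < r ->
  [set x : 'rV[R]_n | forall i, a ord0 i <= x ord0 i <= b ord0 i] `<=` Omega ->
  test_fun Omega (fun x : 'rV[R]_n => bump_fun a b r x *: e).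
Proof.
move=> ab r0 abO.
pose q i : {poly R} := r *: (('X - (a ord0 i)%:P) * ((b ord0 i)%:P - 'X)).
have E : (fun x : 'rV[R]_n => bump_fun a b r x *: e) = tensor (fun i => bump_derivn (q i)) e (fun=> 0%N).
  apply/funext => x; rewrite /tensor /bump_fun; congr (_ *: _).
  by apply: eq_bigr => i _; rewrite /bump_derivn/= /q !hornerE.
have cl : closed [set x : 'rV[R]_n | forall i, a ord0 i <= x ord0 i <= b ord0 i].
  rewrite (_ : [set x | _] = \bigcap_i [set x : 'rV[R]_n | a ord0 i <= x ord0 i <= b ord0 i]).
    apply: closed_bigI => i _.
    rewrite (_ : [set x | _] = (fun x : 'rV[R]_n => x ord0 i) @^-1` `[a ord0 i, b ord0 i]%classic).
      apply: preimage_closed; last exact: interval_closed.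
      by move=> x _; exact: coord_continuous.
    by apply/seteqP; split => x /=; rewrite in_itv.
  by apply/seteqP; split => x h i; [move=> _|]; exact: (h i).
have sub : closure [set x : 'rV[R]_n | bump_fun a b r x *: e != 0] `<=`
    [set x : 'rV[R]_n | forall i, a ord0 i <= x ord0 i <= b ord0 i].
  rewrite [X in _ `<=` X](closure_id _).1//; apply: closureS => x /=.
  by rewrite scaler_eq0 negb_or => /andP[h _]; exact: bump_fun_neq0 h.
split.
- by rewrite E; apply: smooth_tensor => i k t; exact: is_derive_bump.
- apply: (@subclosed_compact _ _ [set x : 'rV[R]_n | forall i, `[a ord0 i, b ord0 i]%classic (x ord0 i)]).
  + exact: closed_closure.
  + by apply: (@rV_compact _ _ (fun i => `[a ord0 i, b ord0 i]%classic)) => i; exact: segment_compact.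
  + by move=> x /sub h i; rewrite /= in_itv/=; exact: h.
- exact: subset_trans sub abO.
Qed.

(** Moving the upper corner outwards by d / (k + 1) makes the limit 1 on the upper
    faces and 0 on the lower ones, as for half-open boxes. The steepness
    (k + 1)^2 outweighs the distance d / (k + 1) at the upper faces. *)
Definition bump_seq a b (d : R) (k : nat) : 'rV[R]_n -> R :=
  bump_fun a (b + const_mx (d / k.+1%:R)) (k.+1%:R ^+ 2).

Lemma flat0_cvg1 (u : nat -> R) : u @ \oo --> +oo -> (fun k => flat 0 (u k)) @ \oo --> (1 : R).
Proof.
move=> uoo.
have u0 : \forall k \near \oo, 0 < u k by move/cvgryPgt : uoo; exact.
have h : (fun k => expR (- (u k)^-1)) @ \oo --> (1 : R).
  rewrite -expR0 -oppr0; apply: (@continuous_cvg _ _ _ _ _ _ expR).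
    exact: continuous_expR.
  by apply: cvgN; apply/gtr0_cvgV0.
apply: cvg_trans h; apply: near_eq_cvg; near=> k.
rewrite /flat ifT ?expr0 ?mul1r//.
by near: k.
Unshelve. all: by end_near. Qed.

Lemma bump_seq_cvg a b d x : 0 < d -> (forall i, a ord0 i <= b ord0 i) ->
  (fun k => bump_seq a b d k x) @ \oo --> (\1_(box (Some (a, b))) x : R).
Proof.
move=> d0 ab.
have -> : \1_(box (Some (a, b))) x = \prod_(i < n) (a ord0 i < x ord0 i <= b ord0 i)%R%:R :> R.
  rewrite indicE; case: (boolP (x \in _)) => [/set_mem h|xN].
    by rewrite big1// => i _; rewrite h.
  have [i /negbTE ni] : exists i, ~~ (a ord0 i < x ord0 i <= b ord0 i).
    apply/existsP; rewrite -negb_forall; apply: contra xN => /forallP h.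
    by rewrite inE => i; exact: h.
  by rewrite (bigD1 i)//= ni mul0r.
rewrite /bump_seq /bump_fun.
elim: (index_enum _) => [|i s IH].
  under eq_fun do rewrite big_nil; rewrite big_nil; exact: cvg_cst.
under eq_fun do rewrite big_cons; rewrite big_cons; apply: cvgM => //.
under eq_fun do rewrite !mxE.
set t := x _ _; set u := a _ _; set v := b _ _.
have uv : u <= v := ab i.
have [tu|ut] := leP t u.
  rewrite /=.
  apply: cvg_near_cst; apply: nearW => k.
  rewrite /flat ltNge -mulrA pmulr_rle0 ?exprn_gt0//.
  by rewrite mulr_le0_ge0 ?subr_le0// subr_ge0 (le_trans tu)// (le_trans uv)// lerDl divr_ge0// ltW.
have [tv|vt] := leP t v; rewrite /=.
  apply: flat0_cvg1; apply/cvgryPge => A.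
  have tud : 0 < (t - u) * d by rewrite mulr_gt0// subr_gt0.
  have := @nbhs_infty_ger R (A / ((t - u) * d)); apply: filterS => k.
  rewrite ler_pdivrMr// => /le_trans; apply.
  have k0 : 0 < k.+1%:R :> R by [].
  apply: (@le_trans _ _ (k.+1%:R * ((t - u) * d))).
    by rewrite ler_wpM2r ?(ltW tud)// ler_nat.
  have -> : k.+1%:R * ((t - u) * d) = k.+1%:R ^+ 2 * (t - u) * (d / k.+1%:R).
    by field; rewrite gt_eqF.
  rewrite ler_wpM2l ?mulr_ge0 ?exprn_ge0 ?subr_ge0 ?(ltW ut)//.
  by rewrite addrAC lerDr subr_ge0.
apply: cvg_near_cst.
have dk : d / k.+1%:R @[k --> \oo] --> 0.
  rewrite -[X in _ --> X](mulr0 d); apply: cvgM; first exact: cvg_cst.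
  exact: cvg_harmonic.
have vt0 : 0 < t - v by rewrite subr_gt0.
have /cvgrPdist_lt/(_ _ vt0) := dk; apply: filterS => k.
rewrite sub0r normrN gtr0_norm ?divr_gt0// => dkt.
rewrite /flat ltNge -mulrA pmulr_rle0 ?exprn_gt0//.
rewrite mulr_ge0_le0// ?subr_ge0 ?(ltW ut)// subr_le0 addrC -lerBrDr; exact: ltW.
Unshelve. all: by end_near. Qed.
End box_bump.

(** * The lemma of du Bois-Reymond *)

Section L1loc.
Context (R : realType) (n : nat) (Omega : set 'rV[R]_n).
Hypothesis Omega_open : open Omega.
Local Notation mu := (leb R n).

Lemma ae_leb_imp (P Q : 'rV[R]_n -> Prop) : (forall x, P x -> Q x) ->
  {ae mu, forall x, P x} -> {ae mu, forall x, Q x}.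
Proof. by move=> PQ; apply: (@filterS _ _ (ae_filter_ringOfSetsType mu)). Qed.

Lemma ae_leb_imp2 (P P' Q : 'rV[R]_n -> Prop) : (forall x, P x -> P' x -> Q x) ->
  {ae mu, forall x, P x} -> {ae mu, forall x, P' x} -> {ae mu, forall x, Q x}.
Proof. by move=> PQ; apply: (@filterS2 _ _ (ae_filter_ringOfSetsType mu)). Qed.

Lemma continuous_measurable_leb (f : 'rV[R]_n -> R) : continuous f ->
  measurable_fun (setT : set (rVleb R n)) f.
Proof.
move=> /continuousP cf; apply: (measurability _ (RGenOpens.measurableE R)).
move=> _ [_ [a [b ->] <-]]; rewrite setTI; apply: open_measurable_leb.
exact/cf/interval_open.
Qed.

Lemma box_setI (o1 o2 : option ('rV[R]_n * 'rV[R]_n)) :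
  exists o3, box o3 = box o1 `&` box o2.
Proof.
case: o1 => [[a b]|]; last by exists None; rewrite set0I.
case: o2 => [[a' b']|]; last by exists None; rewrite setI0.
exists (Some (\row_i Num.max (a ord0 i) (a' ord0 i), \row_i Num.min (b ord0 i) (b' ord0 i))).
apply/seteqP; split => [x h|x [h1 h2] i].
  by split => i; have := h i; rewrite !mxE gt_max le_min;
    move=> /andP[/andP[g1 g2] /andP[g3 g4]]; rewrite ?g1 ?g2 ?g3 ?g4.
by rewrite !mxE gt_max le_min; have /andP[-> ->] := h1 i; have /andP[-> ->] := h2 i.
Qed.

Lemma closed_measurable_leb (C : set 'rV[R]_n) : closed C ->
  measurable (C : set (rVleb R n)).
Proof.
move=> cC; rewrite -[C]setCK; apply: measurableC; apply: open_measurable_leb.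
exact: closed_openC.
Qed.

Lemma compact_measurable_leb (C : set 'rV[R]_n) : compact C ->
  measurable (C : set (rVleb R n)).
Proof.
move=> cC; apply: closed_measurable_leb; apply: compact_closed => //.
Qed.

Lemma integrable_L1loc_mul (w h : 'rV[R]_n -> R) (C : set 'rV[R]_n) (M : R) :
  in_L1loc Omega w -> measurable_fun (Omega : set (rVleb R n)) h ->
  compact C -> C `<=` Omega -> (forall x, Omega x -> ~ C x -> h x = 0) ->
  (forall x, C x -> `|h x| <= M) ->
  mu.-integrable Omega (EFin \o (fun x => w x * h x) : rVleb R n -> \bar R).
Proof.
move=> [mw iw] mh cC CO h0 hM.
have mO := open_measurable_leb Omega_open.
have mC := compact_measurable_leb cC.
have iwC := iw C cC CO.
have : mu.-integrable Omega ((EFin \o (fun x => M * `|w x|) : rVleb R n -> \bar R) \_ C).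
  apply/integrable_restrict => //; rewrite setIidr//.
  apply: integrable_finZ => //.
  have := @integrable_norm _ (rVleb R n) R mu C w iwC.
  exact.
apply: le_integrable => //.
  by apply/measurable_EFinP; apply: measurable_funM.
move=> x Ox; rewrite patchE; case: ifPn => [/set_mem xC|xC].
  rewrite /= lee_fin normrM mulrC.
  have M0 : 0 <= M := le_trans (normr_ge0 _) (hM _ xC).
  by rewrite [leRHS]ger0_norm ?mulr_ge0// ler_wpM2r// hM.
rewrite /= h0// ?mulr0 ?normr0//.
by move: xC; rewrite notin_setE.
Qed.

Definition closed_box (a b : 'rV[R]_n) : set 'rV[R]_n :=
  [set x | forall i, a ord0 i <= x ord0 i <= b ord0 i].

Lemma closed_box_compact a b : compact (closed_box a b).
Proof.
rewrite (_ : closed_box a b = [set x | forall i, `[a ord0 i, b ord0 i]%classic (x ord0 i)]).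
  by apply: (@rV_compact _ _ (fun i => `[a ord0 i, b ord0 i]%classic)) => i; exact: segment_compact.
by apply/seteqP; split => x h i /=; have := h i; rewrite /= in_itv.
Qed.

Lemma integrable_bump (w : 'rV[R]_n -> R) (a b : 'rV[R]_n) (r : R) : in_L1loc Omega w ->
  (forall i, a ord0 i <= b ord0 i) -> 0 < r -> closed_box a b `<=` Omega ->
  mu.-integrable Omega (EFin \o (fun x => w x * bump_fun a b r x) : rVleb R n -> \bar R).
Proof.
move=> Lw ab r0 abO.
apply: (@integrable_L1loc_mul _ _ (closed_box a b) 1) => //.
- apply: measurable_funTS; apply: continuous_measurable_leb.
  exact: continuous_bump_fun.
- exact: closed_box_compact.
- move=> x Ox xC; apply: contrapT => /eqP h; apply: xC; exact: bump_fun_neq0 h.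
- by move=> x _; rewrite ger0_norm ?bump_fun_ge0 ?bump_fun_le1.
Qed.

Variable w : 'rV[R]_n -> R.
Hypothesis Lw : in_L1loc Omega w.
Hypothesis w0 : forall (a b : 'rV[R]_n) (r : R), (forall i, a ord0 i <= b ord0 i) -> 0 < r ->
  closed_box a b `<=` Omega ->
  \int[mu]_(x in Omega) (w x * bump_fun a b r x) = 0.

(** Dominated convergence along [bump_seq]; the margin d contains the supports. *)
Lemma Rintegral_box_eq0 (a b : 'rV[R]_n) (d : R) :
  (forall i, a ord0 i <= b ord0 i) -> 0 < d ->
  closed_box a (b + const_mx d) `<=` Omega ->
  \int[mu]_(x in box (Some (a, b))) w x = 0.
Proof.
move=> ab d0 abO; have mO := open_measurable_leb Omega_open.
have mB := @box_measurable R n (Some (a, b)).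
have BC : box (Some (a, b)) `<=` closed_box a (b + const_mx d).
  move=> x h i; have /andP[h1 h2] := h i; rewrite !mxE (ltW h1)/=.
  by rewrite (le_trans h2)// lerDl ltW.
have BO : box (Some (a, b)) `<=` Omega := subset_trans BC abO.
have dk k : d / k.+1%:R <= d :> R by rewrite ler_pdivrMr// ler_peMr ?(ltW d0)// ler1n.
have abk k : closed_box a (b + const_mx (d / k.+1%:R)) `<=` closed_box a (b + const_mx d).
  move=> x h i; have := h i; rewrite !mxE => /andP[-> h2] /=.
  by rewrite (le_trans h2)// lerD2l.
have abk' k i : a ord0 i <= (b + const_mx (d / k.+1%:R)) ord0 i.
  by rewrite !mxE (le_trans (ab i))// lerDl divr_ge0// ltW.
have k20 k : 0 < k.+1%:R ^+ 2 :> R by rewrite exprn_gt0.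
have iC : mu.-integrable (closed_box a (b + const_mx d)) (EFin \o w : rVleb R n -> \bar R).
  by apply: Lw.2 => //; exact: closed_box_compact.
have mC := compact_measurable_leb (@closed_box_compact a (b + const_mx d)).
have lim : (\int[mu]_(x in Omega) (w x * bump_seq a b d k x)%:E @[k --> \oo] -->
    \int[mu]_(x in Omega) (w x * \1_(box (Some (a, b))) x)%:E)%E.
  apply: (@dominated_cvg _ (rVleb R n) _ mu _ mO _ _
    ((EFin \o (fun x => `|w x|) : rVleb R n -> \bar R) \_ (closed_box a (b + const_mx d)))).
  - move=> k; have := integrable_bump Lw (abk' k) (k20 k) (subset_trans (abk k) abO).
    exact: measurable_int.
  - move=> x Ox; apply: cvg_EFin; first exact: nearW.
    by apply: cvgM; [exact: cvg_cst|exact: bump_seq_cvg].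
  - by move=> x Ox; rewrite patchE; case: ifP.
  - apply/integrable_restrict => //; rewrite setIidr//.
    have := @integrable_norm _ (rVleb R n) R mu _ w iC.
    exact.
  - move=> k x Ox; rewrite patchE; case: ifPn => [_|xC].
      rewrite /= lee_fin normrM ler_piMr// ger0_norm ?bump_fun_ge0//.
      exact: bump_fun_le1.
    rewrite /bump_seq; have [->|h] := eqVneq (bump_fun a (b + const_mx (d / k.+1%:R)) (k.+1%:R ^+ 2) x) 0.
      by rewrite /= mulr0 normr0.
    exfalso; move: xC; rewrite notin_setE; apply; apply: (abk k).
    exact: bump_fun_neq0 h.
have : (\int[mu]_(x in Omega) (w x * \1_(box (Some (a, b))) x)%:E)%E = 0%E.
  apply/esym; move/cvg_lim : lim => <- //; apply/esym/cvg_lim => //.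
  rewrite (_ : (fun k => _) = cst 0%E); first exact: cvg_cst.
  apply/funext => k.
  have := w0 (abk' k) (k20 k) (subset_trans (abk k) abO).
  rewrite /Rintegral => h; rewrite /cst -[X in _ = X]/((0:R)%:E) -h fineK//.
  apply: integrable_fin_num => //.
  exact: (integrable_bump Lw (abk' k) (k20 k) (subset_trans (abk k) abO)).
rewrite /Rintegral => h; rewrite -[RHS]/(fine 0%E) -h; congr fine.
rewrite -(setIidr BO) integral_mkcondr setIidr//; apply: eq_integral => x _.
rewrite patchE indicE; case: ifP => _; first by rewrite mulr1.
by rewrite mulr0.
Qed.

(** Boxes are stable under intersection, so inclusion-exclusion gives integral 0
    over finite unions of boxes. These approximate any measurable subset of the
    box, and absolute continuity of the integral of w concludes. *)
Lemma ae_eq0_box (a b : 'rV[R]_n) (d : R) :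
  (forall i, a ord0 i <= b ord0 i) -> 0 < d ->
  closed_box a (b + const_mx d) `<=` Omega ->
  {ae mu, forall x, box (Some (a, b)) x -> w x = 0}.
Proof.
move=> ab d0 abO; pose B := box (Some (a, b)).
have mB : measurable (B : set (rVleb R n)) := box_measurable (Some (a, b)).
have BC : B `<=` closed_box a (b + const_mx d).
  move=> x h i; have /andP[h1 h2] := h i; rewrite !mxE (ltW h1)/=.
  by rewrite (le_trans h2)// lerDl ltW.
have iB : mu.-integrable B (EFin \o w : rVleb R n -> \bar R).
  apply: integrableS (Lw.2 (closed_box a (b + const_mx d)) _ abO) => //.
    by apply: compact_measurable_leb; exact: closed_box_compact.
  exact: closed_box_compact.
have box0 ab' : \int[mu]_(x in B `&` box ab') w x = 0.
  case: ab' => [[a' b']|]; last by rewrite setI0 Rintegral_set0.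
  pose a2 : 'rV[R]_n := \row_i Num.max (a ord0 i) (a' ord0 i).
  pose b2 : 'rV[R]_n := \row_i Num.min (b ord0 i) (b' ord0 i).
  have -> : B `&` box (Some (a', b')) = box (Some (a2, b2)).
    apply/seteqP; split => [x [h1 h2] i|x h].
      by rewrite !mxE gt_max le_min; have /andP[-> ->] := h1 i; have /andP[-> ->] := h2 i.
    by split => i; have := h i; rewrite !mxE gt_max le_min;
      move=> /andP[/andP[g1 g2] /andP[g3 g4]]; rewrite ?g1 ?g2 ?g3 ?g4.
  have [h|/existsNP[i hi]] := pselect (forall i, a2 ord0 i <= b2 ord0 i); last first.
    rewrite (_ : box _ = set0) ?Rintegral_set0// -subset0 => x /(_ i).
    by move=> /andP[/lt_le_trans/[apply]/ltW].
  apply: (@Rintegral_box_eq0 a2 b2 d) => //; apply: subset_trans abO => x hx i.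
  have := hx i; rewrite !mxE ge_max => /andP[/andP[-> _] h2] /=.
  by rewrite (le_trans h2)// lerD2r ge_min lexx.
have boxes0 (s : seq (option ('rV[rat]_n * 'rV[rat]_n))) :
    forall ab', \int[mu]_(x in B `&` box ab' `&`
      \big[setU/set0]_(o <- s) box (rat_box R o)) w x = 0.
  elim: s => [|c s IH] ab'; first by rewrite big_nil setI0 Rintegral_set0.
  rewrite big_cons; set S := \big[setU/set0]_(_ <- _) _.
  have mS : measurable (S : set (rVleb R n)).
    by apply: bigsetU_measurable => k _; exact: box_measurable.
  have mX : measurable (B `&` box ab' : set (rVleb R n)).
    by apply: measurableI => //; exact: box_measurable.
  have mc : measurable (box (rat_box R c) : set (rVleb R n)) by exact: box_measurable.
  have iX Y : measurable (Y : set (rVleb R n)) -> Y `<=` B ->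
      mu.-integrable Y (EFin \o w : rVleb R n -> \bar R).
    by move=> mY YB; exact: integrableS iB.
  have XB Y : B `&` box ab' `&` Y `<=` B by move=> x [[]].
  have [c' c'E] := box_setI ab' (rat_box R c).
  have mXc : measurable (B `&` box ab' `&` (box (rat_box R c) `|` S) : set (rVleb R n)).
    by apply: measurableI => //; exact: measurableU.
  have mXS : measurable (B `&` box ab' `&` S : set (rVleb R n)) by exact: measurableI.
  rewrite (Rintegral_setD mXc mc); last exact: iX.
  have -> : B `&` box ab' `&` (box (rat_box R c) `|` S) `&` box (rat_box R c) =
      B `&` box c'.
    by rewrite c'E; apply/seteqP; split => x /=; tauto.
  rewrite box0 add0r.
  have -> : B `&` box ab' `&` (box (rat_box R c) `|` S) `\` box (rat_box R c) =
      (B `&` box ab' `&` S) `\` box (rat_box R c).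
    by apply/seteqP; split => x [[? h] nc]; split => //; split => //; [case: h|right].
  have := Rintegral_setD mXS mc (iX _ mXS (@XB _)); rewrite IH.
  have -> : B `&` box ab' `&` S `&` box (rat_box R c) = B `&` box c' `&` S.
    by rewrite c'E; apply/seteqP; split => x /=; tauto.
  by rewrite IH add0r => <-.
have mBE E : measurable (E : set (rVleb R n)) -> E `<=` B -> \int[mu]_(x in E) w x = 0.
  move=> mE EB; apply/eqP; rewrite -normr_eq0; apply/eqP/le_anti.
  rewrite normr_ge0 andbT; apply/ler_addgt0Pl => e e0; rewrite addr0.
  have [r r0 rP] := integrable_abs_continuous mB iB e0.
  have Eoo : (mu E < +oo)%E.
    apply: (@le_lt_trans _ _ (mu B)).
      by apply: le_measure; rewrite ?inE.
    by apply: (le_lt_trans (leb_box_le _)); rewrite ltry.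
  have [k kr] := rat_boxes_dense mE Eoo r0.
  have mk := @rat_boxes_measurable R n k.
  have Bk0 : \int[mu]_(x in B `&` rat_boxes k) w x = 0.
    rewrite /rat_boxes; case: unpickle => [s|]; last by rewrite setI0 Rintegral_set0.
    by have := boxes0 s (Some (a, b)); rewrite setIid.
  have := dist_Rintegral_le mB iB mE EB mk; rewrite Bk0 subr0 => /le_trans; apply.
  apply/ltW/rP; first (by apply: measurableI => //; apply: measurableU; exact: measurableD); first exact: subIsetl.
  apply: le_lt_trans kr; apply: le_measure; rewrite ?inE//.
    by apply: measurableI => //; apply: measurableU; exact: measurableD.
  by apply: measurableU; exact: measurableD.
have : ae_eq mu B (EFin \o w) (cst 0%E).
  apply: (@integral_ae_eq _ (rVleb R n)) => //.
  move=> E EB mE; rewrite integral0.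
  have := mBE _ mE EB; rewrite /Rintegral => h; rewrite -[RHS]/((0:R)%:E) -h fineK//.
  by apply: integrable_fin_num => //; exact: integrableS iB.
by apply: filterS => x h /h [].
Qed.

(** Omega is covered by the countably many boxes with rational corners that stay
    inside it together with a rational margin. *)
Lemma ae_eq0_of_bump : {ae mu, forall x, Omega x -> w x = 0}.
Proof.
have aux (X Y A B L E : R) : 0 < E -> B < X + E / 2 -> X - E / 2 < A ->
    A <= Y -> Y <= B + L -> L < E / 2 -> - E < X - Y < E.
  by move=> *; apply/andP; split; lra.
pose P (ob : option ('rV[rat]_n * 'rV[rat]_n) * nat) := if ob.1 is Some (a, b) then
  (forall i, (map_mx ratr a : 'rV[R]_n) ord0 i <= (map_mx ratr b : 'rV[R]_n) ord0 i) /\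
  closed_box (map_mx ratr a) (map_mx ratr b + const_mx ob.2.+1%:R^-1) `<=` Omega
  else False.
have : {ae mu, forall x, forall k ob, unpickle k = Some ob -> P ob -> box (rat_box R ob.1) x -> w x = 0}.
  apply: ae_foralln => k; case: (unpickle k) => [ob|]; last by apply: aeW.
  have [Pob|nP] := pselect (P ob); last by apply: aeW => x c [<-].
  case: ob Pob => -[[a b]|]//= l [ab abO].
  have l0 : 0 < l.+1%:R^-1 :> R by rewrite invr_gt0.
  suff h0 : {ae mu, forall x, box (rat_box R (Some (a, b))) x -> w x = 0}.
    have h1 : {ae mu, forall x, forall ob, Some (Some (a, b), l) = Some ob -> P ob ->
        box (rat_box R ob.1) x -> w x = 0}.
      by apply: ae_leb_imp h0 => x h c [<-] _ /h.
    exact: h1.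
  exact: ae_eq0_box ab l0 abO.
apply: ae_leb_imp => x h Ox.
have /nbhs_ballP[e /= e0 eO] := open_nbhs_nbhs (conj Omega_open Ox).
have e20 : 0 < e / 2 by rewrite divr_gt0.
have [|a aP] := @rat_row_between R n (x - const_mx (e / 2)) x.
  by move=> i; rewrite !mxE ltrBlDr ltrDl.
have [|b bP] := @rat_row_between R n x (x + const_mx (e / 2)).
  by move=> i; rewrite !mxE ltrDl.
have [l _ /(_ l (leqnn l))/= le] := near_infty_natSinv_lt (PosNum e20).
apply: (h (pickle (Some (a, b), l)) (Some (a, b), l)); first exact: pickleK.
  rewrite /P /=; split => [i|y hy].
    by rewrite !mxE; have /andP[_ /ltW h1] := aP i; have /andP[/ltW h2 _] := bP i; exact: le_trans h2.
  apply: eO; split => // i j; rewrite (ord1 i : i = ord0); have := hy j; have := aP j; have := bP j.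
  rewrite !mxE /ball/= ltr_norml => /andP[h1 h2] /andP[h3 h4] /andP[h5 h6].
  exact: (aux _ _ _ _ _ _ e0 h2 h3 h5 h6 le).
by move=> i; rewrite !mxE; have /andP[_ ->] := aP i; have /andP[/ltW -> _] := bP i.
Qed.

End L1loc.

(** * Divergence of a test field times Lipschitz coefficients *)

Section measurable_derive.
Context (R : realType) (n : nat).
Local Notation mu := (leb R n).
Variable psi : 'rV[R]_n -> R.
Hypothesis psi_cont : continuous psi.
Variable v : 'rV[R]_n.

Definition quotient (h : R) (x : 'rV[R]_n) : R := h^-1 * (psi (h *: v + x) - psi x).

Lemma continuous_quotient h : continuous (quotient h).
Proof.
have -> : quotient h = cst h^-1 \* ((psi \o (fun x => h *: v + x)) \- psi) by [].
move=> x; apply: continuousM; first exact: cst_continuous.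
apply: continuousB; last exact: psi_cont.
apply: continuous_comp; last exact: psi_cont.
by apply: continuousD; [exact: cst_continuous|exact: cvg_id].
Qed.

Definition near_cauchy (k j : nat) : set 'rV[R]_n :=
  \bigcap_(hh in [set hh : R * R | [/\ hh.1 != 0, hh.2 != 0,
     `|hh.1| < j.+1%:R^-1 & `|hh.2| < j.+1%:R^-1]])
  [set x | `|quotient hh.1 x - quotient hh.2 x| <= k.+1%:R^-1].

Lemma closed_near_cauchy k j : closed (near_cauchy k j).
Proof.
apply: closed_bigI => -[h h'] _ /=.
rewrite (_ : [set x | _] = (fun x => `|quotient h x - quotient h' x|) @^-1` [set y | y <= k.+1%:R^-1]).
  apply: preimage_closed; last exact: closed_le.
  move=> x _; apply: (@continuous_comp _ _ _ (quotient h \- quotient h') (fun y : R => `|y|)).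
    by apply: continuousB; exact: continuous_quotient.
  exact: norm_continuous.
by [].
Qed.

(** Cauchy's criterion writes the derivability at x through countably many
    conditions, each of them closed since the quotients are continuous. *)
Lemma derivable_set : [set x | derivable psi x v] = \bigcap_k \bigcup_j near_cauchy k j.
Proof.
apply/seteqP; split => x /=.
  move=> /cvg_ex[/= l /cvgrPdist_lt xl] k _.
  have k0 : 0 < k.+1%:R^-1 / 2 :> R by rewrite divr_gt0.
  have := xl _ k0; rewrite /dnbhs/= -nbhs_nearE => /nbhs_ballP[d /= d0 dl].
  have [j _ /(_ j (leqnn j))/= jd] := near_infty_natSinv_lt (PosNum d0).
  exists j => // -[h h'] /= [h0 h'0 hj h'j].
  have dq g : g != 0 -> `|g| < j.+1%:R^-1 -> `|l - quotient g x| < k.+1%:R^-1 / 2.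
    move=> g0 gj; apply: dl => //.
    by rewrite /ball/= sub0r normrN (lt_trans gj).
  rewrite (le_trans (ler_distD l _ _))// [leRHS]splitr lerD// ltW//; last exact: dq.
  by rewrite distrC dq.
move=> H; apply/cauchy_cvgP; apply: cauchy_exP => e e0.
have [k _ /(_ k (leqnn k))/= ke] := near_infty_natSinv_lt (PosNum e0).
have [j _ xj] := H k I.
have j0 : 0 < j.+1%:R^-1 / 2 :> R by rewrite divr_gt0.
exists (quotient (j.+1%:R^-1 / 2) x).
have jj : 0 < j.+1%:R^-1 :> R by rewrite invr_gt0.
rewrite /= nbhs_simpl; near=> h.
apply: le_lt_trans ke; apply: (xj (j.+1%:R^-1 / 2, h)); split => /=.
- by rewrite gt_eqF.
- by near: h; exact: nbhs_dnbhs_neq.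
- by rewrite gtr0_norm// ltr_pdivrMr// mulr_natr mulr2n ltrDl.
- by near: h; exact: dnbhs0_lt.
Unshelve. all: by end_near. Qed.

Lemma measurable_derivable :
  measurable ([set x | derivable psi x v] : set (rVleb R n)).
Proof.
rewrite derivable_set; apply: bigcapT_measurable => k.
by apply: bigcupT_measurable => j; apply: closed_measurable_leb; exact: closed_near_cauchy.
Qed.

Lemma measurable_derive :
  measurable_fun (setT : set (rVleb R n)) (fun x => 'D_v psi x).
Proof.
pose D : set 'rV[R]_n := [set x | derivable psi x v].
apply: (@measurable_fun_cvg _ (rVleb R n) _ _ (fun N x => if x \in D then
   quotient N.+1%:R^-1 x else point)).
  move=> N; apply: measurable_fun_ifT; last exact: measurable_cst.
  - apply: (measurable_fun_bool true); rewrite setTI.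
    rewrite (_ : _ @^-1` _ = D); first exact: measurable_derivable.
    by apply/seteqP; split => y /=; [move/set_mem|move=> /mem_set].
  - by apply: continuous_measurable_leb; exact: continuous_quotient.
move=> x _; have [xD|xD] := boolP (x \in D).
  have h0 : (fun N : nat => N.+1%:R^-1 : R) @ \oo --> 0^'.
    move=> A /nbhs_ballP[d /= d0 dA].
    have := near_infty_natSinv_lt (PosNum d0); apply: filterS => N /= Nd.
    by apply: dA; rewrite ?gt_eqF// /ball/= sub0r normrN gtr0_norm.
  by move/set_mem : xD => xD; exact: (cvg_comp _ _ h0 xD).
move: xD; rewrite notin_setE => /dvgP xD; rewrite /derive xD; exact: cvg_cst.
Qed.

End measurable_derive.

Section divergence_field.
Context (R : realType) (m n : nat) (Omega : set 'rV[R]_n).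
Hypothesis Omega_open : open Omega.
Hypothesis Omega_bounded : bounded_set Omega.
Variable C : 'rV[R]_n -> 'M[R]_(m, n).
Hypothesis C_lip : forall j i, [lipschitz C x j i | x in Omega].
Variable phi : 'rV[R]_n -> 'rV[R]_m.
Hypothesis phi_test : test_fun Omega phi.
Local Notation mu := (leb R n).

Let K := closure [set x | phi x != 0].
Let psi i (x : 'rV[R]_n) : R := (phi x *m C x) ord0 i.

Let phi0 x : ~ K x -> phi x = 0.
Proof.
move=> nK; apply: contrapT => /eqP h; apply: nK; exact: subset_closure.
Qed.

Let near_phi0 x : ~ K x -> \forall y \near x, phi y = 0.
Proof.
move=> nK; have oK : open (~` K) by exact/closed_openC/closed_closure.
have := open_nbhs_nbhs (conj oK nK); apply: filterS => y; exact: phi0.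
Qed.

Lemma lipschitz_bound : exists2 L : R, 0 <= L & forall j i x y, Omega x -> Omega y ->
  `|C x j i - C y j i| <= L * `|x - y|.
Proof.
have /choice[L LP] : forall ji : 'I_m * 'I_n, exists L : R, forall x y, Omega x -> Omega y ->
    `|C x ji.1 ji.2 - C y ji.1 ji.2| <= L * `|x - y|.
  move=> [j i]; have [M [_ /(_ (M + 1))]] := C_lip j i.
  by rewrite ltrDl => /(_ ltr01) h; exists (M + 1) => x y Ox Oy; exact: (h (x, y)).
exists (\sum_ji `|L ji|); first exact: sumr_ge0.
move=> j i x y Ox Oy; apply: (le_trans (LP (j, i) x y Ox Oy)).
rewrite ler_wpM2r// (bigD1 (j, i))//= (le_trans (ler_norm _))// lerDl.
exact: sumr_ge0.
Qed.

Lemma coef_bound : exists2 M : R, 0 <= M & forall j i x, Omega x -> `|C x j i| <= M.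
Proof.
have [L L0 LP] := lipschitz_bound.
have [[x0 Ox0]|nO] := pselect (exists x, Omega x); last first.
  by exists 0 => // j i x Ox; exfalso; apply: nO; exists x.
have [B [_ /(_ (`|B| + 1))]] := Omega_bounded.
rewrite (le_lt_trans (ler_norm _)) ?ltrDl// => /(_ isT) OB.
exists (\sum_ji `|C x0 ji.1 ji.2| + L * (2 * (`|B| + 1))).
  by rewrite addr_ge0 ?sumr_ge0// !mulr_ge0// addr_ge0.
move=> j i x Ox; rewrite -[C x j i](subrK (C x0 j i)) addrC.
rewrite (le_trans (ler_normD _ _))// lerD//.
  by rewrite (bigD1 (j, i))//= lerDl sumr_ge0.
apply: (le_trans (LP j i x x0 Ox Ox0)); rewrite ler_wpM2l//.
by rewrite (le_trans (ler_normB _ _))// mulr_natl mulr2n lerD// OB.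
Qed.

Lemma continuous_coef j i x : Omega x -> {for x, continuous (fun y : ('rV[R]_n : normedModType R) => C y j i)}.
Proof.
move=> Ox; have [L L0 LP] := lipschitz_bound.
apply/(@cvgrPdist_le _ _ _ (nbhs x) (nbhs_filter x)) => e e0.
have eL : 0 < e / (L + 1) by rewrite divr_gt0// ltr_wpDl.
have h1 := open_nbhs_nbhs (conj Omega_open Ox).
have h2 : \forall y \near x, `|x - y| < e / (L + 1).
  by have /cvgrPdist_lt/(_ _ eL) := @cvg_id _ (nbhs x).
move: h1 h2; apply: filterS2 => y Oy xy.
apply: (le_trans (LP j i x y Ox Oy)).
apply: (@le_trans _ _ (L * (e / (L + 1)))); first by rewrite ler_wpM2l// ltW.
by rewrite mulrCA ler_piMr ?(ltW e0)// ler_pdivrMr ?ltr_wpDl// mul1r lerDl.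
Qed.

Lemma continuous_phi j : continuous (fun x => phi x ord0 j).
Proof.
have [sm _ _] := phi_test; have [c _] := sm [::].
by move=> x; apply: (@continuous_comp _ _ _ phi (fun z : 'rV[R]_m => z ord0 j)); [exact: c|exact: coord_continuous].
Qed.

Lemma psiE i x : psi i x = \sum_j phi x ord0 j * C x j i.
Proof. by rewrite /psi mxE. Qed.

Lemma continuous_psi i : continuous (psi i).
Proof.
move=> x; have [Ox|nO] := pselect (Omega x); last first.
  have nK : ~ K x by move=> /(let: And3 _ _ h := phi_test in h x).
  have h := near_phi0 nK.
  have E y : phi y = 0 -> psi i y = 0 by move=> py; rewrite /psi py mul0mx mxE.
  rewrite /continuous_at E ?phi0//.
  apply: (@cvg_near_cst _ _ _ _ (nbhs x) (nbhs_filter x)).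
  by apply: (@filterS _ (nbhs x) (nbhs_filter x) _ _ _ h) => y; exact: E.
have -> : psi i = fun x => \sum_j phi x ord0 j * C x j i by apply/funext => y; exact: psiE.
have S (s : seq 'I_m) :
    {for x, continuous (fun y : 'rV[R]_n => \sum_(j <- s) phi y ord0 j * C y j i)}.
  elim: s => [|j s IH].
    rewrite (_ : (fun _ => _) = cst 0); first exact: cst_continuous.
    by apply/funext => y; rewrite big_nil.
  rewrite (_ : (fun _ => _) = ((fun y : 'rV[R]_n => phi y ord0 j) \* (fun y => C y j i)) \+
     (fun y => \sum_(j <- s) phi y ord0 j * C y j i)); last first.
    by apply/funext => y; rewrite big_cons.
  apply: continuousD => //; apply: continuousM; first exact: continuous_phi.
  exact: continuous_coef.
exact: S.
Qed.

Lemma measurable_divergence :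
  measurable_fun (setT : set (rVleb R n)) (divergence (fun y => phi y *m C y)).
Proof.
apply: measurable_sum => i; apply: measurable_derive; exact: continuous_psi.
Qed.

Lemma divergence_eq0 x : ~ K x -> divergence (fun y => phi y *m C y) x = 0.
Proof.
move=> /near_phi0 h; rewrite /divergence big1// => i _; rewrite /partial.
rewrite (@near_eq_derive _ _ _ _ (cst 0)) ?derive_cst//.
by move: h; apply: filterS => y ->; rewrite mul0mx mxE.
Qed.

Lemma continuous_compact_bound (f : 'rV[R]_n -> R) (A : set 'rV[R]_n) :
  continuous f -> compact A -> exists2 M : R, 0 <= M & forall x, A x -> `|f x| <= M.
Proof.
move=> cf cA.
have : compact (f @` A).
  by apply: continuous_compact => //; exact: continuous_subspaceT.
move=> /compact_bounded[B [_ /(_ (`|B| + 1))]].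
rewrite (le_lt_trans (ler_norm _)) ?ltrDl// => /(_ isT) fB.
exists (`|B| + 1); first by rewrite addr_ge0.
by move=> x Ax; apply: fB; exists x.
Qed.

Lemma cvg_phi_quotient i j x :
  h^-1 * (phi (h *: delta_mx ord0 i + x) ord0 j - phi x ord0 j) @[h --> 0^'] -->
  partial i phi x ord0 j.
Proof.
have [sm _ _] := phi_test; have [_ /(_ i x) /= d] := sm [::].
rewrite (_ : (fun h => _) = (fun z : 'rV[R]_m => z ord0 j) \o
    (fun h => h^-1 *: ((phi \o shift x) (h *: delta_mx ord0 i) - phi x))).
  by apply: continuous_cvg; [exact: coord_continuous|exact: d].
by apply/funext => h /=; rewrite !mxE.
Qed.

(** The product rule applied to difference quotients: those of phi are bounded by
    its smoothness, those of C by its Lipschitz constant, and the limit inherits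
    the bound wherever it exists. *)
Lemma derive_psi_bound : exists2 M : R, 0 <= M &
  forall i x, Omega x -> K x -> `|partial i (psi i) x| <= M.
Proof.
have [L L0 LP] := lipschitz_bound.
have [B B0 BP] := coef_bound.
have [sm cK _] := phi_test.
have /choice[M1 M1P] : forall j, exists M, 0 <= M /\ forall x, K x -> `|phi x ord0 j| <= M.
  move=> j; have [M M0 MP] := continuous_compact_bound (@continuous_phi j) cK.
  by exists M.
have /choice[M2 M2P] : forall ij : 'I_n * 'I_m, exists M, 0 <= M /\
    forall x, K x -> `|partial ij.1 phi x ord0 ij.2| <= M.
  move=> [i j]; have [c _] := sm [:: i].
  have cf : continuous (fun x => partial i phi x ord0 j).
    by move=> x; apply: (@continuous_comp _ _ _ (partial i phi) (fun z : 'rV[R]_m => z ord0 j));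
      [exact: c|exact: coord_continuous].
  have [M M0 MP] := continuous_compact_bound cf cK.
  by exists M.
pose Q := \sum_j (M1 j * L + B * \sum_(i < n) M2 (i, j)).
have Q0 : 0 <= Q.
  apply: sumr_ge0 => j _; rewrite addr_ge0 ?mulr_ge0 ?sumr_ge0//; first exact: (M1P j).1.
  by move=> i _; exact: (M2P (i, j)).1.
(* [point] is the value of the derivative where the limit does not exist *)
exists (Q + `|point : R|); first by rewrite addr_ge0.
move=> i x Ox Kx.
have [d|nd] := pselect (derivable (psi i) x (delta_mx ord0 i)); last first.
  by rewrite /partial /derive (dvgP nd) lerDr.
apply: (@le_trans _ _ Q); last by rewrite lerDl.
have v1 : `|delta_mx ord0 i : 'rV[R]_n| <= 1.
  rewrite [leLHS]mx_normrE; apply/bigmax_leP; split => // -[k l] _ /=.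
  by rewrite mxE; case: (_ && _); rewrite ?normr1 ?normr0.
have Oh : \forall h \near 0^', Omega (h *: delta_mx ord0 i + x).
  have c : h *: delta_mx ord0 i + x @[h --> 0^'] --> x.
    suff : h *: delta_mx ord0 i + x @[h --> 0^'] --> 0 *: delta_mx ord0 i + x.
      by rewrite scale0r add0r.
    apply: cvgD; last exact: cvg_cst.
    by apply: cvgZr_tmp; apply: cvg_within.
  exact: (c _ (open_nbhs_nbhs (conj Omega_open Ox))).
have quot h : h != 0 -> Omega (h *: delta_mx ord0 i + x) ->
  `|h^-1 * (psi i (h *: delta_mx ord0 i + x) - psi i x)| <=
  \sum_j (M1 j * L + B * `|h^-1 * (phi (h *: delta_mx ord0 i + x) ord0 j - phi x ord0 j)|).
  move=> h0 Oh'; rewrite !psiE -sumrB mulr_sumr (le_trans (ler_norm_sum _ _ _))//.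
  apply: ler_sum => j _; set y := _ + x.
  have -> : h^-1 * (phi y ord0 j * C y j i - phi x ord0 j * C x j i) =
    phi x ord0 j * (h^-1 * (C y j i - C x j i)) + C y j i * (h^-1 * (phi y ord0 j - phi x ord0 j)) by ring.
  rewrite (le_trans (ler_normD _ _))// !normrM lerD//.
    apply: ler_pM => //; first exact: (M1P j).2.
    rewrite normfV ler_pdivrMl ?normr_gt0// mulrC (le_trans (LP j i y x Oh' Ox))//.
    by rewrite /y addrK normrZ ler_wpM2l// ler_piMr.
  by rewrite -normrM ler_wpM2r// BP.
have lim1 : (`|h^-1 * (psi i (h *: delta_mx ord0 i + x) - psi i x)| @[h --> 0^'] -->
    `|partial i (psi i) x|) by apply: cvg_norm; exact: d.
have lim2 : (\sum_j (M1 j * L + B * `|h^-1 * (phi (h *: delta_mx ord0 i + x) ord0 j - phi x ord0 j)|)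
   @[h --> 0^'] --> \sum_j (M1 j * L + B * `|partial i phi x ord0 j|)).
  elim: (index_enum _) => [|j s IH].
    by under eq_fun do rewrite big_nil; rewrite big_nil; exact: cvg_cst.
  under eq_fun do rewrite big_cons; rewrite big_cons; apply: cvgD => //.
  apply: cvgD; first exact: cvg_cst.
  apply: cvgM; first exact: cvg_cst.
  by apply: cvg_norm; exact: cvg_phi_quotient.
apply: (@le_trans _ _ (\sum_j (M1 j * L + B * `|partial i phi x ord0 j|))).
  apply: (ler_cvg_to lim1 lim2); near=> h; apply: quot; near: h => //.
  exact: nbhs_dnbhs_neq.
apply: ler_sum => j _; rewrite lerD2l ler_wpM2l//.
rewrite (le_trans ((M2P (i, j)).2 _ Kx))// (bigD1 i)//= lerDl sumr_ge0// => k _.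
exact: (M2P (k, j)).1.
Unshelve. all: by end_near. Qed.

Lemma divergence_bound : exists2 M : R, 0 <= M &
  forall x, K x -> `|divergence (fun y => phi y *m C y) x| <= M.
Proof.
have [M M0 MP] := derive_psi_bound.
exists (\sum_(i < n) M); first exact: sumr_ge0.
move=> x Kx; rewrite (le_trans (ler_norm_sum _ _ _))// ler_sum// => i _.
by apply: MP => //; move: Kx; have [_ _ h] := phi_test; exact: h.
Qed.

Lemma integrable_divergence (u : 'rV[R]_n -> R) : in_L1loc Omega u ->
  mu.-integrable Omega (EFin \o (fun x => u x * divergence (fun y => phi y *m C y) x) : rVleb R n -> \bar R).
Proof.
move=> Lu; have [M M0 MP] := divergence_bound; have [_ cK KO] := phi_test.
apply: (@integrable_L1loc_mul _ _ _ Omega_open _ _ K M) => //.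
  by apply: measurable_funTS; exact: measurable_divergence.
by move=> x _; exact: divergence_eq0.
Qed.

Lemma integrable_test (g : 'rV[R]_n -> 'rV[R]_m) j : in_L1loc Omega (fun x => g x ord0 j) ->
  mu.-integrable Omega (EFin \o (fun x => g x ord0 j * phi x ord0 j) : rVleb R n -> \bar R).
Proof.
move=> Lg; have [_ cK KO] := phi_test.
have [M M0 MP] := continuous_compact_bound (@continuous_phi j) cK.
apply: (@integrable_L1loc_mul _ _ _ Omega_open _ _ K M) => //.
  apply: measurable_funTS; exact: (continuous_measurable_leb (@continuous_phi j)).
by move=> x _ nK; rewrite phi0// mxE.
Qed.

End divergence_field.

(** * Uniqueness and linearity of the X-gradient *)

Section Xgradient.
Context (R : realType) (m n : nat) (Omega : set 'rV[R]_n).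
Hypothesis Omega_open : open Omega.
Hypothesis Omega_bounded : bounded_set Omega.
Variable C : 'rV[R]_n -> 'M[R]_(m, n).
Hypothesis C_lip : forall j i, [lipschitz C x j i | x in Omega].
Local Notation mu := (leb R n).

Lemma in_L1locB (u v : 'rV[R]_n -> R) : in_L1loc Omega u -> in_L1loc Omega v ->
  in_L1loc Omega (fun x => u x - v x).
Proof.
move=> [mu_ iu] [mv iv]; split.
  exact: (measurable_funB mu_ mv).
move=> A cA AO; apply: (integrable_finB (compact_measurable_leb cA)); [exact: iu|exact: iv].
Qed.

(** Both sides of the defining identity split into differences because the
    products with the test field and with its divergence are integrable. *)
Lemma is_XgradB u v g g' : is_Xgrad Omega C u g -> is_Xgrad Omega C v g' ->
  is_Xgrad Omega C (u \- v) (fun x => g x - g' x).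
Proof.
move=> [Lu Lg Eu] [Lv Lg' Ev]; have mO := open_measurable_leb Omega_open.
split; first exact: in_L1locB.
  move=> j; rewrite (_ : (fun _ => _) = (fun x => g x ord0 j - g' x ord0 j)).
    exact: in_L1locB.
  by apply/funext => x; rewrite !mxE.
move=> phi tphi.
pose S (g : 'rV[R]_n -> 'rV[R]_m) x := \sum_(j < m) g x ord0 j * phi x ord0 j.
have iS (f : 'rV[R]_n -> 'rV[R]_m) : (forall j, in_L1loc Omega (fun x => f x ord0 j)) ->
    mu.-integrable Omega (EFin \o S f : rVleb R n -> \bar R).
  move=> Lf; rewrite (_ : _ \o _ = (fun x => \sum_(j < m) (f x ord0 j * phi x ord0 j)%:E)%E).
    by apply: integrable_sum => // j _; exact: (integrable_test Omega_open tphi (Lf j)).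
  by apply/funext => x /=; rewrite sumEFin.
have iu := integrable_divergence Omega_open Omega_bounded C_lip tphi Lu.
have iv := integrable_divergence Omega_open Omega_bounded C_lip tphi Lv.
pose dv := divergence (fun y => phi y *m C y).
transitivity (\int[mu]_(x in Omega) (S g x - S g' x)%:E)%E.
  apply: eq_integral => x _; congr EFin; rewrite -sumrB; apply: eq_bigr => j _.
  by rewrite !mxE mulrBl.
rewrite integralB_EFin//; [|exact: iS..].
rewrite Eu// Ev//.
transitivity (- \int[mu]_(x in Omega) (u x * dv x - v x * dv x)%:E)%E; last first.
  by congr (- _)%E; apply: eq_integral => x _; congr EFin; rewrite -mulrBl.
rewrite integralB_EFin// fin_num_oppeB ?oppeK//.
exact: (integrable_fin_num mO iv).
Qed.

(** Test fields of the form bump * e_j isolate the j-th component, to which the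
    lemma of du Bois-Reymond applies. *)
Lemma is_Xgrad_unique u g g' j : is_Xgrad Omega C u g -> is_Xgrad Omega C u g' ->
  {ae mu, forall x, Omega x -> g x ord0 j = g' x ord0 j}.
Proof.
move=> [_ Lg Eu] [_ Lg' Eu']; have mO := open_measurable_leb Omega_open.
have Lgg := in_L1locB (Lg j) (Lg' j).
suff : {ae mu, forall x, Omega x -> g x ord0 j - g' x ord0 j = 0}.
  by apply: ae_leb_imp => x h /h /subr0_eq.
apply: ae_eq0_of_bump => // a b r ab r0 abO.
have ig := integrable_bump Omega_open (Lg j) ab r0 abO.
have ig' := integrable_bump Omega_open (Lg' j) ab r0 abO.
rewrite (_ : Rintegral _ _ _ = \int[mu]_(x in Omega)
  (g x ord0 j * bump_fun a b r x - g' x ord0 j * bump_fun a b r x)); last first.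
  by apply: eq_Rintegral => x _; rewrite mulrBl.
rewrite RintegralB//; apply/eqP; rewrite subr_eq0; apply/eqP; congr fine.
have tb := test_fun_bump (delta_mx ord0 j : 'rV[R]_m) ab r0 abO.
have E (f : 'rV[R]_n -> 'rV[R]_m) x : (\sum_(k < m) f x ord0 k * (bump_fun a b r x *: delta_mx ord0 j : 'rV[R]_m) ord0 k =
   f x ord0 j * bump_fun a b r x :> R).
  rewrite (bigD1 j)//= big1 ?addr0; last first.
    by move=> k kj; rewrite !mxE (negbTE kj) andbF mulr0 mulr0.
  by rewrite !mxE !eqxx mulr1.
have E2 (f : 'rV[R]_n -> 'rV[R]_m) : (\int[mu]_(x in Omega)
    (\sum_(k < m) f x ord0 k * (bump_fun a b r x *: delta_mx ord0 j : 'rV[R]_m) ord0 k)%:E =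
    \int[mu]_(x in Omega) (f x ord0 j * bump_fun a b r x)%:E)%E.
  by apply: eq_integral => x _; congr EFin; exact: E.
apply: etrans (E2 g'); apply: etrans (esym (E2 g)) _.
by apply: etrans (Eu _ tb) _; rewrite -(Eu' _ tb).
Qed.

Lemma XgradP u g : is_Xgrad Omega C u g -> is_Xgrad Omega C u (Xgrad Omega C u).
Proof. by move=> ug; apply: (xgetPex (fun=> 0)); exists g. Qed.

Lemma ae_forall_ord (P : 'I_m -> 'rV[R]_n -> Prop) :
  (forall j, {ae mu, forall x, P j x}) -> {ae mu, forall x, forall j, P j x}.
Proof.
move=> h.
suff H : {ae mu, forall x, forall k, (if insub k is Some j then P j x else True)}.
  by apply: ae_leb_imp H => x H j; have := H (val j); rewrite valK.
by apply: ae_foralln => k; case: insubP => [j _ _|_]; [exact: h|exact: aeW].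
Qed.

Lemma ae_XgradE u g : is_Xgrad Omega C u g ->
  {ae mu, forall x, Omega x -> Xgrad Omega C u x = g x}.
Proof.
move=> ug; have h := ae_forall_ord (fun j => is_Xgrad_unique j (XgradP ug) ug).
by apply: ae_leb_imp h => x h Ox; apply/rowP => j; exact: h.
Qed.

Lemma ae_XgradB u v g g' : is_Xgrad Omega C u g -> is_Xgrad Omega C v g' ->
  {ae mu, forall x, Omega x ->
    Xgrad Omega C (u \- v) x = Xgrad Omega C u x - Xgrad Omega C v x}.
Proof.
move=> ug vg'; exact: ae_XgradE (is_XgradB (XgradP ug) (XgradP vg')).
Qed.

End Xgradient.

(** * The growth function and a dense sequence of its arguments *)

Lemma continuous_norm_powR (R : realType) (p : R) : 0 < p ->
  continuous (fun x : R => `|x| `^ p).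
Proof.
move=> p0 x; have [->|x0] := eqVneq x 0.
  apply/cvgrPdist_lt => e e0.
  have e1 : 0 < e `^ p^-1 by rewrite powR_gt0.
  have h : \forall y \near (0:R), `|0 - y| < e `^ p^-1.
    by have /cvgrPdist_lt/(_ _ e1) := @cvg_id _ (nbhs (0:R)).
  move: h; apply: filterS => y; rewrite sub0r normrN => ye.
  rewrite normr0 powR0 ?gt_eqF// sub0r normrN ger0_norm ?powR_ge0//.
  rewrite -[ltRHS](powRr1 (ltW e0)) -(mulVf (negbT (gt_eqF p0))) powRrM.
  by apply: gt0_ltr_powR => //; rewrite ?nnegrE ?powR_ge0.
have c : {for x, continuous (fun y : R => expR (p * ln `|y|))}.
  apply: (@continuous_comp _ _ _ (fun y : R => p * ln `|y|) expR); last exact: continuous_expR.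
  apply: continuousM; first exact: cst_continuous.
  apply: (@continuous_comp _ _ _ (fun y : R => `|y|) (@ln R)); first exact: norm_continuous.
  by apply: continuous_ln; rewrite normr_gt0.
rewrite /continuous_at (_ : `|x| `^ p = expR (p * ln `|x|)); last first.
  by rewrite /powR normr_eq0 (negbTE x0).
apply: cvg_trans c; apply: near_eq_cvg.
have : \forall y \near x, y != 0 by exact: open_neq.
by apply: filterS => y y0; rewrite /powR normr_eq0 (negbTE y0).
Qed.

Section enorm.
Context (R : realType) (m : nat).
Implicit Types v : 'rV[R]_m.

Lemma enorm_ge0 v : 0 <= enorm v.
Proof. exact: sqrtr_ge0. Qed.

Lemma normr_coord_le v j : `|v ord0 j| <= `|v|.
Proof.
by rewrite [leRHS]mx_normrE; exact: (le_bigmax _ (fun ij => `|v ij.1 ij.2|) (ord0, j)).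
Qed.

Lemma mx_norm_le v (r : R) : 0 <= r -> (forall j, `|v ord0 j| <= r) -> `|v| <= r.
Proof.
move=> r0 h; rewrite [leLHS]mx_normrE; apply/bigmax_leP; split => // -[i j] _ /=.
by rewrite (ord1 i : i = ord0) h.
Qed.

Lemma norm_le_enorm v : `|v| <= enorm v.
Proof.
apply: mx_norm_le => [|j]; first exact: enorm_ge0.
rewrite -sqrtr_sqr ler_sqrt ?sumr_ge0// => [|k _]; last exact: sqr_ge0.
by rewrite (bigD1 j)//= lerDl sumr_ge0// => k _; exact: sqr_ge0.
Qed.

Lemma enorm_le_norm v : enorm v <= m%:R * `|v|.
Proof.
have h0 : 0 <= m%:R * `|v| by rewrite mulr_ge0.
rewrite -[leRHS](ger0_norm h0) -sqrtr_sqr ler_sqrt ?sqr_ge0//.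
apply: (@le_trans _ _ (\sum_(j < m) `|v| ^+ 2)).
  apply: ler_sum => j _; rewrite -[v _ _ ^+ 2]ger0_norm ?sqr_ge0// normrX.
  by rewrite lerXn2r ?nnegrE// normr_coord_le.
rewrite sumr_const card_ord -[leLHS]mulr_natl exprMn ler_wpM2r ?sqr_ge0//.
rewrite -natrX ler_nat; case: (m) => // k; by rewrite expnS leq_pmulr.
Qed.

Lemma continuous_enorm : continuous (@enorm R m).
Proof.
move=> v; apply: (@continuous_comp _ _ _ (fun v : 'rV[R]_m => \sum_(j < m) v ord0 j ^+ 2)
  (@Num.sqrt R)); last exact: sqrt_continuous.
have S (s : seq 'I_m) : {for v, continuous (fun v : 'rV[R]_m => \sum_(j <- s) v ord0 j ^+ 2)}.
  elim: s => [|j s IH].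
    rewrite (_ : (fun _ => _) = cst 0); first exact: cst_continuous.
    by apply/funext => y; rewrite big_nil.
  rewrite (_ : (fun _ => _) = ((fun v : 'rV[R]_m => v ord0 j) \* (fun v => v ord0 j)) \+
     (fun v => \sum_(j <- s) v ord0 j ^+ 2)); last first.
    by apply/funext => y; rewrite big_cons expr2.
  by apply: continuousD => //; apply: continuousM; exact: coord_continuous.
exact: S.
Qed.

End enorm.

Section growth_function.
Context (R : realType) (m : nat) (p c1 c2 : R).
Hypothesis p0 : 0 < p.
Hypothesis hc1 : 0 <= c1.
Hypothesis hc2 : 0 <= c2.
Local Notation Z := (R * 'rV[R]_m)%type.

Definition growth_fun (z : Z) : R := c1 * enorm z.2 `^ p + c2 * `|z.1| `^ p.
Definition growth_cst : R := c1 * m%:R `^ p + c2.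

Lemma growth_cst_ge0 : 0 <= growth_cst.
Proof. by rewrite addr_ge0// mulr_ge0// powR_ge0. Qed.

Lemma growth_fun_ge0 z : 0 <= growth_fun z.
Proof. by rewrite addr_ge0// mulr_ge0// powR_ge0. Qed.

Lemma growth_fun_le z : growth_fun z <= growth_cst * `|z| `^ p.
Proof.
have p0' := ltW p0.
have z1 : `|z.1| <= `|z| by rewrite prod_normE le_max lexx.
have z2 : `|z.2| <= `|z| by rewrite prod_normE le_max lexx orbT.
rewrite mulrDl lerD//; last by rewrite ler_wpM2l// le_powR.
rewrite -mulrA ler_wpM2l// -powRM// le_powR ?enorm_ge0//.
by rewrite (le_trans (enorm_le_norm _))// ler_wpM2l.
Qed.

Lemma continuous_growth_fun : continuous growth_fun.
Proof.
have E : growth_fun = fun z : Z => c1 * `|enorm z.2| `^ p + c2 * `|z.1| `^ p.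
  by apply/funext => z; rewrite /growth_fun (ger0_norm (enorm_ge0 _)).
rewrite E => z.
apply: (@continuousD _ _ _ (fun z : Z => c1 * `|enorm z.2| `^ p) (fun z => c2 * `|z.1| `^ p)).
  apply: (@continuousM _ _ (cst c1) (fun z : Z => `|enorm z.2| `^ p)); first exact: cst_continuous.
  apply: (@continuous_comp _ _ _ (fun z : Z => enorm z.2) (fun x : R => `|x| `^ p)).
    apply: (@continuous_comp _ _ _ (fun z : Z => z.2) (@enorm R m)); first exact: cvg_snd.
    exact: continuous_enorm.
  exact: continuous_norm_powR.
apply: (@continuousM _ _ (cst c2) (fun z : Z => `|z.1| `^ p)); first exact: cst_continuous.
apply: (@continuous_comp _ _ _ (fun z : Z => z.1) (fun x : R => `|x| `^ p)); first exact: cvg_fst.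
exact: continuous_norm_powR.
Qed.

(** Index 0 is set aside for the origin, so that the nearest points of a map are
    dominated by twice its norm. *)
Definition rat_point (k : nat) : Z :=
  if k is k'.+1 then
    if (unpickle k' : option (rat * 'rV[rat]_m)) is Some rv then
      (ratr rv.1, map_mx ratr rv.2) else 0
  else 0.

Lemma rat_point_dense z (e : R) : 0 < e -> exists k, `|z - rat_point k| < e.
Proof.
case: z => [u v] e0; have e20 : 0 < e / 2 by rewrite divr_gt0.
have [|r] := @rat_in_itvoo R u (u + e / 2); first by rewrite ltrDl.
rewrite in_itv/= => /andP[r1 r2].
have [|w wP] := @rat_row_between R m v (v + const_mx (e / 2)).
  by move=> i; rewrite !mxE ltrDl.
exists (pickle (r, w)).+1; rewrite /rat_point pickleK prod_normE gt_max /=.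
apply/andP; split.
  by rewrite distrC gtr0_norm ?subr_gt0// ltrBlDl (lt_trans r2)// ltrD2l ltr_pdivrMr// mulr_natr mulr2n ltrDl.
apply: (@le_lt_trans _ _ (e / 2)); last by rewrite ltr_pdivrMr// mulr_natr mulr2n ltrDl.
apply: mx_norm_le => [|j]; first exact: ltW.
rewrite !mxE; have := wP j; rewrite !mxE => /andP[w1 w2].
by rewrite distrC gtr0_norm ?subr_gt0// lerBlDl ltW.
Qed.

End growth_function.

(** * Lebesgue and Sobolev norms *)

Section Lebesgue_space.
Context (R : realType) (n : nat) (Omega : set 'rV[R]_n).
Hypothesis Omega_open : open Omega.
Local Notation mu := (leb R n).
Variable p : R.
Hypothesis p0 : 0 < p.

Let mO : measurable (Omega : set (rVleb R n)) := open_measurable_leb Omega_open.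

Lemma Lp_norm_poweR (v : 'rV[R]_n -> R) :
  (Lp_norm Omega p v `^ p = \int[mu]_(x in Omega) (`|v x| `^ p)%:E)%E.
Proof.
rewrite /Lp_norm poweR_Lnorm ?gt_eqF// [RHS]integral_mkcond.
apply: eq_integral => x _; rewrite patchE /= patchE.
by case: ifP => // _; rewrite normr0 powR0 ?gt_eqF.
Qed.

Lemma Lp_norm_ge0 (v : 'rV[R]_n -> R) : (0 <= Lp_norm Omega p v)%E.
Proof. exact: Lnorm_ge0. Qed.

Lemma measurable_norm_powR (v : 'rV[R]_n -> R) :
  measurable_fun (Omega : set (rVleb R n)) v ->
  measurable_fun (Omega : set (rVleb R n)) (fun x => `|v x| `^ p).
Proof.
move=> mv; apply: (measurableT_comp (measurable_powR p)).
exact: (measurableT_comp _ mv).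
Qed.

Lemma integrable_Lp (v : 'rV[R]_n -> R) :
  measurable_fun (Omega : set (rVleb R n)) v -> (Lp_norm Omega p v < +oo)%E ->
  mu.-integrable Omega (EFin \o (fun x => `|v x| `^ p) : rVleb R n -> \bar R).
Proof.
move=> mv vp; apply/integrableP; split.
  by apply/measurable_EFinP; exact: measurable_norm_powR.
rewrite (eq_integral (fun x : rVleb R n => (`|v x| `^ p)%:E)).
  by rewrite -Lp_norm_poweR poweR_lty.
by move=> x _ /=; rewrite ger0_norm// powR_ge0.
Qed.

Lemma Lp_norm_small (e : R) : 0 < e -> exists2 d : R, 0 < d &
  forall v, (Lp_norm Omega p v < d%:E)%E ->
    \int[mu]_(x in Omega) (`|v x| `^ p) <= e.
Proof.
move=> e0; exists (e `^ p^-1); first by rewrite powR_gt0.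
move=> v vd; have v0 := Lp_norm_ge0 v.
have h : (Lp_norm Omega p v `^ p <= e%:E)%E.
  rewrite -[e](powRr1 (ltW e0)) -(mulVf (negbT (gt_eqF p0))) powRrM -poweR_EFin.
  apply: gt0_ler_poweR; rewrite ?(ltW p0)// ?in_itv/= ?leey ?v0//; last exact: ltW.
  by rewrite lee_fin powR_ge0.
have hfin : (Lp_norm Omega p v `^ p)%E \is a fin_num.
  by rewrite ge0_fin_numE ?poweR_ge0// (le_lt_trans h)// ltry.
by rewrite -lee_fin /Rintegral -Lp_norm_poweR fineK.
Qed.

Lemma eq_ae_Lp_norm (v v' : 'rV[R]_n -> R) :
  measurable_fun (Omega : set (rVleb R n)) v ->
  measurable_fun (Omega : set (rVleb R n)) v' ->
  {ae mu, forall x, Omega x -> v x = v' x} -> Lp_norm Omega p v = Lp_norm Omega p v'.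
Proof.
move=> mv mv' vv'.
have rootK f : Lp_norm Omega p f = ((Lp_norm Omega p f `^ p) `^ p^-1)%E.
  by rewrite -poweRrM divff ?gt_eqF// poweRe1// Lp_norm_ge0.
rewrite (rootK v) (rootK v') !Lp_norm_poweR; congr (_ `^ _)%E.
apply: ae_eq_integral => //; [exact/measurable_EFinP/measurable_norm_powR..|].
by apply: ae_leb_imp vv' => x h Ox; rewrite h.
Qed.

Lemma ae_eq_Rintegral (A : set 'rV[R]_n) (f g : 'rV[R]_n -> R) :
  measurable (A : set (rVleb R n)) ->
  measurable_fun (A : set (rVleb R n)) f -> measurable_fun (A : set (rVleb R n)) g ->
  {ae mu, forall x, A x -> f x = g x} -> \int[mu]_(x in A) f x = \int[mu]_(x in A) g x.
Proof.
move=> mA mf mg fg; congr fine; apply: ae_eq_integral => //; [exact/measurable_EFinP..|].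
by apply: ae_leb_imp fg => x h Ox; rewrite h.
Qed.

Lemma Lp_norm_eq0 (v : 'rV[R]_n -> R) :
  measurable_fun (Omega : set (rVleb R n)) v ->
  {ae mu, forall x, Omega x -> v x = 0} -> Lp_norm Omega p v = 0%E.
Proof.
move=> mv v0; rewrite (@eq_ae_Lp_norm v (cst 0))//.
apply: (@poweR_eq0_eq0 _ _ p); rewrite ?Lp_norm_ge0// Lp_norm_poweR.
by apply: integral0_eq => x _; rewrite normr0 powR0 ?gt_eqF.
Qed.

End Lebesgue_space.

Lemma measurable_bigmax d (T : measurableType d) (R : realType) (D : set T)
    (I : finType) (F : I -> T -> R) : (forall i, measurable_fun D (F i)) ->
  measurable_fun D (fun x => \big[Num.max/0]_i F i x).
Proof.
move=> mF; elim: (index_enum I) => [|i s IH].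
  rewrite (_ : (fun _ => _) = cst 0); first exact: measurable_cst.
  by apply/funext => x; rewrite big_nil.
rewrite (_ : (fun _ => _) = (fun x => Num.max (F i x) (\big[Num.max/0]_(i <- s) F i x))).
  exact: measurable_maxr.
by apply/funext => x; rewrite big_cons.
Qed.

Section Sobolev_pairs.
Context (R : realType) (m n : nat) (Omega : set 'rV[R]_n).
Hypothesis Omega_open : open Omega.
Hypothesis Omega_bounded : bounded_set Omega.
Variable C : 'rV[R]_n -> 'M[R]_(m, n).
Hypothesis C_lip : forall j i, [lipschitz C x j i | x in Omega].
Variable p : R.
Hypothesis p0 : 0 < p.
Local Notation mu := (leb R n).
Local Notation Z := (R * 'rV[R]_m)%type.
Local Notation mfun := (measurable_fun (Omega : set (rVleb R n))).

Let mO : measurable (Omega : set (rVleb R n)) := open_measurable_leb Omega_open.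

(** All that an integral functional sees of u. *)
Definition jet (u : 'rV[R]_n -> R) (x : 'rV[R]_n) : Z := (u x, Xgrad Omega C u x).

Lemma measurable_norm_pair (v : 'rV[R]_n -> R) (g : 'rV[R]_n -> 'rV[R]_m) :
  mfun v -> (forall j, mfun (fun x => g x ord0 j)) -> mfun (fun x => `|(v x, g x) : Z|).
Proof.
move=> mv mg; rewrite (_ : (fun _ => _) = (fun x => Num.max `|v x| `|g x|)); last first.
  by apply/funext => x; rewrite prod_normE.
apply: measurable_maxr; first exact: (measurableT_comp _ mv).
rewrite (_ : (fun _ => _) = (fun x => \big[Num.max/0]_ij `|g x ij.1 ij.2|)); last first.
  by apply/funext => x; rewrite [LHS]mx_normrE.
by apply: measurable_bigmax => -[i j] /=; rewrite (ord1 i : i = ord0); exact: (measurableT_comp _ (mg j)).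
Qed.

Lemma measurable_enorm (g : 'rV[R]_n -> 'rV[R]_m) :
  (forall j, mfun (fun x => g x ord0 j)) -> mfun (fun x => enorm (g x)).
Proof.
move=> mg; apply: (measurableT_comp (f := @Num.sqrt R)).
  by apply: continuous_measurable_fun; exact: sqrt_continuous.
by apply: measurable_sum => j; apply: measurable_funX; exact: mg.
Qed.

(** [W1p] provides some X-gradient in L^p; the chosen one agrees with it almost
    everywhere. *)
Lemma W1p_Xgrad u : W1p Omega C p u ->
  [/\ in_Lp Omega p u, is_Xgrad Omega C u (Xgrad Omega C u) &
      in_Lp_vec Omega p (Xgrad Omega C u)].
Proof.
move=> [Lu [g [ug [mg Lg]]]]; have uX := XgradP ug.
have mX j : mfun (fun x => Xgrad Omega C u x ord0 j) by have [_ /(_ j)[]] := uX.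
split=> //; split=> //; rewrite (@eq_ae_Lp_norm _ _ _ Omega_open _ p0 _ (@enorm R m \o g))//.
- exact: measurable_enorm.
- exact: measurable_enorm.
- have := ae_XgradE Omega_open ug.
  by apply: ae_leb_imp => x h Ox /=; rewrite h.
Qed.

Lemma norm_pair_powR_le (v : R) (g : 'rV[R]_m) :
  `|(v, g) : Z| `^ p <= `|v| `^ p + `|enorm g| `^ p.
Proof.
rewrite prod_normE /= (ger0_norm (enorm_ge0 _)); case: (leP `|v| `|g|) => _.
  by rewrite (le_trans (le_powR (ltW p0) _ (norm_le_enorm g)))// lerDr powR_ge0.
by rewrite lerDl powR_ge0.
Qed.

Lemma Lpmap_jet u : W1p Omega C p u ->
  Lpmap mu (Omega : set (rVleb R n)) (@rat_point R m) p (jet u : rVleb R n -> Z).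
Proof.
move=> /W1p_Xgrad[[mu_ Lu] _ [mg Lg]]; split=> [k|].
  apply: (@measurable_norm_pair (fun x => u x - (rat_point R m k).1)
    (fun x => Xgrad Omega C u x - (rat_point R m k).2)).
    exact: measurable_funB.
  move=> j; under eq_fun do rewrite !mxE; exact: measurable_funB.
apply: (@le_integrable_fin _ (rVleb R n) R mu Omega mO (fun x => `|jet u x| `^ p) (fun x => `|u x| `^ p + `|enorm (Xgrad Omega C u x)| `^ p)).
- apply: (measurableT_comp (measurable_powR p)).
  exact: (measurable_norm_pair mu_ mg).
- by move=> x Ox; rewrite ger0_norm ?powR_ge0// norm_pair_powR_le.
- apply: (integrable_finD mO); first exact: (integrable_Lp p0 mu_ Lu).
  exact: (integrable_Lp p0 (measurable_enorm mg) Lg).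
Qed.

Lemma measurable_jet_dist u v : W1p Omega C p u -> W1p Omega C p v ->
  mfun (fun x => `|jet u x - jet v x|).
Proof.
move=> /W1p_Xgrad[[mu_ _] _ [mg _]] /W1p_Xgrad[[mv _] _ [mg' _]].
apply: (@measurable_norm_pair (fun x => u x - v x)
    (fun x => Xgrad Omega C u x - Xgrad Omega C v x)).
  exact: measurable_funB.
by move=> j; under eq_fun do rewrite !mxE; exact: measurable_funB.
Qed.

(** The norm on the left is that of the X-gradient of u - v, which has to be
    compared with the difference of the X-gradients. *)
Lemma W1p_norm_small (e : R) : 0 < e -> exists2 d : R, 0 < d &
  forall u v, W1p Omega C p u -> W1p Omega C p v ->
    (W1p_norm Omega C p (u \- v)%R < d%:E)%E ->
    \int[mu]_(x in Omega) (`|jet u x - jet v x| `^ p) <= e.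
Proof.
move=> e0; have e20 : 0 < e / 2 by rewrite divr_gt0.
have [d d0 dP] := Lp_norm_small Omega p0 e20; exists d => // u v Wu Wv uvd.
have [[mu_ Lu] uX [mg Lg]] := W1p_Xgrad Wu; have [[mv Lv] vX [mg' Lg']] := W1p_Xgrad Wv.
have n1 := Lp_norm_ge0 Omega p (u \- v).
have n2 := Lp_norm_ge0 Omega p (@enorm R m \o Xgrad Omega C (u \- v)).
have h1 : (Lp_norm Omega p (u \- v)%R < d%:E)%E.
  by apply: le_lt_trans uvd; rewrite leeDl.
have h2 : (Lp_norm Omega p (@enorm R m \o Xgrad Omega C (u \- v)%R) < d%:E)%E.
  by apply: le_lt_trans uvd; rewrite leeDr.
have mB : mfun (u \- v) by exact: measurable_funB.
have uvX := XgradP (is_XgradB Omega_open Omega_bounded C_lip uX vX).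
have mXj j : mfun (fun x => Xgrad Omega C (u \- v) x ord0 j) by have [_ /(_ j)[]] := uvX.
have mX : mfun (@enorm R m \o Xgrad Omega C (u \- v)) by exact: measurable_enorm.
have i1 := integrable_Lp p0 mB (lt_trans h1 (ltry _)).
have i2 := integrable_Lp p0 mX (lt_trans h2 (ltry _)).
apply: (@le_trans _ _ (\int[mu]_(x in Omega) (`|(u \- v) x| `^ p) +
   \int[mu]_(x in Omega) (`|(@enorm R m \o Xgrad Omega C (u \- v)) x| `^ p))).
  rewrite -RintegralD//.
  have mp : mfun (fun x => `|((u \- v) x, Xgrad Omega C (u \- v) x) : Z|).
    exact: (measurable_norm_pair mB mXj).
  have E : \int[mu]_(x in Omega) (`|jet u x - jet v x| `^ p) =
      \int[mu]_(x in Omega) (`|((u \- v) x, Xgrad Omega C (u \- v) x) : Z| `^ p).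
    apply: (ae_eq_Rintegral mO (measurableT_comp (measurable_powR p) (measurable_jet_dist Wu Wv))
       (measurableT_comp (measurable_powR p) mp)).
    have := ae_XgradB Omega_open Omega_bounded C_lip uX vX.
    by apply: ae_leb_imp => x h Ox /=; rewrite h.
  have i12 := integrable_finD mO i1 i2.
  rewrite E; apply: (le_Rintegral mO _ i12); last by move=> x _; exact: norm_pair_powR_le.
  apply: (@le_integrable_fin _ (rVleb R n) R mu Omega mO _ _ _ _ i12).
    exact: (measurableT_comp (measurable_powR p) mp).
  by move=> x _; rewrite (ger0_norm (powR_ge0 _ _)); exact: norm_pair_powR_le.
by rewrite [leRHS]splitr; exact: (lerD (dP _ h1) (dP _ h2)).
Qed.

End Sobolev_pairs.

(** * Gamma-limits of functionals with convex integrands *)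

Section integrands.
Context (R : realType) (m n : nat) (Omega : set 'rV[R]_n).
Hypothesis Omega_open : open Omega.
Hypothesis Omega_bounded : bounded_set Omega.
Variable C : 'rV[R]_n -> 'M[R]_(m, n).
Hypothesis C_lip : forall j i, [lipschitz C x j i | x in Omega].
Variable p : R.
Hypothesis p0 : 0 < p.
Variable a : 'rV[R]_n -> R.
Hypothesis ha : (leb R n).-integrable Omega (EFin \o a : rVleb R n -> \bar R).
Variables c1 c2 : R.
Hypothesis hc1 : 0 <= c1.
Hypothesis hc2 : 0 <= c2.
Local Notation mu := (leb R n).
Local Notation Z := (R * 'rV[R]_m)%type.
Local Notation q := (@rat_point R m).
Local Notation G := (@growth_fun R m p c1 c2).
Local Notation jet := (jet Omega C).
Local Notation adm := (admissible (Omega : set (rVleb R n)) G (fun x => `|a x|)).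

Let mO : measurable (Omega : set (rVleb R n)) := open_measurable_leb Omega_open.

Lemma integrable_abs_a : mu.-integrable Omega (EFin \o (fun x => `|a x|) : rVleb R n -> \bar R).
Proof. exact: (integrable_abse ha). Qed.

Lemma le_of_rat_point (f : Z -> \bar R) (b : R) : continuous f ->
  (forall k, f (q k) <= (b + G (q k))%:E)%E -> forall z, (f z <= (b + G z)%:E)%E.
Proof.
move=> cf fq z.
have qz : (fun M => nearest q z M) @ \oo --> z.
  by apply: nearest_cvg => e; exact: rat_point_dense.
have h1 : f (nearest q z M) @[M --> \oo] --> f z by exact: (cvg_comp _ _ qz (cf z)).
have h2 : (b + G (nearest q z M))%:E @[M --> \oo] --> (b + G z)%:E.
  apply: cvg_EFin; first exact: nearW.
  apply: cvgD; first exact: cvg_cst.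
  exact: (cvg_comp _ _ qz (@continuous_growth_fun R m p c1 c2 p0 z)).
rewrite -(cvg_lim _ h1)// -(cvg_lim _ h2)//; apply: lee_lim.
- exact: (cvgP _ h1).
- exact: (cvgP _ h2).
- apply: nearW => M; suff [k ->] : exists k, nearest q z M = q k by exact: fq.
  elim: M => [|M [k IH]]; first by exists 0.
  by rewrite [nearest _ _ _]/=; case: ifP => _; [exists M.+1|exists k].
Qed.

(** The growth bound is given for each z off a null set depending on z. Imposed at
    the countably many points [rat_point k] it holds off one null set N, and
    extends to all z by continuity. Setting the integrand to 0 on N makes it
    finite, convex and bounded everywhere, without changing the integrals. The
    bound uses |a| because a may be negative on a null set. *)
Lemma class_V_admissible F : class_V Omega C p a c1 c2 F ->
  exists2 phi : 'rV[R]_n -> Z -> R, adm phi &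
  forall u A, W1p Omega C p u -> open A -> A `<=` Omega ->
    F u A = (\int[mu]_(x in A) phi x (jet u x))%:E.
Proof.
move=> [f [f0 [mf cf] gf vf FE]].
have gq : {ae mu, forall x, forall k, Omega x ->
    (f x (q k).1 (q k).2 <= (a x + G (q k))%:E)%E}.
  apply: ae_foralln => k; have := gf (q k).1 (q k).2.
  by apply: ae_leb_imp => x h /h; rewrite addrA.
have [N [mN N0 subN]] := ae_leb_imp2 (fun x => @conj _ _) (ae_leb_imp2 (fun x => @conj _ _) cf vf) gq.
have bnd x z : Omega x -> ~ N x -> (f x z.1 z.2 <= (a x + G z)%:E)%E.
  move=> Ox Nx; have [[cx _] gx] := contrapT (fun h => Nx (subN x h)).
  apply: (le_of_rat_point (f := fun z => f x z.1 z.2)); first exact: cx.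
  by move=> k; exact: gx.
pose phi (x : 'rV[R]_n) (z : Z) := fine (f x z.1 z.2) * \1_(~` N) x.
have phiE x z : Omega x -> ~ N x -> f x z.1 z.2 = (phi x z)%:E.
  move=> Ox Nx; rewrite /phi indicE mem_set// mulr1 fineK//.
  by rewrite ge0_fin_numE ?f0// (le_lt_trans (bnd x z Ox Nx))// ltry.
have phiN x z : N x -> phi x z = 0.
  by move=> Nx; rewrite /phi indicE memNset ?mulr0//; exact.
have adm_phi : adm phi.
  split=> [z|x Ox].
    apply: measurable_funM; last exact: measurable_indic (measurableC mN).
    exact: measurableT_comp _ (mf z.1 z.2).
  have [Nx|Nx] := pselect (N x).
    split=> [t y z _|z]; first by rewrite !phiN// !mulr0 addr0.
    by rewrite phiN// lexx addr_ge0// growth_fun_ge0.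
  have [[_ vx] _] := contrapT (fun h => Nx (subN x h)).
  split=> [t y z t01|z].
    rewrite -lee_fin EFinD (EFinM t) (EFinM (1 - t)) -!phiE//; exact: vx.
  rewrite -!lee_fin -phiE// f0//= (le_trans (bnd x z Ox Nx))// lee_fin lerD2r.
  exact: ler_norm.
exists phi => // u A Wu oA AO.
have Lu := Lpmap_jet Omega_open p0 Wu.
have mA : measurable (A : set (rVleb R n)) by exact: open_measurable_leb.
have iphi := integrable_comp_admissible mO (@rat_point_dense R m) p0 (growth_cst_ge0 m p hc1 hc2)
   (growth_fun_le p0 hc1 hc2) (fun x _ => normr_ge0 (a x)) integrable_abs_a adm_phi Lu mA AO.
have mphi := measurable_int _ iphi.
rewrite FE// /Rintegral fineK; last exact: (integrable_fin_num mA iphi).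
have E : ae_eq mu (A : set (rVleb R n)) (EFin \o (fun x => phi x (jet u x)))
   (fun x => f x (u x) (Xgrad Omega C u x)).
  exists N; split => // x /= h; apply: contrapT => Nx; apply: h => Ax.
  by rewrite -(phiE x (jet u x))//; exact: AO.
apply: ae_eq_integral => //; last exact: ae_eq_sym.
apply: (ae_measurable_fun _ E) => //.
exact: measure_is_complete_caratheodory.
Qed.

(** At (0, 0) the growth condition reads 0 <= f x 0 0 <= a x. *)
Lemma class_V_a_ge0 F : class_V Omega C p a c1 c2 F ->
  {ae mu, forall x, Omega x -> 0 <= a x}.
Proof.
move=> [f [f0 _ gf _ _]]; have := gf 0 0.
apply: ae_leb_imp => x h Ox; have := le_trans (f0 x 0 0 Ox) (h Ox).
have -> : enorm (0 : 'rV[R]_m) = 0.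
  by rewrite /enorm big1 ?sqrtr0// => j _; rewrite mxE expr0n.
by rewrite normr0 powR0 ?gt_eqF// !mulr0 !addr0 lee_fin.
Qed.

(** The limit integrand is continuous in its second argument because it is convex
    with finite growth. *)
Lemma admissible_class_V (phi : 'rV[R]_n -> Z -> R) :
  {ae mu, forall x, Omega x -> 0 <= a x} -> adm phi ->
  class_V Omega C p a c1 c2 (fun u A => (\int[mu]_(x in A) (phi x (jet u x))%:E)%E).
Proof.
move=> a0 [mphi phiP]; exists (fun x u eta => (phi x (u, eta))%:E); split.
- by move=> x u eta Ox; rewrite lee_fin; have [_ /(_ (u, eta))/andP[]] := phiP x Ox.
- split=> [u eta|]; first by apply/measurable_EFinP; exact: mphi.
  apply: aeW => x Ox z; have [cx bx] := phiP x Ox.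
  have cphi := convex_continuous (ltW p0) (growth_cst_ge0 m p hc1 hc2)
    (growth_fun_le p0 hc1 hc2) (normr_ge0 (a x)) cx bx.
  rewrite (_ : (fun z : Z => (phi x (z.1, z.2))%:E) = EFin \o phi x); last first.
    by apply/funext => -[].
  by apply: cvg_EFin; [exact: nearW|exact: cphi].
- move=> u eta; apply: ae_leb_imp a0 => x a0 Ox.
  have [_ /(_ (u, eta))/andP[_]] := phiP x Ox.
  by rewrite lee_fin ger0_norm ?a0// addrA.
- apply: aeW => x Ox t u v xi eta t01; have [cx _] := phiP x Ox.
  by rewrite -!EFinM -EFinD lee_fin; exact: (cx t (u, xi) (v, eta) t01).
- by [].
Qed.

Lemma W1p_norm_subrr u : W1p Omega C p u -> W1p_norm Omega C p (u \- u) = 0%E.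
Proof.
move=> /(W1p_Xgrad Omega_open p0)[[mu_ _] uX _].
have uuX := XgradP (is_XgradB Omega_open Omega_bounded C_lip uX uX).
rewrite /W1p_norm (Lp_norm_eq0 Omega_open p0 (measurable_funB mu_ mu_)); last first.
  by apply: aeW => x _ /=; rewrite subrr.
rewrite (Lp_norm_eq0 Omega_open p0) ?adde0//.
  by apply: measurable_enorm => j; have [_ /(_ j)[]] := uuX.
have := ae_XgradB Omega_open Omega_bounded C_lip uX uX.
apply: ae_leb_imp => x h Ox /=; rewrite h// subrr /enorm big1 ?sqrtr0// => j _.
by rewrite mxE expr0n.
Qed.

Lemma approx_cst u : W1p Omega C p u -> Defs.approx Omega C p u (fun=> u).
Proof.
move=> Wu; split=> //; rewrite /W1p_cvg W1p_norm_subrr//; exact: cvg_cst.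
Qed.

(** Convergence in W_X^{1,p} is L^p convergence of the jets, and the integrals are
    equicontinuous in the jet uniformly in h. *)
Lemma cvg_integral_approx (phi : nat -> 'rV[R]_n -> Z -> R) (l : R)
    (A : set 'rV[R]_n) u us : (forall h, adm (phi h)) -> open A -> A `<=` Omega ->
  W1p Omega C p u -> Defs.approx Omega C p u us ->
  (fun h => \int[mu]_(x in A) phi h x (jet u x)) @ \oo --> l ->
  (fun h => \int[mu]_(x in A) phi h x (jet (us h) x)) @ \oo --> l.
Proof.
move=> adm_phi oA AO Wu [Wus usu] philim.
have mA : measurable (A : set (rVleb R n)) by exact: open_measurable_leb.
apply/cvgrPdist_le => e e0; have e20 : 0 < e / 2 by rewrite divr_gt0.
have [r r0 rP] := equicontinuous_admissible mO (@rat_point_dense R m) p0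
  (growth_cst_ge0 m p hc1 hc2) (growth_fun_le p0 hc1 hc2)
  (fun x _ => normr_ge0 (a x)) integrable_abs_a (Lpmap_jet Omega_open p0 Wu) e20.
have [d d0 dP] := W1p_norm_small Omega_open Omega_bounded C_lip p0 r0.
have usd : \forall h \near \oo, (W1p_norm Omega C p (us h \- u)%R < d%:E)%E.
  apply: (usu [set y | (y < d%:E)%E]); apply: open_nbhs_nbhs; split.
    exact: open_ereal_lt_ereal.
  by rewrite /= lte_fin.
move/cvgrPdist_le : philim => /(_ _ e20).
apply: filterS2 usd => h usd lh.
rewrite (le_trans (ler_distD (\int[mu]_(x in A) phi h x (jet u x)) _ _))//.
rewrite [leRHS]splitr; apply: (lerD lh); rewrite distrC.
exact: (rP _ _ A (adm_phi h) (Lpmap_jet Omega_open p0 (Wus h))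
  (measurable_jet_dist Omega_open p0 (Wus h) Wu) (dP _ _ (Wus h) Wu usd) mA AO).
Qed.

(** Along every approximating sequence both the lower and the upper limit equal
    Ginf u, and the constant sequence shows that such sequences exist: the infima
    are taken over a singleton. *)
Lemma Gamma_lim_of_cvg (G : nat -> ('rV[R]_n -> R) -> \bar R) (Ginf : ('rV[R]_n -> R) -> \bar R) :
  (forall u us, W1p Omega C p u -> Defs.approx Omega C p u us ->
    (fun h => G h (us h)) @ \oo --> Ginf u) -> Gamma_lim Omega C p G Ginf.
Proof.
move=> GP u Wu.
have E (L : (\bar R)^nat -> \bar R) :
    (forall us, Defs.approx Omega C p u us -> L (fun h => G h (us h)) = Ginf u) ->
    ereal_inf [set L (fun h => G h (us h)) | us in Defs.approx Omega C p u] = Ginf u.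
  move=> LE; rewrite (_ : [set _ | _ in _] = [set Ginf u]) ?ereal_inf1//.
  apply/seteqP; split=> [_ [us ap <-]|_ ->]; first exact: LE.
  by exists (fun=> u); [exact: approx_cst|exact: LE (approx_cst Wu)].
by split; apply: E => us ap; have [h1 h2] := cvg_limn_einf_sup (GP u us Wu ap).
Qed.

End integrands.

Theorem theorem4p3 (R : realType) (m n : nat) (hm : (0 < m)%N) (hmn : (m <= n)%N)
    (Omega : set 'rV[R]_n) (Omega_open : open Omega)
    (Omega_bounded : bounded_set Omega)
    (C : 'rV[R]_n -> 'M[R]_(m, n))
    (C_lip : forall j i, [lipschitz C x j i | x in Omega])
    (C_LIC : LIC Omega C)
    (p : R) (hp : 1 <= p)
    (a : 'rV[R]_n -> R)
    (ha : (leb R n).-integrable Omega (EFin \o a : rVleb R n -> \bar R))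
    (c1 c2 : R) (hc1 : 0 <= c1) (hc2 : 0 <= c2)
    (F : nat -> functional R n)
    (hF : forall h, class_V Omega C p a c1 c2 (F h)) :
  exists (k : nat -> nat) (Finf : functional R n),
    [/\ {homo k : i j / (i < j)%N},
        class_V Omega C p a c1 c2 Finf &
        forall A : set 'rV[R]_n, open A -> A `<=` Omega ->
          Gamma_lim Omega C p (fun i u => F (k i) u A) (fun u => Finf u A)].
Proof.
have p0 : 0 < p by exact: lt_le_trans hp.
have mO : measurable (Omega : set (rVleb R n)) := open_measurable_leb Omega_open.
have /choice[phi phiP] : forall h, exists phi : 'rV[R]_n -> R * 'rV[R]_m -> R,
    admissible (Omega : set (rVleb R n)) (@growth_fun R m p c1 c2) (fun x => `|a x|) phi /\
    forall u A, W1p Omega C p u -> open A -> A `<=` Omega ->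
      F h u A = (\int[leb R n]_(x in A) phi x (jet Omega C u x))%:E.
  move=> h; have [f fa fE] := class_V_admissible Omega_open p0 ha hc1 hc2 (hF h).
  by exists f.
have ia := integrable_abs_a ha.
have Sd E : measurable (E : set (rVleb R n)) -> E `<=` Omega -> forall e : R, 0 < e ->
    exists k, (leb R n (Omega `&` ((E `\` rat_boxes k) `|` (rat_boxes k `\` E))) < e%:E)%E.
  move=> mE EO e e0.
  have Eoo : (leb R n E < +oo)%E.
    by apply: le_lt_trans (bounded_leb_lty mO Omega_bounded); apply: le_measure; rewrite ?inE.
  have [k kE] := rat_boxes_dense mE Eoo e0; exists k; apply: le_lt_trans kE.
  have mk : measurable (rat_boxes k : set (rVleb R n)) := @rat_boxes_measurable R n k.
  have mS : measurable ((E `\` rat_boxes k) `|` (rat_boxes k `\` E) : set (rVleb R n)).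
    by apply: measurableU; exact: measurableD.
  by apply: le_measure; rewrite ?inE//; exact: measurableI.
have [k kh [phi' phi'a phi'P]] := @admissible_compactness _ (rVleb R n) R (@leb_sf R n) Omega mO
  (bounded_leb_lty mO Omega_bounded) (@rat_boxes R n) (@rat_boxes_measurable R n)
  Sd
  _ (@rat_point R m) erefl (@rat_point_dense R m) p _ _ _ p0
  (growth_cst_ge0 m p hc1 hc2) (growth_fun_ge0 p hc1 hc2) (growth_fun_le p0 hc1 hc2)
  (@continuous_growth_fun R m p c1 c2 p0) (fun x _ => normr_ge0 (a x)) ia
  phi (fun h => (phiP h).1).
pose Finf u A := (\int[leb R n]_(x in A) (phi' x (jet Omega C u x))%:E)%E.
exists k, Finf; split => //.
  have a_ge0 := class_V_a_ge0 p0 (hF 0).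
  exact: (admissible_class_V C p0 hc1 hc2 a_ge0 phi'a).
move=> A oA AO; apply: Gamma_lim_of_cvg => // u us Wu us_u.
have mA : measurable (A : set (rVleb R n)) by exact: open_measurable_leb.
have i' := integrable_comp_admissible mO (@rat_point_dense R m) p0
  (growth_cst_ge0 m p hc1 hc2) (growth_fun_le p0 hc1 hc2)
  (fun x _ => normr_ge0 (a x)) ia phi'a (Lpmap_jet Omega_open p0 Wu) mA AO.
have -> : Finf u A = (\int[leb R n]_(x in A) phi' x (jet Omega C u x))%:E.
  by rewrite /Rintegral fineK//; exact: (integrable_fin_num mA i').
rewrite (_ : (fun h => F (k h) (us h) A) =
    EFin \o (fun h => \int[leb R n]_(x in A) phi (k h) x (jet Omega C (us h) x))); last first.
  by apply/funext => h /=; apply: (phiP (k h)).2 => //; exact: us_u.1.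
apply: cvg_EFin; first exact: nearW.
apply: (cvg_integral_approx Omega_open Omega_bounded C_lip p0 ha hc1 hc2
  (fun h => (phiP (k h)).1) oA AO Wu us_u).
exact: (phi'P _ _ (Lpmap_jet Omega_open p0 Wu) mA AO).
Qed.
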